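(* Let $r\ge3$ and let $F_1=K_{1,1,1,t_4,\ldots,t_{r+1}}$, where $1\le t_4\le\cdots\le t_{r+1}$ are integers. For all sufficiently large $n$, $$\mathrm{EX}_{r+1,\rho}(n,F_1)=\{Y_r(n)\}$$ (up to isomorphism).
   Context: All graphs are finite and simple. $K_{a_1,\ldots,a_m}$ is the complete multipartite graph with parts of sizes $a_1,\ldots,a_m$. $T_{n,r}$ is the Turán graph, i.e. the balanced complete $r$-partite graph of order $n$. A graph $G$ is non-$r$-partite if its chromatic number satisfies $\chi(G)>r$; it is $F$-free if it has no (not necessarily induced) subgraph isomorphic to $F$. $\mathrm{EX}_{r+1,\rho}(n,F)$ is the family of non-$r$-partite $F$-free graphs of order $n$ attaining the maximum adjacency spectral radius among all non-$r$-partite $F$-free graphs of order $n$. Definition of $Y_r(n)$: let $T_1,\ldots,T_r$ be the parts of $T_{n,r}$, labeled so that $|T_1|\le\cdots\le|T_r|$. Choose distinct vertices $u,w\in T_r$ and a vertex $v\in T_1$. Starting with $T_{n,r}$, add the edge $uw$, delete all edges between $\{u,w\}$ and $T_1$, and then add the edges $uv$ and $wz$ for every $z\in T_1\setminus\{v\}$. The resulting graph is $Y_r(n)$. Equivalently: start with $T_{n-1,r}$, choose one vertex in each of its two smallest parts, delete the edge between these two vertices, and add a new vertex adjacent to these two vertices and to every vertex in the remaining $r-2$ parts. *)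

(* Defs.v *)
From mathcomp Require Import all_boot all_order all_algebra.
From mathcomp Require Import classical_sets reals.
From mathcomp.real_closed Require Import complex.

Set Implicit Arguments.
Unset Strict Implicit.
Unset Printing Implicit Defensive.

Import GRing.Theory.

(* -------------------------- Simple graphs -------------------------- *)

Record sgraph := SGraph {
  vertex :> finType;
  edge : rel vertex;
  edge_sym : symmetric edge;
  edge_irr : irreflexive edge }.

Section OfRel.
Variables (T : finType) (e : rel T).

Definition simple_rel : rel T := [rel x y | (x != y) && (e x y || e y x)].

Lemma simple_rel_sym : symmetric simple_rel.
Proof. by move=> x y; rewrite /simple_rel /= eq_sym orbC. Qed.

Lemma simple_rel_irr : irreflexive simple_rel.
Proof. by move=> x; rewrite /simple_rel /= eqxx. Qed.

(* The simple graph whose edges are the pairs {x, y}, x != y, with e x y or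
   e y x. *)
Definition graph_of_rel : sgraph := SGraph simple_rel_sym simple_rel_irr.

End OfRel.

Definition isomorphic (G H : sgraph) : Prop :=
  exists2 f : G -> H, bijective f & forall x y, edge (f x) (f y) = edge x y.

(* Not necessarily induced. *)
Definition has_subgraph (F G : sgraph) : Prop :=
  exists2 f : F -> G, injective f & forall x y, edge x y -> edge (f x) (f y).

Definition free (F G : sgraph) : Prop := ~ has_subgraph F G.

Definition colorable (G : sgraph) (k : nat) : bool :=
  [exists f : {ffun G -> 'I_k},
    [forall x, forall y, edge x y ==> (f x != f y)]].

Lemma colorable_card (G : sgraph) : exists k, colorable G k.
Proof.
exists #|G|; apply/existsP; exists [ffun x => enum_rank x].
apply/forallP => x; apply/forallP => y; apply/implyP => exy.
rewrite !ffunE; apply: contraTneq exy => /enum_rank_inj ->.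
by rewrite edge_irr.
Qed.

Definition chromatic_number (G : sgraph) : nat := ex_minn (colorable_card G).

(* ------------------------- Spectral radius ------------------------- *)

Definition adjacency (R : realType) (G : sgraph) : 'M[R]_#|G| :=
  (\matrix_(i, j) (edge (enum_val i) (enum_val j))%:R)%R.

(* Largest modulus of a complex eigenvalue. The set of eigenvalues is finite,
   so the supremum is a maximum; it is 0 for the empty matrix. *)
Definition spectral_radius (R : realType) (n : nat) (A : 'M[R]_n) : R :=
  sup [set ComplexField.Normc.normc z | z in
        [set z : R[i] | eigenvalue (map_mx (real_complex R) A) z]]%classic.

(* ---------------------------- Extremal family ---------------------- *)

Definition admissible (r n : nat) (F G : sgraph) : Prop :=
  [/\ #|G| = n, r < chromatic_number G & free F G].

(* Membership in EX_{r+1,rho}(n, F): the index r stands for "non-r-partite". *)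
Definition EX_rho (R : realType) (r n : nat) (F G : sgraph) : Prop :=
  admissible r n F G /\
  forall H : sgraph, admissible r n F H ->
    (spectral_radius (adjacency R H) <= spectral_radius (adjacency R G))%R.

(* ------------------ Multipartite graphs and Y_r(n) ----------------- *)

(* A vertex is a pair of the index of its part and a position in that part. *)
Definition complete_multipartite (m : nat) (a : m.-tuple nat) : sgraph :=
  graph_of_rel [rel x y : {i : 'I_m & 'I_(tnth a i)} | tag x != tag y].

(* The part T_(i+1) has floor((n + i) / r) vertices: for r > 0 these r numbers
   are nondecreasing in i, differ by at most 1, and sum to n. *)
Definition turan (n r : nat) : sgraph :=
  complete_multipartite [tuple (n + i) %/ r | i < r].

Definition part (n r : nat) (x : turan n r) : 'I_r := tag x.

Section Y.
Variables (n r : nat) (u w v : turan n r).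

(* u, w are distinct vertices of the last (largest) part T_r and v is a vertex
   of the first (smallest) part T_1. *)
Definition Y_choice : Prop :=
  [/\ part u = r.-1 :> nat, part w = r.-1 :> nat, u != w & part v = 0 :> nat].

Definition in_T1 : pred (turan n r) := [pred z | part z == 0 :> nat].

Definition Y_deleted : rel (turan n r) :=
  [rel x z | (x \in [:: u; w]) && in_T1 z].

Definition Y_added : rel (turan n r) :=
  [rel x z | [|| (x == u) && (z == w), (x == u) && (z == v) |
                 [&& x == w, in_T1 z & z != v]]].

Definition Y_graph : sgraph :=
  graph_of_rel [rel x y | [&& edge x y, ~~ Y_deleted x y & ~~ Y_deleted y x]
                          || Y_added x y].

End Y.

Lemma card_turan (n r : nat) : 0 < r -> #|turan n r| = n.
Proof.
move=> r_gt0; rewrite card_tagged sumnE big_map big_enum /=.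
under eq_bigr do rewrite card_ord tnth_mktuple.
elim: n => [|n IHn].
  by rewrite big1 // => i _; rewrite add0n divn_small.
case: r r_gt0 IHn => // r _.
rewrite big_ord_recl addn0 => IHn; rewrite big_ord_recr /=.
have -> : (n.+1 + r) %/ r.+1 = (n %/ r.+1).+1.
  by rewrite addSnnS divnDr ?dvdnn // divnn addn1.
rewrite addnS -[in RHS]IHn addnC; congr (_ + _).+1.
by apply: eq_bigr => i _; rewrite addSnnS.
Qed.

(* Y_graph is only defined up to the choice of u, w, v (and up to isomorphism it
   does not depend on it), so a statement about Y_r(n) quantifies over all
   choices; this lemma shows that such a statement is not vacuous. *)
Lemma Y_choice_exists (n r : nat) :
  0 < r -> r.*2 <= n -> exists u w v : turan n r, Y_choice u w v.
Proof.
move=> r_gt0 le_rn.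
have r1 : r.-1 < r by rewrite prednK.
have sz (i : 'I_r) : 1 < tnth [tuple (n + i) %/ r | i < r] i.
  rewrite tnth_mktuple leq_divRL // mul2n.
  exact: leq_trans le_rn (leq_addr _ _).
pose x (i : 'I_r) b : turan n r :=
  Tagged (fun i => 'I_(tnth [tuple (n + i) %/ r | i < r] i))
    (Ordinal (leq_ltn_trans (leq_b1 b) (sz i))).
exists (x (Ordinal r1) false), (x (Ordinal r1) true), (x (Ordinal r_gt0) true).
by split=> //; rewrite -tag_eqE /tag_eq eqxx /= tagged_asE.
Qed.

(* Main.v *)
Require Import Defs.
From mathcomp Require Import classical_sets reals.
From mathcomp Require boolp.
From mathcomp Require Import all_boot all_order all_algebra.
From mathcomp Require Import perm spectral sesquilinear.
From mathcomp.real_closed Require Import complex.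
From mathcomp Require Import ring lra zify.

Set Implicit Arguments.
Unset Strict Implicit.
Unset Printing Implicit Defensive.

Import Order.TTheory GRing.Theory Num.Theory.

(** Let G be extremal on n vertices, rho its spectral radius, x its Perron
    vector scaled to maximum 1 and q = n / r. Throughout, the spectral radius is
    used through two facts: the Rayleigh bound [rayleigh] and the existence of
    x, [perron].

    The graph Y_r(n) needs r + 1 colours and contains no K_{r+1}, whereas every
    F_1 contains K_{r+1}. Hence Y_r(n) is admissible, and the all-one vector
    shows rho >= n - q - 1 ([Y_admissible], [Y_rho]).

    Stability. A graph without K_{1,1,1,t,...,t} (r - 2 parts of size t) whose
    minimum degree is close to n - n / r is r-partite ([min_degree_colorable]):
    it contains a large complete r-partite graph, each vertex sees few vertices
    of some part of it, and these parts serve as colours up to few vertices, which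
    are recoloured afterwards. Deleting a vertex of least Perron weight costs little spectral radius
    when some degree is small, so a graph with rho >= n - q - 1 loses only few
    vertices before its minimum degree is large; what remains is r-partite and
    nearly complete between the classes ([dense_core]).

    One critical vertex. Give a vertex d as neighbourhood all core vertices
    outside the class of d. No copy of F_1 arises, so if G - d is not r-partite
    the new graph competes with G, and x d must be nearly 1. If that happened
    for the vertex z of least weight, all degrees would be large and G would be
    r-partite. So G - z is r-partite ([exists_critical]).

    Exact structure. For an r-colouring c of all vertices but u, let
    [yrel c u w v] be the complete r-partite graph on the other vertices minus
    the edge w v, with u joined to w, to v and to all classes but those of w and
    v; Y_r(n) is of this form. All these graphs with c w <> c v and classes not
    too small are admissible. Comparing G with those that rewire z and one other
    vertex ([compare_degrees]) shows that rho x is about n - 2 q at z and about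
    n - q elsewhere. Therefore, if z had several neighbours in the two classes
    that it sees least, trading these edges for edges between the classes would
    increase the Rayleigh quotient: G is itself some [yrel c z w v]
    ([critical_structure]).

    Class sizes. Moving one vertex of such a graph to another class cannot
    increase rho. For test vectors that are constant on the classes away from
    u, w and v, the optimum is explicit and the comparison becomes an inequality
    between two class sizes ([move_le]). It forces the classes of w and v to be
    the smallest two, up to ties, and all sizes to differ by at most 1, which
    determines the graph up to isomorphism ([extremal_balanced], [yrel_iso]).

    The converse direction follows because an extremal graph exists
    ([extremal_exists]) and is isomorphic to Y_r(n). *)

(** * The spectral radius: Rayleigh bound and Perron vector *)

Section SpectralRadius.
Variable R : realType.
Local Open Scope ring_scope.
Local Open Scope sesquilinear_scope.

Section Matrix.
Variables (n : nat) (A : 'M[R]_n.+1).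
Hypotheses (symA : A^T = A) (posA : forall i j, 0 <= A i j).

Local Notation B := (map_mx (real_complex R) A).
Local Notation P := (spectralmx B).
Local Notation d := (spectral_diag B).
Local Notation rho := (spectral_radius A).
Local Notation normc := (@ComplexField.Normc.normc R).

Let normcE (z : R[i]) : (normc z)%:C%C = `|z|. Proof. by []. Qed.

Let hermB : B \is hermsymmx.
Proof.
apply: realsym_hermsym; last first.
  by apply/mxOverP => i j; rewrite mxE; apply/complex_realP; exists (A i j).
by apply/is_hermitianmxP; rewrite expr0 scale1r map_mx_id // map_trmx symA.
Qed.

Let PK : P^t* *m P = 1%:M.
Proof. by rewrite -invmx_unitary ?spectral_unitarymx // mulVmx ?spectral_unit. Qed.

Let PK' : P *m P^t* = 1%:M.
Proof. by apply/unitarymxP/spectral_unitarymx. Qed.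

Let BE : B = P^t* *m diag_mx d *m P.
Proof.
rewrite -invmx_unitary ?spectral_unitarymx //.
exact/orthomx_spectralP/hermitian_normalmx/hermB.
Qed.

Let PB : P *m B = diag_mx d *m P.
Proof. by rewrite [X in _ *m X]BE !mulmxA PK' mul1mx. Qed.

Let row_eigen k : row k P *m B = d 0 k *: row k P.
Proof. by rewrite -row_mul PB row_mul row_diag_mx -scalemxAl -rowE. Qed.

Let row_neq0 k : row k P != 0.
Proof.
apply: contra_neq (oner_neq0 R[i]) => r0.
have := congr1 (fun M : 'M_n.+1 => row k M) PK'.
rewrite row_mul r0 mul0mx => /(congr1 (fun v : 'rV_n.+1 => v 0 k)).
by rewrite !mxE eqxx.
Qed.

Let eigen_d k : eigenvalue B (d 0 k).
Proof. by apply/eigenvalueP; exists (row k P). Qed.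

Let eigen_inv z : eigenvalue B z -> exists k, z = d 0 k.
Proof.
case/eigenvalueP => v vB v0; pose c := v *m P^t*.
have vE : v = c *m P by rewrite -mulmxA PK mulmx1.
have c0 : c != 0 by apply: contra_neq v0 => c0; rewrite vE c0 mul0mx.
have cd : c *m diag_mx d = z *: c.
  by rewrite /c scalemxAl -vB [X in _ = v *m X *m _]BE !mulmxA -!(mulmxA _ P) PK' mulmx1.
have /rV0Pn[k ck] := c0.
exists k; apply: (mulIf ck); have /matrixP/(_ 0 k) := cd.
by rewrite mul_mx_diag !mxE => <-; rewrite mulrC.
Qed.

Local Notation E := ([set ComplexField.Normc.normc z | z in
        [set z : R[i] | eigenvalue (map_mx (real_complex R) A) z]]%classic).

Let kmax := [arg max_(k > ord0 : 'I_n.+1) normc (d 0 k)]%O.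

Let kmaxP k : normc (d 0 k) <= normc (d 0 kmax).
Proof. by rewrite /kmax; case: arg_maxP => // i _; apply. Qed.

Let rhoE : rho = normc (d 0 kmax).
Proof.
have ubE : ubound E (normc (d 0 kmax)).
  by move=> _ [z /eigen_inv[k ->] <-]; apply: kmaxP.
have Ek : E (normc (d 0 kmax)) by exists (d 0 kmax) => //; apply: eigen_d.
apply/eqP; rewrite eq_le; apply/andP; split.
  by apply: ge_sup => //; exists (normc (d 0 kmax)).
by apply: ub_le_sup => //; exists (normc (d 0 kmax)).
Qed.

(** Diagonalise A over the complex numbers: A is unitarily similar to a
    diagonal matrix, all of whose entries have modulus at most rho. *)
Lemma rayleigh_mx (x : 'rV[R]_n.+1) :
  (x *m A *m x^T) 0 0 <= rho * (x *m x^T) 0 0.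
Proof.
pose v : 'rV[R[i]]_n.+1 := map_mx (real_complex R) x.
pose c := v *m P^t*.
have vE : v = c *m P by rewrite -mulmxA PK mulmx1.
have vt : v^t* = v^T.
  by apply/matrixP => i j; rewrite !mxE; apply: conj_Creal; apply/complex_realP; eexists.
have e1 : (v *m v^T) 0 0 = \sum_k `|c 0 k| ^+ 2.
  rewrite -vt {1}vE {1}vE trmx_mul map_mxM !mulmxA -(mulmxA c) PK' mulmx1 mxE.
  by apply: eq_bigr => k _; rewrite !mxE normCK.
have e2 : (v *m B *m v^T) 0 0 = \sum_k d 0 k * `|c 0 k| ^+ 2.
  rewrite [X in v *m X *m _]BE -vt !mulmxA -/c mul_mx_diag -mulmxA.
  have -> : P *m v^t* = c^t* by rewrite /c trmx_mul map_mxM trmxCK.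
  rewrite mxE; apply: eq_bigr => k _.
  by rewrite !mxE normCK mulrCA mulrA.
rewrite -lecR rmorphM /=.
have -> : ((x *m A *m x^T) 0 0)%:C%C = (v *m B *m v^T) 0 0.
  by rewrite /v map_trmx -!map_mxM [RHS]mxE.
have -> : ((x *m x^T) 0 0)%:C%C = (v *m v^T) 0 0.
  by rewrite /v map_trmx -map_mxM [RHS]mxE.
rewrite e1 e2 mulr_sumr; apply: ler_sum => k _; apply: ler_wpM2r.
  by rewrite exprn_ge0.
have dr : d 0 k \is Num.real by have /mxOverP := hermitian_spectral_diag_real hermB.
by rewrite (le_trans (real_ler_norm dr)) // -normcE lecR rhoE kmaxP.
Qed.

(** Take moduli in an eigenvector for an eigenvalue of largest modulus. The
    triangle inequality only gives an inequality, which suffices: the vector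
    then attains the Rayleigh bound, see [form_kernel]. *)
Lemma perron_mx : exists2 x : 'rV[R]_n.+1, x != 0 &
  forall j, 0 <= x 0 j /\ rho * x 0 j <= (x *m A) 0 j.
Proof.
pose u := row kmax P; exists (\row_j normc (u 0 j)).
  have /rV0Pn[j uj] := row_neq0 kmax; apply/rV0Pn; exists j.
  by rewrite mxE; apply: contra_neq uj; apply: ComplexField.Normc.eq0_normc.
move=> j; rewrite [(\row_j _) 0 j]mxE; split; first by rewrite -ler0c normcE.
rewrite -lecR rmorphM /= rhoE !normcE -normrM.
have := congr1 (fun w : 'rV_n.+1 => w 0 j) (row_eigen kmax).
rewrite -/u mxE [in RHS]mxE => <-; rewrite mxE.
apply: (le_trans (ler_norm_sum _ _ _)).
rewrite rmorph_sum /=; apply: ler_sum => i _.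
rewrite [X in u 0 i * X]mxE normrM [(\row_j _) 0 i]mxE rmorphM /= normcE.
by rewrite (ger0_norm (x := (A i j)%:C%C)) // ler0c.
Qed.

End Matrix.

Definition qform (T : finType) (e : rel T) (y : T -> R) : R :=
  \sum_a \sum_b (e a b)%:R * (y a * y b).

Section Form.
Variables (T : finType) (e : rel T).
Hypothesis (symE : symmetric e).

(** A vector attaining the Rayleigh bound is an eigenvector: the form rho I
    - A is nonnegative and vanishes at x, so its first variation at x vanishes.
    The direction tested is the residual w of the eigenvalue equation. *)
Lemma form_kernel (rho : R) (x : T -> R) :
  (forall y, qform e y <= rho * \sum_a y a ^+ 2) ->
  rho * \sum_a x a ^+ 2 <= qform e x ->
  forall a, rho * x a = \sum_(b | e a b) x b.
Proof.
move=> ray xx a.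
pose w a := (\sum_(b | e a b) x b) - rho * x a.
pose W := \sum_a w a ^+ 2.
pose Qw := rho * \sum_a w a ^+ 2 - qform e w.
have Qw0 : 0 <= Qw by rewrite subr_ge0 ray.
have key s : 0 <= - 2 * s * W + s ^+ 2 * Qw.
  have := ray (fun a => x a + s * w a).
  have -> : qform e (fun a => x a + s * w a) =
    qform e x + 2 * s * (\sum_a w a * \sum_(b | e a b) x b) + s ^+ 2 * qform e w.
    have e1 : \sum_a \sum_b (e a b)%:R * (w a * x b) = \sum_a w a * \sum_(b | e a b) x b.
      apply: eq_bigr => b _; rewrite mulr_sumr [RHS]big_mkcond.
      by apply: eq_bigr => c _; case: e; rewrite ?mul1r ?mul0r.
    have e2 : \sum_a \sum_b (e a b)%:R * (x a * w b) = \sum_a w a * \sum_(b | e a b) x b.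
      rewrite -e1 exchange_big; apply: eq_bigr => b _; apply: eq_bigr => c _.
      by rewrite symE [x c * _]mulrC.
    have -> : 2 * s * (\sum_a w a * \sum_(b | e a b) x b) =
      s * (\sum_a w a * \sum_(b | e a b) x b) + s * (\sum_a w a * \sum_(b | e a b) x b).
      by ring.
    rewrite -{1}e1 -e2.
    rewrite /qform !mulr_sumr -!big_split /=; apply: eq_bigr => b _.
    by rewrite !mulr_sumr -!big_split /=; apply: eq_bigr => c _; ring.
  have -> : \sum_a (x a + s * w a) ^+ 2 =
    \sum_a x a ^+ 2 + 2 * s * \sum_a x a * w a + s ^+ 2 * W.
    rewrite /W !mulr_sumr -!big_split /=; apply: eq_bigr => b _; ring.
  have -> : \sum_a w a * \sum_(b | e a b) x b = W + rho * \sum_a x a * w a.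
    rewrite /W mulr_sumr -big_split /=; apply: eq_bigr => b _; rewrite /w; ring.
  move: xx; rewrite /Qw -/W; lra.
(* The choice s = W / (Qw + 1) makes the quadratic in s negative unless W = 0. *)
have W0 : W = 0.
  have Wp : 0 <= W by apply: sumr_ge0 => b _; apply: sqr_ge0.
  have Q1 : 0 < Qw + 1 by lra.
  have := key (W / (Qw + 1)); set s := W / _.
  have sW : s * (Qw + 1) = W by rewrite /s divfK // gt_eqF.
  have s0 : 0 <= s by rewrite /s divr_ge0 // ltW.
  have -> : - 2 * s * W + s ^+ 2 * Qw = - s * W - s ^+ 2 by rewrite -sW; ring.
  have : 0 <= s * W by rewrite mulr_ge0.
  have := sqr_ge0 s => h1 h2 h3.
  have : s ^+ 2 = 0 by lra.
  by move/eqP; rewrite sqrf_eq0 => /eqP s00; rewrite -sW s00 mul0r.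
have /eqP := W0; rewrite psumr_eq0; last by move=> b _; apply: sqr_ge0.
by move/allP/(_ a); rewrite mem_index_enum sqrf_eq0 subr_eq0 => /(_ isT)/eqP.
Qed.

End Form.

Variable G : sgraph.
Local Notation rho := (spectral_radius (adjacency R G)).

Lemma qformE (T : finType) (e : rel T) (y : T -> R) :
  qform e y = \sum_a y a * \sum_(b | e a b) y b.
Proof.
apply: eq_bigr => b _; rewrite mulr_sumr [RHS]big_mkcond.
by apply: eq_bigr => c _; case: e; rewrite ?mul1r ?mul0r.
Qed.

Lemma sum_enum_val (F : G -> R) : \sum_(i < #|G|) F (enum_val i) = \sum_a F a.
Proof. by rewrite -(big_enum_val F). Qed.

Lemma spectral_radius_cast m n (e : m = n) (M : 'M[R]_m) :
  spectral_radius (castmx (e, e) M) = spectral_radius M.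
Proof. by case: n / e; rewrite castmx_id. Qed.

Section NonEmpty.
Variable (n : nat) (cardG : #|G| = n.+1).

Local Notation A := (castmx (cardG, cardG) (adjacency R G)).

Let AE i j : A i j = (edge (enum_val (cast_ord (esym cardG) i))
                       (enum_val (cast_ord (esym cardG) j)))%:R.
Proof. by rewrite castmxE mxE. Qed.

Let rhoE : rho = spectral_radius A.
Proof. by rewrite spectral_radius_cast. Qed.

Let sumE (F : G -> R) :
  \sum_(i < n.+1) F (enum_val (cast_ord (esym cardG) i)) = \sum_a F a.
Proof.
rewrite -sum_enum_val [RHS](reindex (cast_ord (esym cardG))) //=.
by exists (cast_ord cardG) => i _; rewrite ?cast_ordK ?cast_ordKV.
Qed.

Let symA : A^T = A.
Proof. by apply/matrixP => i j; rewrite mxE !AE edge_sym. Qed.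

Let posA i j : 0 <= A i j.
Proof. by rewrite AE ler0n. Qed.

Let formE (y : G -> R) (v := \row_i y (enum_val (cast_ord (esym cardG) i))) :
  (v *m A *m v^T) 0 0 = qform (@edge G) y.
Proof.
rewrite qformE -sumE mxE; apply: eq_bigr => i _.
rewrite !mxE mulrC; congr (_ * _).
rewrite [RHS]big_mkcond -sumE; apply: eq_bigr => j _.
by rewrite mxE AE edge_sym; case: edge; rewrite ?mulr1 ?mulr0.
Qed.

Let normE (y : G -> R) (v := \row_i y (enum_val (cast_ord (esym cardG) i))) :
  (v *m v^T) 0 0 = \sum_a y a ^+ 2.
Proof.
by rewrite -(sumE (fun a => y a ^+ 2)) mxE; apply: eq_bigr => i _; rewrite !mxE expr2.
Qed.

Let ray (y : G -> R) : qform (@edge G) y <= rho * \sum_a y a ^+ 2.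
Proof. by rewrite rhoE -formE -normE; apply: rayleigh_mx. Qed.

Let per : exists x : G -> R,
  [/\ forall a, 0 <= x a, exists a, 0 < x a &
      forall a, rho * x a = \sum_(b | edge a b) x b].
Proof.
have [v v0 vP] := perron_mx symA posA.
pose x a := v 0 (cast_ord cardG (enum_rank a)).
have xv i : x (enum_val (cast_ord (esym cardG) i)) = v 0 i.
  by rewrite /x enum_valK cast_ordKV.
have vx : v = \row_i x (enum_val (cast_ord (esym cardG) i)).
  by apply/rowP => i; rewrite mxE xv.
exists x; split; first by move=> a; case: (vP (cast_ord cardG (enum_rank a))).
  have /rV0Pn[j vj] := v0; exists (enum_val (cast_ord (esym cardG) j)).
  by rewrite xv lt0r vj; case: (vP j).
apply: form_kernel => [a b|y|]; [exact: edge_sym|exact: ray|].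
rewrite -formE -normE -vx mxE [X in _ <= X]mxE mulr_sumr.
apply: ler_sum => j _; rewrite mulrA [v^T j 0]mxE; apply: ler_wpM2r.
  by case: (vP j).
by rewrite rhoE; case: (vP j).
Qed.

(** The diagonalisation is stated for matrices of size n.+1, hence the
    casts. *)
Lemma spectral_facts : (forall y, qform (@edge G) y <= rho * \sum_a y a ^+ 2) /\
  exists x : G -> R,
  [/\ forall a, 0 <= x a, forall a, x a <= 1, exists a, x a = 1 &
      forall a, rho * x a = \sum_(b | edge a b) x b].
Proof.
split; first exact: ray.
have [x [x0 [a0 xa0] xE]] := per.
pose m := x [arg max_(a > a0) x a]%O.
have mP a : x a <= m by rewrite /m; case: arg_maxP => // b _; apply.
have m0 : 0 < m := lt_le_trans xa0 (mP a0).
exists (fun a => x a / m); split.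
- by move=> a; rewrite divr_ge0 // ltW.
- by move=> a; rewrite ler_pdivrMr // mul1r.
- by exists [arg max_(a > a0) x a]%O; rewrite divff // gt_eqF.
- by move=> a; rewrite mulrA xE mulr_suml.
Qed.

End NonEmpty.

Theorem rayleigh : (0 < #|G|)%N -> forall y : G -> R,
  qform (@edge G) y <= rho * \sum_a y a ^+ 2.
Proof. by move=> G0; have [] := spectral_facts (esym (prednK G0)). Qed.

Theorem perron : (0 < #|G|)%N -> exists x : G -> R,
  [/\ forall a, 0 <= x a, forall a, x a <= 1, exists a, x a = 1 &
      forall a, rho * x a = \sum_(b | edge a b) x b].
Proof. by move=> G0; have [] := spectral_facts (esym (prednK G0)). Qed.

End SpectralRadius.

(** * Embedding complete multipartite graphs *)

Lemma multipartite_embed m (a : m.-tuple nat) (G : sgraph) (U : 'I_m -> {set G}) :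
  (forall i, tnth a i <= #|U i|) ->
  (forall i j : 'I_m, i < j -> {in U i & U j, forall x y, edge x y}) ->
  has_subgraph (complete_multipartite a) G.
Proof.
move=> aU Ue.
pose f (p : complete_multipartite a) : G := enum_val (widen_ord (aU (tag p)) (tagged p)).
have fU p : f p \in U (tag p) by apply: enum_valP.
have fe (p q : complete_multipartite a) : tag p != tag q -> edge (f p) (f q).
  rewrite neq_ltn => /orP[pq|pq]; first by apply: Ue pq _ _ _ _.
  by rewrite edge_sym; apply: Ue pq _ _ _ _.
exists f => [p q fpq|p q /andP[_]]; last first.
  by case/orP => pq; [exact: fe | rewrite edge_sym; apply: fe].
have [tpq|/fe] := eqVneq (tag p) (tag q); last by rewrite fpq edge_irr.
case: p q fpq tpq => [i p] [j q] /= fpq ij; case: _ / ij q fpq => q.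
by move=> /enum_val_inj/(congr1 val)/= /val_inj ->.
Qed.

Lemma exists_subset (T : finType) (A : {set T}) k :
  k <= #|A| -> exists2 B : {set T}, B \subset A & #|B| = k.
Proof.
move=> kA; exists [set x in take k (enum A)].
  by apply/subsetP => x; rewrite inE => /mem_take; rewrite mem_enum.
rewrite cardsE (card_uniqP _) ?take_uniq ?enum_uniq // size_takel //.
by rewrite -cardE.
Qed.

Lemma card_bigcup_le (T I : finType) (A : {set I}) (F : I -> {set T}) m :
  (forall i, i \in A -> #|F i| <= m) -> #|\bigcup_(i in A) F i| <= #|A| * m.
Proof.
move=> Fm; rewrite -sum_nat_const.
elim/big_rec2: _ => [|i n B iA IH]; first by rewrite cards0.
by rewrite (leq_trans (leq_card_setU _ _)) // leq_add // Fm.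
Qed.

Section Embed.
Variables (T : finType) (e : rel T).

(** Choose the t vertices of the first set arbitrarily, remove their at
    most t * m non-neighbours from each of the other sets, and continue. *)
Lemma greedy m t k (U : nat -> {set T}) :
  (forall i j, i < k -> j < k -> i != j ->
     forall a, a \in U i -> #|[set b in U j | ~~ e a b]| <= m) ->
  (forall i, i < k -> t + k * (t * m) <= #|U i|) ->
  exists B : nat -> {set T}, (forall i, i < k -> B i \subset U i /\ #|B i| = t) /\
   (forall i j, i < j < k -> {in B i & B j, forall a b, e a b}).
Proof.
elim: k U => [|k IH] U Um Ut; first by exists U; split=> // i j; rewrite ltn0 andbF.
have [B0 B0U B0t] : exists2 B0 : {set T}, B0 \subset U 0 & #|B0| = t.
  by apply: exists_subset; apply: leq_trans (Ut 0 _) => //; apply: leq_addr.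
pose bad i := \bigcup_(a in B0) [set b in U i | ~~ e a b].
have badm i : 0 < i < k.+1 -> #|bad i| <= t * m.
  move=> /andP[i0 ik]; rewrite -B0t; apply: card_bigcup_le => a aB.
  by apply: (Um 0 i) => //; [rewrite eq_sym -lt0n | apply: (subsetP B0U)].
pose U' i := U i.+1 :\: bad i.+1.
have U'U i : U' i \subset U i.+1 by apply: subsetDl.
have [|i ik|B [BU Be]] := IH U'.
- move=> i j ik jk ij a aU; apply: leq_trans (Um i.+1 j.+1 _ _ _ a _) => //.
    apply: subset_leq_card; apply/subsetP => b; rewrite !inE.
    by case/andP => /andP[_ ->].
  exact: (subsetP (U'U i)).
- have := Ut i.+1 ik; have := badm i.+1 ik; rewrite mulSn.
  have : #|U i.+1| <= #|U' i| + #|bad i.+1|.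
    rewrite -(cardsID (bad i.+1) (U i.+1)) addnC leq_add2l.
    exact: subset_leq_card (subsetIr _ _).
  lia.
exists (fun i => if i is i'.+1 then B i' else B0); split.
  case=> [//|i] ik; have [BiU Bit] := BU i ik; split=> //.
  exact: subset_trans BiU (U'U i).
case=> [|i] [|j] // ijk a b aB bB; last by apply: Be aB bB.
have := subsetP (BU j ijk).1 b bB; rewrite inE => /andP[/bigcupP nb bU].
by apply: contraT => nab; case: nb; exists a => //; rewrite inE bU.
Qed.

(** Absence of K_{1,1,1,t,...,t}, with r - 2 parts of size t. The sets of
    size t are given as a function on nat to avoid ordinals of varying size. *)
Definition tame r t := forall x y w (B : nat -> {set T}),
  e x y -> e x w -> e y w ->
  (forall i, i < r - 2 -> t <= #|B i|) ->
  (forall i v, i < r - 2 -> v \in B i -> [&& e x v, e y v & e w v]) ->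
  (forall i j, i < j < r - 2 -> {in B i & B j, forall a b, e a b}) -> False.

Definition near_complete r (V : 'I_r -> {set T}) m :=
  forall l l', l != l' -> forall a, a \in V l -> #|[set b in V l' | ~~ e a b]| <= m.

Variables (r t m : nat) (V : 'I_r -> {set T}).
Hypotheses (r2 : 1 < r) (t0 : 0 < t) (tameT : tame r t) (nearV : near_complete V m).
Hypothesis (symE : symmetric e).

Let Th := t + r * (t * m).

(** Otherwise the common neighbourhoods of x, y and w in the r - 2 other
    classes are large, and [greedy] completes the triangle to the forbidden
    graph. *)
Lemma embed_triangle i j x y w : i != j -> e x y -> e x w -> e y w ->
  exists l, [/\ l != i, l != j & #|[set v in V l | [&& e x v, e y v & e w v]]| < Th].
Proof.
move=> ij xy xw yw.
case: (pickP [pred l | [&& l != i, l != j & #|[set v in V l | [&& e x v, e y v & e w v]]| < Th]]).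
  by move=> l /and3P[? ? ?]; exists l.
move=> no.
have big l : l != i -> l != j -> Th <= #|[set v in V l | [&& e x v, e y v & e w v]]|.
  by move=> li lj; have := no l; rewrite /= li lj /= ltnNge => /negbFE.
pose s := [seq l <- enum 'I_r | (l != i) && (l != j)].
have ss : size s = (r - 2)%N.
  have sE : size s = #|~: [set i; j]|.
    rewrite cardE /s; congr size; rewrite enumT /enum_mem.
    by apply: eq_filter => l; rewrite !inE negb_or.
  by have := cardsC [set i; j]; rewrite cards2 ij card_ord sE; lia.
have us : uniq s by rewrite filter_uniq ?enum_uniq.
pose U k := [set v in V (nth i s k) | [&& e x v, e y v & e w v]].
have sP k : k < r - 2 -> (nth i s k != i) && (nth i s k != j).
  by rewrite -ss => /(mem_nth i); rewrite mem_filter => /andP[].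
have [k k' kr kr' kk' a|k kr|B [BU Be]] := @greedy m t (r - 2) U.
- rewrite inE => /andP[aV _].
  apply: leq_trans (nearV (l' := nth i s k') _ aV); last first.
    by rewrite nth_uniq ?ss.
  by apply: subset_leq_card; apply/subsetP => b; rewrite !inE => /andP[/andP[-> _]].
- have /andP[ki kj] := sP k kr; apply: leq_trans (big _ ki kj).
  by rewrite leq_add2l leq_mul2r leq_subr orbT.
case: (tameT xy xw yw (B := B)) => [k kr|k v kr vB|//].
  by have [_ ->] := BU k kr.
by have [/subsetP/(_ _ vB) + _] := BU k kr; rewrite inE => /andP[].
Qed.

(** If all classes but i contained many common neighbours, one of them, w,
    would form a triangle x y w that contradicts [embed_triangle]: w misses at
    most m vertices of the class found there. *)
Lemma embed_edge i x y : e x y ->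
  exists2 l, l != i & #|[set v in V l | e x v && e y v]| < Th + m.
Proof.
move=> xy.
case: (pickP [pred l | (l != i) && (#|[set v in V l | e x v && e y v]| < Th + m)]).
  by move=> l /andP[? ?]; exists l.
move=> no.
have big l : l != i -> Th + m <= #|[set v in V l | e x v && e y v]|.
  by move=> li; have := no l; rewrite /= li /= ltnNge => /negbFE.
have [j ij] : exists j : 'I_r, i != j.
  apply/existsP; rewrite -[[exists _, _]]negbK negb_exists; apply/negP => /forallP all_i.
  have : #|'I_r| <= #|[set i]|.
    by apply: subset_leq_card; apply/subsetP => l _; rewrite inE eq_sym -[_ == _]negbK.
  by rewrite cards1 card_ord leqNgt r2.
have /card_gt0P[w] : 0 < #|[set v in V j | e x v && e y v]|.
  by apply: leq_trans (big j _); rewrite 1?eq_sym // /Th; lia.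
rewrite inE => /and3P[wV xw yw].
have [l [li lj]] := embed_triangle ij xy xw yw.
have := big l li; have := nearV (l' := l) _ wV; rewrite eq_sym => /(_ lj).
have : #|[set v in V l | e x v && e y v]| <=
  #|[set v in V l | [&& e x v, e y v & e w v]]| + #|[set b in V l | ~~ e w b]|.
  apply: leq_trans (leq_card_setU _ _); apply: subset_leq_card.
  by apply/subsetP => v; rewrite !inE => /and3P[-> -> ->] /=; case: (e w v).
lia.
Qed.

Lemma embed_vertex x : exists l, #|[set v in V l | e x v]| < Th + 2 * m.
Proof.
case: (pickP [pred l | #|[set v in V l | e x v]| < Th + 2 * m]).
  by move=> l ?; exists l.
move=> no.
have big l : Th + 2 * m <= #|[set v in V l | e x v]|.
  by have := no l; rewrite /= ltnNge => /negbFE.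
pose i : 'I_r := Ordinal (ltnW r2).
have /card_gt0P[y] : 0 < #|[set v in V i | e x v]|.
  by apply: leq_trans (big i); rewrite /Th; lia.
rewrite inE => /andP[yV xy].
have [l li] := embed_edge i xy.
have := big l; have := nearV (l' := l) _ yV; rewrite eq_sym => /(_ li).
have : #|[set v in V l | e x v]| <=
  #|[set v in V l | e x v && e y v]| + #|[set b in V l | ~~ e y b]|.
  apply: leq_trans (leq_card_setU _ _); apply: subset_leq_card.
  by apply/subsetP => v; rewrite !inE => /andP[-> ->] /=; case: (e y v).
lia.
Qed.

End Embed.

(** * Colouring around a nearly complete multipartite core *)

Definition deg_in (T : finType) (e : rel T) (S : {set T}) (v : T) := #|[set w in S | e v w]|.

Definition proper_on (T : finType) (e : rel T) (S : {set T}) r (c : T -> 'I_r) :=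
  {in S &, forall x y, e x y -> c x != c y}.

Section Sums.
Variables (R : realFieldType) (r : nat).
Local Open Scope ring_scope.

Lemma sum_le1 (F : 'I_r -> R) b i :
  (forall l, l != i -> F l <= b) -> \sum_(l | l != i) F l <= (r%:R - 1) * b.
Proof.
move=> Fb; apply: le_trans (ler_sum _ Fb) _; rewrite sumr_const.
have := cardC1 i; rewrite card_ord => ->.
rewrite -[X in X <= _]mulr_natl -subn1 natrB //; exact: leq_ltn_trans (leq0n i) (ltn_ord i).
Qed.

Lemma sum_le2 (F : 'I_r -> R) b i j : i != j ->
  (forall l, l != i -> l != j -> F l <= b) ->
  \sum_(l | (l != i) && (l != j)) F l <= (r%:R - 2) * b.
Proof.
move=> ij Fb; have {}Fb l : (l != i) && (l != j) -> F l <= b by case/andP; apply: Fb.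
apply: le_trans (ler_sum _ Fb) _; rewrite sumr_const.
have := cardsC [set i; j]; rewrite cards2 ij card_ord => rE.
have -> : #|[pred l | (l != i) && (l != j)]| = (r - 2)%N.
  have -> : #|[pred l | (l != i) && (l != j)]| = #|~: [set i; j]|.
    by apply: eq_card => l; rewrite !inE negb_or.
  by move: rE; lia.
by rewrite -[X in X <= _]mulr_natl natrB //; move: rE; lia.
Qed.

Lemma sum_ge1 (F : 'I_r -> R) b i :
  (forall l, l != i -> b <= F l) -> (r%:R - 1) * b <= \sum_(l | l != i) F l.
Proof.
move=> Fb; rewrite -lerN2 -sumrN -mulrN; apply: sum_le1 => l li.
by rewrite lerN2 Fb.
Qed.

Lemma sum_ge2 (F : 'I_r -> R) b i j : i != j ->
  (forall l, l != i -> l != j -> b <= F l) ->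
  (r%:R - 2) * b <= \sum_(l | (l != i) && (l != j)) F l.
Proof.
move=> ij Fb; rewrite -lerN2 -sumrN -mulrN; apply: sum_le2 => // l li lj.
by rewrite lerN2 Fb.
Qed.

Lemma sum_split2 (F : 'I_r -> R) i j : i != j ->
  \sum_l F l = F i + F j + \sum_(l | (l != i) && (l != j)) F l.
Proof.
move=> ij; rewrite (bigD1 i) //= (bigD1 j) 1?eq_sym //= addrA; congr (_ + _).
Qed.

End Sums.

Lemma card_split (T : finType) (S : {set T}) (P : pred T) :
  #|S| = #|[set w in S | P w]| + #|[set w in S | ~~ P w]|.
Proof.
rewrite -(cardsID [set w | P w] S); congr addn; apply: eq_card => w; rewrite !inE //.
by rewrite andbC.
Qed.

Lemma card_class (T : finType) (S : {set T}) r (c : T -> 'I_r) (P : pred T) :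
  #|[set w in S | P w]| = \sum_l #|[set w in [set v in S | c v == l] | P w]|.
Proof.
rewrite -sum1_card (partition_big c predT) //=; apply: eq_bigr => l _.
by rewrite -sum1_card; apply: eq_bigl => w; rewrite !inE -!andbA [P w && _]andbC.
Qed.

Section Near.
Variables (R : realType) (T : finType) (e : rel T).
Hypotheses (symE : symmetric e).
Variables (r t : nat) (r2 : 1 < r) (t0 : 0 < t).
Hypothesis (tameT : tame e r t).
Variables (S : {set T}) (c : T -> 'I_r) (n : R) (D : nat).

Local Notation q := (n / r%:R)%R.

Definition cls l : {set T} := [set v in S | c v == l].

Hypotheses (Sle : (#|S|%:R <= n)%R) (Sge : (n - D%:R <= #|S|%:R)%R).
Hypothesis (degS : forall v, v \in S -> (n - q - D%:R <= (deg_in e S v)%:R)%R).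
Hypothesis properS : proper_on e S c.

(** Bound on the number of non-neighbours, outside its own class, of a
    vertex of degree at least n - n / r - D. *)
Definition missing := r.+1 * D.
(** The threshold of [embed_vertex] when each vertex misses at most
    [missing] vertices of each other class. *)
Definition tau := t + r * (t * missing) + 2 * missing.

Lemma rq : (r%:R * q = n)%R.
Proof. by rewrite mulrC divfK // pnatr_eq0 -lt0n (ltn_trans _ r2). Qed.

Let n0 : (0 <= n)%R. Proof. exact: le_trans Sle. Qed.
Let q0 : (0 <= q)%R. Proof. by rewrite divr_ge0. Qed.

Local Open Scope ring_scope.

Lemma class_le l : #|cls l|%:R <= q + D%:R.
Proof.
have [->|[v vV]] := set_0Vmem (cls l); first by rewrite cards0 addr_ge0.
have vS : v \in S by move: vV; rewrite inE => /andP[].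
have := degS vS; have := card_split S (e v); rewrite -/(deg_in e S v) => SE.
have : (#|cls l| <= #|[set w in S | ~~ e v w]|)%N.
  apply: subset_leq_card; apply/subsetP => w; rewrite !inE => /andP[wS /eqP wl].
  rewrite wS; apply/negP => /(properS vS wS); rewrite wl.
  by move: vV; rewrite inE vS => /eqP->; rewrite eqxx.
rewrite -(ler_nat R); move: Sle; rewrite SE natrD; lra.
Qed.

Lemma class_sum : #|S|%:R = \sum_l #|cls l|%:R :> R.
Proof.
rewrite -natr_sum; congr (_%:R).
rewrite -[in LHS](setIT S) -[S :&: _](_ : [set w in S | xpredT w] = _).
  by rewrite (card_class _ c); apply: eq_bigr => l _; apply: eq_card => w; rewrite !inE andbT.
by apply/setP => w; rewrite !inE.
Qed.

Lemma class_ge l : q - r%:R * D%:R <= #|cls l|%:R.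
Proof.
have := class_sum; rewrite (bigD1 l) //=.
have := sum_le1 (F := fun l => #|cls l|%:R) (i := l) (fun j _ => class_le j).
have := rq; move: Sge; lra.
Qed.

(** A vertex with no neighbour in class l has already used up about n / r
    of the n / r + D non-neighbours that its degree allows. *)
Lemma miss_le l v : n - q - D%:R <= (deg_in e S v)%:R ->
  (forall w, w \in cls l -> ~~ e v w) ->
  (#|[set b in S | (c b != l) && ~~ e v b]| <= missing)%N.
Proof.
move=> dv vl; rewrite -(ler_nat R) /missing natrM -addn1 natrD.
have := card_split S (e v); rewrite -/(deg_in e S v).
have := card_split [set b in S | ~~ e v b] (fun b => c b == l).
have -> : [set w in [set b in S | ~~ e v b] | c w == l] = cls l.
  apply/setP => w; rewrite !inE andbAC; case wl: (w \in cls l).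
    by have := vl w wl; move: wl; rewrite !inE => /andP[-> ->] ->.
  by move: wl; rewrite !inE; case: (w \in S) => //= ->.
have -> : [set w in [set b in S | ~~ e v b] | c w != l] =
          [set b in S | (c b != l) && ~~ e v b].
  by apply/setP => w; rewrite !inE -andbA [~~ _ && _]andbC.
move=> -> /(congr1 (fun k => k%:R : R)); rewrite !natrD.
have := class_ge l; move: Sle dv; lra.
Qed.

Lemma nbr_class v w : v \in S -> w \in cls (c v) -> ~~ e v w.
Proof.
move=> vS; rewrite inE => /andP[wS /eqP wl]; apply/negP => /(properS vS wS).
by rewrite wl eqxx.
Qed.

Lemma near_cls : near_complete e cls missing.
Proof.
move=> l l' ll' a; rewrite inE => /andP[aS /eqP al].
apply: leq_trans (miss_le (degS aS) (fun w => nbr_class aS)).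
apply: subset_leq_card; apply/subsetP => b; rewrite !inE => /andP[/andP[-> /eqP->] ->].
by rewrite al eq_sym ll'.
Qed.

Lemma near_edge i x y : e x y ->
  exists2 l, l != i & (#|[set v in cls l | e x v && e y v]| < tau)%N.
Proof.
move=> /(embed_edge r2 t0 tameT near_cls i)[l li ll]; exists l => //.
by apply: leq_trans ll _; rewrite /tau leq_add2l mul2n -addnn leq_addr.
Qed.

Lemma near_vertex x : exists l, (#|[set v in cls l | e x v]| < tau)%N.
Proof. exact: (embed_vertex r2 t0 tameT near_cls). Qed.

Hypothesis qbig : 2 * tau%:R + 2 * missing%:R + r%:R * D%:R < q.

(** The degree of v leaves room for one class without neighbours, not for
    two. *)
Lemma two_small v i j : n - q - D%:R <= (deg_in e S v)%:R -> i != j ->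
  (#|[set w in cls i | e v w]| <= tau)%N ->
  (#|[set w in cls j | e v w]| <= tau + missing)%N -> False.
Proof.
move=> dv ij; rewrite -!(ler_nat R) [(_ + _)%:R]natrD => hi hj; move: dv qbig.
rewrite /deg_in (card_class _ c) natr_sum.
have -> : \sum_l (#|[set w in [set v0 in S | c v0 == l] | e v w]|)%:R =
   \sum_l (#|[set w in cls l | e v w]|)%:R :> R by [].
rewrite (sum_split2 _ ij).
have : \sum_(l | (l != i) && (l != j)) #|[set w in cls l | e v w]|%:R <= (r%:R - 2) * (q + D%:R).
  apply: sum_le2 => // l _ _; apply: le_trans (class_le l); rewrite ler_nat.
  by apply: subset_leq_card; apply/subsetP => w; rewrite inE => /andP[].
have := rq.
have : 0 <= missing%:R :> R by []. have : 0 <= D%:R :> R by [].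
lra.
Qed.

(** Some class l contains few neighbours of v. If it contained one, y, then
    v and y would have few common neighbours in another class j; as y misses
    few vertices of j, class j would also be sparse for v, against [two_small]. *)
Lemma empty_class v : n - q - D%:R <= (deg_in e S v)%:R ->
  exists l, [forall w in cls l, ~~ e v w].
Proof.
move=> dv; have [l ll] := near_vertex v; exists l.
apply/forall_inP => y yl; apply/negP => vy.
have [j jl lj] := near_edge l vy.
apply: (@two_small v l j dv); [by rewrite eq_sym|exact: ltnW|].
have yj : (#|[set b in cls j | ~~ e y b]| <= missing)%N.
  by apply: near_cls yl; rewrite eq_sym.
have : (#|[set w in cls j | e v w]| <=
  #|[set w in cls j | e v w && e y w]| + #|[set b in cls j | ~~ e y b]|)%N.
  apply: leq_trans (leq_card_setU _ _); apply: subset_leq_card.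
  by apply/subsetP => w; rewrite !inE => /andP[-> ->] /=; case: (e y w).
by move=> /leq_trans; apply; rewrite leq_add // ltnW.
Qed.

(** Each vertex of large degree into S gets the colour of a class in which
    it has no neighbour. Two adjacent vertices with the same colour would both
    be joined to nearly all of the other classes, against [near_edge]. *)
Lemma extend_coloring (U : {set T}) :
  (forall v, v \in U -> n - q - D%:R <= (deg_in e S v)%:R) ->
  exists c' : T -> 'I_r, proper_on e U c'.
Proof.
move=> dU; pose l0 : 'I_r := Ordinal (ltnW r2).
pose c' v := odflt l0 [pick l | [forall w in cls l, ~~ e v w]].
have c'P v : v \in U -> forall w, w \in cls (c' v) -> ~~ e v w.
  move=> vU w; rewrite /c'; case: pickP => [l /forall_inP|no]; first exact.
  by have [l] := empty_class (dU v vU); rewrite no.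
exists c' => v v' vU v'U vv'; apply/eqP => cc.
have [j jl lj] := near_edge (c' v) vv'.
have hv := miss_le (dU v vU) (c'P v vU).
have := miss_le (dU v' v'U) (c'P v' v'U); rewrite -cc => hv'.
have h : (#|cls j| <= #|[set w in cls j | e v w && e v' w]| + missing + missing)%N.
  apply: leq_trans (leq_add (leq_add (leqnn _) hv) hv').
  apply: leq_trans (leq_add (leq_card_setU _ _) (leqnn _)).
  apply: leq_trans (leq_card_setU _ _); apply: subset_leq_card.
  apply/subsetP => w; rewrite !inE => /andP[-> /eqP->]; rewrite jl eqxx /=.
  by case: (e v w); case: (e v' w).
have := class_ge j; move: qbig; have : (#|cls j| <= tau + 2 * missing)%N.
  by apply: leq_trans h _; rewrite mul2n -addnn addnA !leq_add2r ltnW.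
rewrite -(ler_nat R) natrD natrM.
have : 0 <= tau%:R :> R by [].
lra.
Qed.

End Near.

(** * Large complete multipartite subgraphs *)

Definition has_blown_clique (T : finType) (e : rel T) (S : {set T}) s M :=
  exists B : nat -> {set T}, (forall i, i < s -> B i \subset S /\ #|B i| = M) /\
    (forall i j, i < j < s -> {in B i & B j, forall a b, e a b}).

Lemma pigeonhole (T K : finType) (f : T -> K) (A : {set T}) (P : {set K}) M :
  (forall a, a \in A -> f a \in P) -> #|P| * M < #|A| ->
  exists2 k, k \in P & M < #|[set a in A | f a == k]|.
Proof.
move=> fP big; apply/exists_inP; apply: contraLR big => /exists_inPn no.
rewrite -leqNgt -sum1_card (partition_big f (fun k => k \in P)) //=.
rewrite -sum_nat_const; apply: leq_sum => k kP.
by rewrite sum1dep_card leqNgt no.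
Qed.

Section Step.
Variables (R : realType) (T : finType) (e : rel T).
Hypothesis (symE : symmetric e).
Variables (r s M : nat) (S : {set T}) (d : R).
Local Open Scope ring_scope.
Hypotheses (sr : (s < r)%N) (M0 : (0 < M)%N) (dle : 4 * r%:R ^+ 2 * d <= #|S|%:R).
Hypothesis (d0 : 0 <= d).
Hypothesis degS : forall v, v \in S -> #|S|%:R - #|S|%:R / r%:R - d <= (deg_in e S v)%:R.
Hypothesis Sbig : (2 * r * (r * (4 * r * M) + 2 ^ (r * (4 * r * M)) * M + 1) < #|S|)%N.

Let M' := (4 * r * M)%N.

Lemma double_count (B : nat -> {set T}) k :
  \sum_(v in S) \sum_(i < k) (#|[set b in B i | e v b]|) =
  \sum_(i < k) \sum_(b in B i) deg_in e S b.
Proof.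
rewrite exchange_big; apply: eq_bigr => i _ /=.
under eq_bigr do rewrite -sum1_card.
under [RHS]eq_bigr do rewrite /deg_in -sum1_card.
rewrite (exchange_big_dep (fun b => b \in B i)) /=; last by move=> v b _; rewrite inE => /andP[].
apply: eq_bigr => b bB; apply: eq_bigl => v; by rewrite !inE bB symE.
Qed.

(** Double counting edges between S and the given s parts of size 4 r M
    shows that a positive proportion of S has at least M neighbours in every
    part: this uses s < r and the minimum degree. Among these vertices M have
    the same neighbourhood in the union of the parts, and they form the new
    part. *)
Lemma blown_clique_step : has_blown_clique e S s M' -> has_blown_clique e S s.+1 M.
Proof.
move=> [B [BS Be]].
have r0 : (0 < r)%N by apply: leq_ltn_trans sr.
have rR : 0 < r%:R :> R by rewrite ltr0n.
pose df v i := #|[set b in B i | e v b]|.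
pose good := [set v in S | [forall i : 'I_s, (M <= df v i)%N]].
have dfM' v (i : 'I_s) : (df v i <= M')%N.
  rewrite -(BS i (ltn_ord i)).2; apply: subset_leq_card.
  by apply/subsetP => b; rewrite inE => /andP[].
have MM' : (M <= M')%N by rewrite /M'; nia.
have bad v : v \in S -> v \notin good -> ((\sum_(i < s) df v i) + M' <= s * M' + M)%N.
  move=> vS; rewrite inE vS /= negb_forall => /existsP[i0]; rewrite -ltnNge => iM.
  rewrite (bigD1 i0) //=.
  have : (\sum_(j < s | j != i0) df v j <= s.-1 * M')%N.
    apply: (@leq_trans (\sum_(j < s | j != i0) M')); first by apply: leq_sum => j _; apply: dfM'.
    by rewrite sum_nat_const; have := cardC1 i0; rewrite card_ord => ->.
  have s0 : (0 < s)%N by case: (s) i0 {iM} => // [[]].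
  rewrite -[in (s * M')%N](prednK s0) mulSn; move: iM.
  by move: (df v i0) (bigop.body _ _ _) (s.-1 * M')%N => x y z; clear; lia.
have gd v : v \in S -> (\sum_(i < s) df v i <= s * M')%N.
  move=> _; apply: (@leq_trans (\sum_(j < s) M')); first by apply: leq_sum => j _; apply: dfM'.
  by rewrite sum_nat_const card_ord.
have goodS : good \subset S by apply/subsetP => v; rewrite inE => /andP[].
have count : ((\sum_(v in S) \sum_(i < s) df v i) + (#|S| - #|good|) * M' <=
   #|S| * (s * M') + (#|S| - #|good|) * M)%N.
  have <- : #|S :\: good| = (#|S| - #|good|)%N by rewrite cardsD (setIidPr goodS).
  rewrite (big_setID good) /= (setIidPr goodS).
  have h1 : (\sum_(v in good) \sum_(i < s) df v i <= #|good| * (s * M'))%N.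
    by rewrite -sum_nat_const; apply: leq_sum => v /(subsetP goodS); apply: gd.
  have h2 : ((\sum_(v in S :\: good) \sum_(i < s) df v i) + #|S :\: good| * M' <=
      #|S :\: good| * (s * M' + M))%N.
    rewrite -!sum_nat_const -big_split /=; apply: leq_sum => v.
    by rewrite inE => /andP[vg vS]; apply: bad.
  have <- : (#|good| + #|S :\: good| = #|S|)%N.
    by rewrite -[in RHS](cardsID good S) (setIidPr goodS).
  move: h1 h2; set a1 := (\sum_(v in good) _)%N; set a2 := (\sum_(v in _ :\: _) _)%N.
  move: a1 a2 (#|good|) (#|S :\: good|) (s * M')%N => a1 a2 g h x; clear.
  by rewrite !mulnDl mulnDr; lia.
have lower : s%:R * M'%:R * (#|S|%:R - #|S|%:R / r%:R - d) <=
    (\sum_(v in S) \sum_(i < s) df v i)%:R :> R.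
  rewrite double_count natr_sum -mulrA mulr_natl -[s in X in X <= _]card_ord -sumr_const.
  apply: ler_sum => i _; have [Bi BM] := BS i (ltn_ord i).
  rewrite natr_sum mulr_natl -BM -sumr_const; apply: ler_sum => b bB.
  exact/degS/(subsetP Bi).
have gbig : #|S|%:R <= 2 * r%:R * #|good|%:R :> R.
  have gS : (#|good| <= #|S|)%N by apply: subset_leq_card.
  move: count; rewrite -(ler_nat R) !natrD !natrM natrB //.
  set N := #|S|%:R; set g := #|good|%:R.
  have M'E : M'%:R = 4 * r%:R * M%:R :> R by rewrite !natrM.
  move: lower; rewrite -/N; set q := N / r%:R.
  have qE : r%:R * q = N by rewrite mulrC divfK // gt_eqF.
  set X : R := (\sum_(v in S) \sum_(i < s) df v i)%:R => lower count.
  have MR : 0 < M%:R :> R by rewrite ltr0n.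
  have s1 : s%:R + 1 <= r%:R :> R by rewrite natr1 ler_nat.
  have s0 : 0 <= s%:R :> R by [].
  have k1 : (N - g) * (4 * r%:R - 1) <= 4 * r%:R * (s%:R * (q + d)).
    rewrite -(ler_pM2r MR); move: lower count; rewrite M'E.
    nra.
  have N0 : 0 <= N by []. have q0 : 0 <= q by rewrite divr_ge0.
  have k2 : s%:R * (q + d) <= (r%:R - 1) * (q + d) by rewrite ler_wpM2r ?addr_ge0 //; lra.
  have k3 : 4 * r%:R * d <= q by rewrite -(ler_pM2l rR) qE; move: dle; rewrite -/N; nra.
  have k4 : 4 * r%:R * (s%:R * (q + d)) <= 4 * r%:R * ((r%:R - 1) * (q + d)).
    by rewrite ler_wpM2l // mulr_ge0.
  have g0 : 0 <= g by [].
  have k5 : (r%:R - 1) * (r%:R * d * 4) <= (r%:R - 1) * q.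
    rewrite ler_wpM2l //; [lra | nra].
  nra.
pose U := \bigcup_(i in 'I_s) B i.
have UM : (#|U| <= r * M')%N.
  apply: (@leq_trans (s * M')%N); last by rewrite leq_mul2r ltnW // orbT.
  have := @card_bigcup_le T 'I_s [set: 'I_s] (fun i => B i) M'.
  rewrite cardsT card_ord => H; rewrite /U (eq_bigl (fun i => i \in [set: 'I_s])).
    by apply: H => i _; rewrite (BS i (ltn_ord i)).2.
  by move=> i; rewrite !inE.
pose A := good :\: U.
have Abig : (2 ^ (r * M') * M < #|A|)%N.
  have : (#|good| <= #|A| + #|U|)%N.
    by rewrite -(cardsID U good) addnC leq_add2l subset_leq_card // subsetIr.
  have : (#|S| <= 2 * r * #|good|)%N by rewrite -(ler_nat R) !natrM.
  move: Sbig UM; rewrite -/M'; nia.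
pose tr v := [set b in U | e v b].
have [v _||X XU Xbig] := @pigeonhole _ _ tr A (powerset U) M.
- by rewrite inE; apply/subsetP => b; rewrite inE => /andP[].
- rewrite card_powerset; apply: leq_ltn_trans Abig.
  by rewrite leq_mul2r leq_exp2l // UM orbT.
have [C CA CM] := exists_subset (ltnW Xbig).
have CP v : v \in C -> [/\ v \in good, v \notin U & tr v = X].
  by move/(subsetP CA); rewrite inE => /andP[]; rewrite inE => /andP[-> ->] /eqP.
have [v0 v0C] : exists v, v \in C by apply/card_gt0P; rewrite CM.
have sub i : exists B' : {set T}, (i < s)%N -> [/\ B' \subset B i, B' \subset X & #|B'| = M].
  have [is_|] := ltnP i s; last by exists set0.
  have [v0g _ trX] := CP v0 v0C.
  have := v0g; rewrite inE => /andP[_ /forallP/(_ (Ordinal is_))/=].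
  case/exists_subset => B' /subsetP B'B B'M; exists B' => _; split=> //.
    by apply/subsetP => b /B'B; rewrite inE => /andP[].
  apply/subsetP => b /B'B; rewrite -trX !inE => /andP[bB ->]; rewrite andbT.
  by apply/bigcupP; exists (Ordinal is_).
have [B' B'P] := boolp.choice sub.
exists (fun i => if (i < s)%N then B' i else C); split.
  move=> i; rewrite ltnS; have [is_ _|si is_] := ltnP i s.
    have [B'B _ ->] := B'P i is_; split=> //.
    by apply: subset_trans B'B (BS i is_).1.
  split=> //; apply/subsetP => v /CP[vg _ _]; exact: (subsetP goodS).
move=> i j /andP[ij]; rewrite ltnS => js.
have is_ := leq_trans ij js; rewrite is_; have [js'|sj] := ltnP j s => a b aB bB.
  have [/subsetP/(_ _ aB) aBi _ _] := B'P i is_.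
  have [/subsetP/(_ _ bB) bBj _ _] := B'P j js'.
  by apply: Be aBi bBj; rewrite ij.
have [_ /subsetP/(_ _ aB)] := B'P i is_.
by have [_ _ <-] := CP b bB; rewrite inE symE => /andP[].
Qed.

End Step.

(** * Large minimum degree forces an r-colouring *)

Section Stability.
Variable R : realType.
Local Open Scope ring_scope.

Lemma blown_clique_exists r s M : (s <= r)%N -> (0 < M)%N ->
  exists N1 : nat, forall (T : finType) (e : rel T), symmetric e ->
  forall (S : {set T}) (d : R), 0 <= d -> 4 * r%:R ^+ 2 * d <= #|S|%:R ->
  (forall v, v \in S -> #|S|%:R - #|S|%:R / r%:R - d <= (deg_in e S v)%:R) ->
  (N1 <= #|S|)%N -> has_blown_clique e S s M.
Proof.
elim: s M => [|s IH] M sr M0; first by exists 0%N => *; exists (fun _ => set0); split=> // i j; rewrite ltn0 andbF.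
have r0 : (0 < r)%N by apply: leq_ltn_trans sr.
have [N1 N1P] := IH (4 * r * M)%N (ltnW sr) (ltac:(by rewrite !muln_gt0 r0 M0)).
exists (maxn N1 (2 * r * (r * (4 * r * M) + 2 ^ (r * (4 * r * M)) * M + 1)).+1).
move=> T e symE S d d0 dS degS; rewrite geq_max => /andP[N1S SM].
apply: (blown_clique_step _ sr M0 dS d0 degS SM) => //.
exact: N1P degS N1S.
Qed.

(** All error terms of the core are at most this constant times D. *)
Definition core_const (r t : nat) := (2 * (t + r * (t * r.+1) + 2 * r.+1) + 2 * r.+1 + r)%N.

Lemma core_const_le r t D : (0 < D)%N ->
  2 * (tau r t D)%:R + 2 * (missing r D)%:R + r%:R * D%:R <= (core_const r t)%:R * D%:R :> R.
Proof.
move=> D0; rewrite -!natrM -!natrD ler_nat /tau /missing /core_const.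
have -> : ((2 * (t + r * (t * r.+1) + 2 * r.+1) + 2 * r.+1 + r) * D =
  2 * (t * D + r * (t * (r.+1 * D)) + 2 * (r.+1 * D)) + 2 * (r.+1 * D) + r * D)%N by ring.
by rewrite !leq_add2r leq_mul2l /= !leq_add2r leq_pmulr.
Qed.

(** Fix a complete r-partite subgraph with parts of size M, and colour each
    vertex by a part in which it has fewer than t neighbours. The vertices that
    see more than half of every other part induce a properly coloured graph,
    since two adjacent ones of the same colour would have t common neighbours
    in every other part. Counting the edges to the parts leaves few other
    vertices, so [extend_coloring] applies to the former and recolours
    everything. *)
Theorem min_degree_colorable r t : (1 < r)%N -> (0 < t)%N ->
  exists2 eps : R, 0 < eps & exists N1 : nat,
  forall (T : finType) (e : rel T), symmetric e -> tame e r t ->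
  forall S : {set T}, (N1 <= #|S|)%N ->
  (forall v, v \in S -> #|S|%:R - #|S|%:R / r%:R - eps * #|S|%:R <= (deg_in e S v)%:R) ->
  exists c : T -> 'I_r, proper_on e S c.
Proof.
move=> r2 t0; have r0 : (0 < r)%N := ltnW r2.
(* L makes d = eps #|S| so small that core_const * D < #|S| / r for the D chosen below. *)
pose K := core_const r t; have K0 : (0 < K)%N by rewrite /K /core_const; lia.
pose L := (2 * r * K * (4 * r + 3))%N.
have L0 : (0 < L)%N by rewrite !muln_gt0 r0 K0 addnS.
pose eps : R := L%:R^-1; pose M := (4 * t * L)%N.
have M0 : (0 < M)%N by rewrite /M muln_gt0 L0 andbT muln_gt0 t0.
have eps0 : 0 < eps by rewrite invr_gt0 ltr0n.
have [N1 N1P] := blown_clique_exists (leqnn r) M0.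
exists eps => //; exists (maxn N1 L) => T e symE tameT S.
rewrite geq_max => /andP[N1S LS] degS.
set N : R := #|S|%:R in degS; pose q := N / r%:R; pose d := eps * N.
have rR : 0 < r%:R :> R by rewrite ltr0n.
have qE : r%:R * q = N by rewrite mulrC divfK // gt_eqF.
have LR : 0 < L%:R :> R by rewrite ltr0n.
have LE : L%:R = 2 * r%:R * K%:R * (4 * r%:R + 3) :> R by rewrite !natrM natrD natrM.
have dE : L%:R * d = N by rewrite /d /eps mulrA divff ?mul1r // gt_eqF.
have d1 : 1 <= d by rewrite -(ler_pM2l LR) dE mulr1 ler_nat.
have d0 : 0 <= d by lra.
have KR : 1 <= K%:R :> R by rewrite ler1n.
have r1R : 2 <= r%:R :> R by rewrite ler_nat.
have dS : 4 * r%:R ^+ 2 * d <= N.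
  rewrite -dE LE ler_wpM2r //; nra.
have ME : M%:R * d = 4 * t%:R * N :> R by rewrite /M natrM natrM -[in RHS]dE; ring.
have tM : (2 * t <= M)%N.
  rewrite /M; move: (t) (L) L0; clear=> t L L0.
  by rewrite mulnAC leq_mul2r; apply/orP; right; lia.
have KE : K = core_const r t by [].
have {}N1P := N1P T e symE S d d0 dS degS N1S.
have {}degS v : v \in S -> N - q - d <= (deg_in e S v)%:R by apply: degS.
clearbody d eps M L K; clear LS L0.
have [B [BS Be]] := N1P.
pose V (i : 'I_r) := B i.
have VM i : #|V i| = M by case: (BS i (ltn_ord i)).
have Ve (i j : 'I_r) a b : i != j -> a \in V i -> b \in V j -> e a b.
  rewrite neq_ltn => /orP[ij|ij] aV bV.
    by apply: (Be i j) aV bV; rewrite ij ltn_ord.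
  by rewrite symE; apply: (Be j i) bV aV; rewrite ij ltn_ord.
have nearV : near_complete e V 0.
  move=> l l' ll' a aV; rewrite leqn0 cards_eq0; apply/eqP/setP => b.
  by rewrite !inE; apply/negP => /andP[bV]; rewrite (Ve _ _ _ _ ll' aV bV).
pose df v (i : 'I_r) := #|[set b in V i | e v b]|.
have ex v : exists i, (df v i < t)%N.
  have [l] := embed_vertex r2 t0 tameT nearV v.
  by rewrite !muln0 !addn0; exists l.
pose l0 : 'I_r := Ordinal r0.
pose c v := odflt l0 [pick i | (df v i < t)%N].
have cP v : (df v (c v) < t)%N.
  by rewrite /c; case: pickP => [//|no]; have [j] := ex v; rewrite no.
have dfM v i : (df v i <= M)%N.
  by rewrite -(VM i) subset_leq_card //; apply/subsetP => b; rewrite inE => /andP[].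
pose S' := [set v in S | [forall j, (j != c v) ==> (M + t <= 2 * df v j)%N]].
have S'S : S' \subset S by apply/subsetP => v; rewrite inE => /andP[].
have pS' : proper_on e S' c.
  move=> v w vS wS vw; apply/eqP => cvw.
  have [j jv] := embed_edge r2 t0 tameT nearV (c v) vw.
  rewrite !muln0 !addn0; apply/negP; rewrite -leqNgt.
  have := vS; rewrite inE => /andP[_ /forallP/(_ j)]; rewrite jv /= => hv.
  have := wS; rewrite inE => /andP[_ /forallP/(_ j)]; rewrite -cvw jv /= => hw.
  have := cardsUI [set b in V j | e v b] [set b in V j | e w b].
  have -> : [set b in V j | e v b] :&: [set b in V j | e w b] = [set b in V j | e v b && e w b].
    by apply/setP => b; rewrite !inE; case: (b \in V j).
  have : (#|[set b in V j | e v b] :|: [set b in V j | e w b]| <= M)%N.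
    rewrite -(VM j) subset_leq_card //; apply/subsetP => b.
    by rewrite !inE => /orP[] /andP[].
  move: hv hw; rewrite -/(df v j) -/(df w j).
  move: (df v j) (df w j) #|_ :|: _| #|[set b in V j | e v b && e w b]|.
  by clear=> *; lia.
pose b : nat := #|S :\: S'|.
have bE : (#|S'| + b = #|S|)%N by rewrite -(cardsID S' S) (setIidPr S'S).
have up v : (\sum_i df v i <= (r - 1) * M + t)%N.
  rewrite (bigD1 (c v)) //= addnC leq_add //; last exact: ltnW.
  apply: (@leq_trans (\sum_(i | i != c v) M)); first by apply: leq_sum => i _; apply: dfM.
  by rewrite sum_nat_const; have := cardC1 (c v); rewrite card_ord subn1 => ->.
have upb v : v \in S :\: S' -> (2 * (\sum_i df v i) + (M - t) <= 2 * ((r - 1) * M + t))%N.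
  rewrite inE => /andP[+ vS]; rewrite inE vS /= negb_forall => /existsP[j].
  rewrite negb_imply -ltnNge => /andP[jv hj].
  rewrite (bigD1 (c v)) //= (bigD1 j) //=.
  have := cP v.
  have : (\sum_(i | (i != c v) && (i != j)) df v i <= (r - 2) * M)%N.
    apply: (@leq_trans (\sum_(i | (i != c v) && (i != j)) M)).
      by apply: leq_sum => i _; apply: dfM.
    rewrite sum_nat_const leq_mul2r; apply/orP; right.
    have -> : #|(fun i => (i != c v) && (i != j))| = #|~: [set c v; j]|.
      by apply: eq_card => l; rewrite !inE negb_or.
    by have := cardsC [set c v; j]; rewrite cards2 eq_sym jv card_ord; move: #|_|; clear; lia.
  have -> : ((r - 1) * M = (r - 2) * M + M)%N.
    by rewrite -[X in (_ + X)%N]mul1n -mulnDl; congr muln; clear -r2; lia.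
  have {}tM : (t <= M)%N by clear -tM; lia.
  move: hj tM; move: (bigop.body _ _ _) (df v (c v)) (df v j) ((r - 2) * M)%N (M).
  by clear; lia.
have count : (2 * (\sum_(v in S) \sum_i df v i) + b * (M - t) <= 2 * (#|S| * ((r - 1) * M + t)))%N.
  rewrite (big_setID S') /= (setIidPr S'S).
  have h1 : (\sum_(v in S') \sum_i df v i <= #|S'| * ((r - 1) * M + t))%N.
    by rewrite -sum_nat_const; apply: leq_sum => v _; apply: up.
  have h2 : (2 * (\sum_(v in S :\: S') \sum_i df v i) + b * (M - t) <= 
      b * (2 * ((r - 1) * M + t)))%N.
    by rewrite -!sum_nat_const big_distrr -big_split /=; apply: leq_sum => v /upb.
  move: h1 h2; rewrite -bE; set a1 := (\sum_(v in S') _)%N.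
  set a2 := (\sum_(v in _ :\: _) _)%N.
  move: a1 a2 (#|S'|) (b) (M - t)%N ((r - 1) * M + t)%N; clear=> *; nia.
have lower : r%:R * M%:R * (N - q - d) <= (\sum_(v in S) \sum_i df v i)%:R :> R.
  rewrite (double_count symE S B r) natr_sum -mulrA mulr_natl -[r in X in X <= _]card_ord -sumr_const.
  apply: ler_sum => i _; have [Bi BM] := BS i (ltn_ord i).
  rewrite natr_sum mulr_natl -BM -sumr_const; apply: ler_sum => b' bB.
  exact/degS/(subsetP Bi).
have bd : b%:R <= (4 * r%:R + 1) * d :> R.
  have tM1 : (t <= M)%N by apply: leq_trans tM; rewrite mul2n -addnn leq_addr.
  move: count; rewrite -(ler_nat R) natrD !(natrM, natrD) !natrB //.
  move: lower; set X : R := (\sum_(v in S) _)%:R => lower; rewrite -/N => count.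
  have tMR : 2 * t%:R <= M%:R :> R by rewrite -natrM ler_nat.
  have MR : 0 < M%:R :> R by rewrite ltr0n.
  have bb : b%:R * M%:R <= 2 * (b%:R * (M%:R - t%:R)) :> R.
    by rewrite mulrCA ler_wpM2l //; lra.
  rewrite -(ler_pM2r MR).
  have e1 : r%:R * M%:R * (N - q - d) = r%:R * (M%:R * N) - M%:R * N - r%:R * (M%:R * d).
    rewrite -[X in _ = _ - M%:R * X - _]qE; ring.
  have e2 : (4 * r%:R + 1) * d * M%:R = 4 * (r%:R * (M%:R * d)) + M%:R * d by ring.
  move: lower count; rewrite e1 e2 => lower count.
  have e3 : 2 * (N * ((r%:R - 1) * M%:R + t%:R)) = 2 * (r%:R * (M%:R * N)) - 2 * (M%:R * N) + 2 * (t%:R * N) by ring.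
  move: count ME; rewrite e3; lra.
(* The core S' misses at most (4 r + 1) d vertices, and each degree loses d more. *)
pose D := (Num.trunc ((4 * r%:R + 2) * d)).+1.
have [Dge Dle] : (4 * r%:R + 2) * d <= D%:R /\ D%:R <= (4 * r%:R + 3) * d.
  have p0 : 0 <= (4 * r%:R + 2) * d by rewrite mulr_ge0 // addr_ge0 // mulr_ge0.
  have /andP[h1 h2] := truncn_itv p0.
  split; first exact: ltW.
  by rewrite /D -natr1; move: h1 d1; lra.
have KD : K%:R * D%:R < q.
  have : K%:R * D%:R <= K%:R * ((4 * r%:R + 3) * d) by rewrite ler_wpM2l //; lra.
  have : r%:R * (2 * (K%:R * ((4 * r%:R + 3) * d))) = r%:R * q.
    by rewrite qE -dE LE; ring.
  have r0' : r%:R != 0 :> R by rewrite gt_eqF.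
  move/(mulfI r0') => <-.
  have : 0 < K%:R * ((4 * r%:R + 3) * d).
    by rewrite !mulr_gt0 //; nra.
  lra.
have degS' v : v \in S -> N - q - D%:R <= (deg_in e S' v)%:R.
  move=> vS; have : (deg_in e S v <= deg_in e S' v + b)%N.
    apply: leq_trans (leq_card_setU _ _); apply: subset_leq_card.
    apply/subsetP => w; rewrite !inE => /andP[-> ->] /=; rewrite !andbT.
    by case: [forall j, _].
  rewrite -(ler_nat R) natrD; have := degS v vS; lra.
apply: (@extend_coloring R T e r t r2 t0 tameT S' c N D).
- by rewrite ler_nat subset_leq_card.
- rewrite /N -bE natrD; lra.
- by move=> v /(subsetP S'S); apply: degS'.
- exact: pS'.
- by apply: le_lt_trans KD; rewrite KE; apply: core_const_le.
- exact: degS'.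
Qed.

End Stability.

(** * From spectral radius to minimum degree *)

Section Deletion.
Variable R : realType.
Local Open Scope ring_scope.

(** Cauchy-Schwarz. *)
Lemma sum_sqr_le (I : finType) (A : pred I) (x : I -> R) :
  (\sum_(i | A i) x i) ^+ 2 <= #|A|%:R * \sum_(i | A i) x i ^+ 2.
Proof.
have : 0 <= \sum_(i | A i) \sum_(j | A j) (x i - x j) ^+ 2.
  by apply: sumr_ge0 => i _; apply: sumr_ge0 => j _; apply: sqr_ge0.
have -> : \sum_(i | A i) \sum_(j | A j) (x i - x j) ^+ 2 =
  2 * (#|A|%:R * \sum_(i | A i) x i ^+ 2) - 2 * (\sum_(i | A i) x i) ^+ 2.
  have e1 : \sum_(i | A i) \sum_(j | A j) x i ^+ 2 = #|A|%:R * \sum_(i | A i) x i ^+ 2.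
    by rewrite exchange_big /= sumr_const mulr_natl.
  have e2 : \sum_(i | A i) \sum_(j | A j) x j ^+ 2 = #|A|%:R * \sum_(i | A i) x i ^+ 2.
    by rewrite sumr_const mulr_natl.
  have e3 : \sum_(i | A i) \sum_(j | A j) x i * x j = (\sum_(i | A i) x i) ^+ 2.
    by rewrite expr2 mulr_suml; apply: eq_bigr => i _; rewrite mulr_sumr.
  rewrite [2 * (#|A|%:R * _)]mulr_natl mulr2n -{1}e1 -e2 -e3 mulr_sumr -sumrN -!big_split /=.
  apply: eq_bigr => i _; rewrite mulr_sumr -sumrN -!big_split /=.
  by apply: eq_bigr => j _; ring.
lra.
Qed.

Section Vector.
Variables (T : finType) (e : rel T) (rho : R) (x : T -> R).
Hypotheses (symE : symmetric e) (x0 : forall a, 0 <= x a).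
Hypothesis xE : forall a, rho * x a = \sum_(b | e a b) x b.

Lemma qform_eigen : qform e x = rho * \sum_a x a ^+ 2.
Proof.
rewrite qformE mulr_sumr; apply: eq_bigr => a _; rewrite -xE; ring.
Qed.

Lemma sum_off (D : pred T) :
  \sum_a (if D a then 0 else x a) ^+ 2 = \sum_a x a ^+ 2 - \sum_(a | D a) x a ^+ 2.
Proof.
rewrite [X in _ = X - _](bigID D) /= addrC addrK [RHS]big_mkcond.
by apply: eq_bigr => a _; case: (D a); rewrite ?expr0n.
Qed.

Lemma qform_off (D : pred T) :
  rho * \sum_a x a ^+ 2 - 2 * rho * \sum_(a | D a) x a ^+ 2 <=
  qform e (fun a => if D a then 0 else x a).
Proof.
rewrite -qform_eigen.
have e1 : rho * \sum_(a | D a) x a ^+ 2 = \sum_a \sum_b (D a)%:R * ((e a b)%:R * (x a * x b)).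
  rewrite mulr_sumr big_mkcond; apply: eq_bigr => a _; case: (D a); last first.
    by rewrite big1 // => b _; rewrite mul0r.
  rewrite expr2 mulrA xE mulr_suml big_mkcond; apply: eq_bigr => b _.
  by case: (e a b); rewrite ?mul0r ?mul1r // mulrC.
have e2 : rho * \sum_(a | D a) x a ^+ 2 = \sum_a \sum_b (D b)%:R * ((e a b)%:R * (x a * x b)).
  rewrite e1 exchange_big; apply: eq_bigr => a _; apply: eq_bigr => b _.
  by rewrite symE [x b * _]mulrC.
rewrite lerBlDr -mulrA mulr_natl mulr2n {1}e1 e2.
rewrite -!big_split /=; apply: ler_sum => a _; rewrite -!big_split /=; apply: ler_sum => b _.
have : 0 <= (e a b)%:R * (x a * x b) by rewrite !mulr_ge0.
case: (D a); case: (D b); rewrite /= ?(mul0r, mulr0, mul1r, add0r, addr0) //; lra.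
Qed.

End Vector.

Section Sub.
Variables (T : finType) (e : rel T).
Hypotheses (symE : symmetric e) (irrE : irreflexive e).

Definition subrel_on (S : {set T}) : rel T := [rel x y | [&& e x y, x \in S & y \in S]].

Lemma subrel_sym S : symmetric (subrel_on S).
Proof. by move=> x y; rewrite /subrel_on /= symE [(x \in S) && _]andbC. Qed.

Lemma subrel_irr S : irreflexive (subrel_on S).
Proof. by move=> x; rewrite /subrel_on /= irrE. Qed.

Definition induced S : sgraph := SGraph (subrel_sym S) (subrel_irr S).

(** Induced subgraphs are kept on the whole vertex type, with isolated
    vertices outside S: this changes neither the Rayleigh bound nor nonzero
    eigenvalues. *)
Definition rhoS (S : {set T}) : R := spectral_radius (adjacency R (induced S)).

(** Evaluate the form at the Perron vector: the pairs inside a class are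
    missing, and the squares of the r class sums add up to at least an r-th of
    the square of the total. *)
Lemma rpartite_rho r S (c : T -> 'I_r) : (0 < r)%N -> proper_on e S c -> (0 < #|T|)%N ->
  rhoS S <= (1 - r%:R^-1) * #|S|%:R.
Proof.
move=> r0 pc T0; have rR : 0 < r%:R :> R by rewrite ltr0n.
have r1 : r%:R^-1 <= 1 :> R by rewrite invf_le1 // ler1n.
have [rho0|rho0] := lerP (rhoS S) 0.
  by apply: le_trans rho0 _; rewrite mulr_ge0 // subr_ge0.
have [x [x0 _ [a0 xa0] xE]] := @perron R (induced S) T0.
rewrite -/(rhoS S) /= in xE.
have xS a : a \notin S -> x a = 0.
  move=> aS; have := xE a; rewrite big1; last by move=> b; rewrite /subrel_on /= (negPf aS) andbF.
  by move=> /eqP; rewrite mulf_eq0 gt_eqF //= => /eqP.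
have X0 : 0 < \sum_a x a ^+ 2.
  rewrite lt0r sumr_ge0 ?andbT; last by move=> a _; apply: sqr_ge0.
  rewrite psumr_neq0; last by move=> a _; apply: sqr_ge0.
  by apply/hasP; exists a0; rewrite ?mem_index_enum //= xa0 expr1n.
rewrite -(ler_pM2r X0) -(qform_eigen xE).
pose s l := \sum_(a | c a == l) x a.
have sE : \sum_a x a = \sum_l s l by rewrite (partition_big c predT).
have q1 : qform (subrel_on S) x <= (\sum_a x a) ^+ 2 - \sum_l s l ^+ 2.
  have -> : \sum_l s l ^+ 2 = \sum_a \sum_b (c a == c b)%:R * (x a * x b).
    rewrite (partition_big c predT) //=; apply: eq_bigr => l _.
    rewrite expr2 mulr_suml; apply: eq_bigr => a /eqP ca.
    rewrite mulr_sumr big_mkcond; apply: eq_bigr => b _; rewrite ca eq_sym.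
    by case: (_ == _); rewrite ?mul1r ?mul0r.
  rewrite expr2 mulr_suml -sumrN -big_split; apply: ler_sum => a _ /=.
  rewrite mulr_sumr -sumrN -big_split; apply: ler_sum => b _ /=.
  have xx : 0 <= x a * x b by rewrite mulr_ge0.
  have [cab|cab] := eqVneq (c a) (c b); rewrite ?mul1r ?mul0r ?subr0 ?subrr.
    case eab: (e a b); case aS: (a \in S); case bS: (b \in S); rewrite /subrel_on /= eab aS bS /= ?mul0r //.
    by have := pc a b aS bS eab; rewrite cab eqxx.
  by rewrite ler_piMl // lern1 leq_b1.
have q2 : (\sum_a x a) ^+ 2 <= r%:R * \sum_l s l ^+ 2.
  by rewrite sE; have := sum_sqr_le predT s; rewrite card_ord.
have q3 : (\sum_a x a) ^+ 2 <= #|S|%:R * \sum_a x a ^+ 2.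
  have -> : \sum_a x a = \sum_(a in S) x a.
    by rewrite [RHS]big_mkcond; apply: eq_bigr => a _; case: ifPn => // /xS.
  have -> : \sum_a x a ^+ 2 = \sum_(a in S) x a ^+ 2.
    rewrite [RHS]big_mkcond; apply: eq_bigr => a _; case: ifPn => // /xS ->.
    by rewrite expr0n.
  exact: sum_sqr_le.
apply: le_trans q1 _.
have q4 : r%:R^-1 * (\sum_a x a) ^+ 2 <= \sum_l s l ^+ 2 by rewrite ler_pdivrMl.
apply: (@le_trans _ _ ((1 - r%:R^-1) * (\sum_a x a) ^+ 2)).
  by rewrite mulrBl mul1r lerB.
by rewrite -mulrA ler_wpM2l // subr_ge0.
Qed.

Lemma rhoS_le S : (0 < #|T|)%N -> rhoS S <= #|S|%:R.
Proof.
move=> T0; have [x [x0 x1 [a0 xa0] xE]] := @perron R (induced S) T0.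
have := xE a0; rewrite xa0 mulr1 -/(rhoS S) => ->.
apply: (@le_trans _ _ (\sum_(b in S) 1)); last by rewrite sumr_const.
rewrite [X in X <= _]big_mkcond [X in _ <= X]big_mkcond; apply: ler_sum => b _ /=.
by rewrite /subrel_on /=; case: (b \in S); rewrite ?andbF //; case: ifP.
Qed.

(** Delete a vertex u of least Perron weight. The weight of a vertex v0 of
    small degree bounds x u from above by Cauchy-Schwarz, where the vertices
    outside the neighbourhood of v0 count with at least the least weight;
    testing the form with x set to 0 at u then gives the bound for S minus u. *)
Lemma delete_vertex (S : {set T}) v0 (al eps : R) :
  v0 \in S -> 2 / 3 <= al -> al <= 1 -> 0 < eps -> eps <= 1 / 3 ->
  2 <= eps * #|S|%:R -> al * #|S|%:R - 1 <= rhoS S ->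
  (deg_in e S v0)%:R < (al - eps) * #|S|%:R ->
  exists2 u, u \in S & rhoS S - (al - eps / 2) <= rhoS (S :\ u).
Proof.
move=> v0S al1 al2 e0 e1 S2 rge dlt.
have T0 : (0 < #|T|)%N by apply/card_gt0P; exists v0.
have [x [x0 x1 [a0 xa0] xE]] := @perron R (induced S) T0.
rewrite -/(rhoS S) in xE.
set N : R := #|S|%:R in S2 rge dlt.
have rleN : rhoS S <= N by apply: rhoS_le.
move: (rhoS S) rge xE rleN => rho rge xE rleN.
set be : R := (deg_in e S v0)%:R in dlt.
have N6 : 6 <= N by nra.
have al1' : al - eps / 2 >= 1 / 2 by lra.
have [u uS umin] : exists2 u, u \in S & forall a, a \in S -> x u <= x a.
  by exists [arg min_(a < v0 | a \in S) x a]%O; case: arg_minP.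
exists u; first exact: uS.
pose X := \sum_a x a ^+ 2; pose w := x u ^+ 2.
have rho0 : 0 <= rho by apply: le_trans rge; nra.
have be0 : 0 <= be by [].
have beN : be <= N by rewrite ler_nat subset_leq_card //; apply/subsetP => a; rewrite inE => /andP[].
have Xge : \sum_(a in S :\: [set b in S | e v0 b]) w + \sum_(a in [set b in S | e v0 b]) x a ^+ 2 <= X.
  rewrite {1}big_mkcond [X in _ + X <= _]big_mkcond -big_split; apply: ler_sum => a _ /=.
  rewrite !inE; have [aS|aS] := boolP (a \in S); rewrite /= ?andbT ?andbF ?add0r ?sqr_ge0 //.
  case: (e v0 a) => /=; rewrite ?add0r ?addr0 //.
  by rewrite /w ler_sqr ?nnegrE ?x0 ?umin.
have cardN : #|S :\: [set b in S | e v0 b]|%:R = N - be :> R.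
  rewrite cardsD natrB ?subset_leq_card ?subsetIl //; congr (_ - _%:R).
  by apply: eq_card => a; rewrite !inE; case: (a \in S).
have w0 : 0 <= w by apply: sqr_ge0.
have h1 : (rho * x u) ^+ 2 <= be * (X - (N - be) * w).
  have s1 : rho * x u <= \sum_(b in [set b in S | e v0 b]) x b.
    apply: (@le_trans _ _ (rho * x v0)); first by rewrite ler_wpM2l // umin.
    rewrite xE le_eqVlt; apply/orP; left; apply/eqP/eq_bigl => b.
    by rewrite inE /= /subrel_on /= v0S /= andbC.
  apply: (@le_trans _ _ ((\sum_(b in [set b in S | e v0 b]) x b) ^+ 2)).
    by rewrite ler_sqr ?nnegrE ?mulr_ge0 ?sumr_ge0.
  apply: le_trans (sum_sqr_le _ _) _; rewrite ler_wpM2l //.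
  move: Xge; rewrite sumr_const -mulr_natl cardN; lra.
have Xw : 0 < X - w.
  have ge2 : 1 <= X.
    rewrite /X (bigD1 a0) //= xa0 expr1n lerDl sumr_ge0 // => a _; exact: sqr_ge0.
  have h : N * w <= X.
    rewrite mulr_natl -sumr_const big_mkcond; apply: ler_sum => a _.
    by case: ifP => [aS|_]; rewrite ?sqr_ge0 // /w ler_sqr ?nnegrE ?x0 ?umin.
  nra.
(* h1 solved for w: the weight of u is at most be / Z times the remaining weight. *)
pose Z := rho ^+ 2 + be * (N - 1 - be).
have hZ : w * Z <= be * (X - w).
  move: h1; rewrite exprMn -/w /Z; nra.
have hZ2 : rho * be <= (al - eps / 2) * Z.
  pose h := rho - al * N.
  have rE : rho = al * N + h by rewrite /h; ring.
  have hh : -1 <= h by rewrite /h; lra.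
  have hg : 0 <= h + eps * N by lra.
  have p1 : h + eps * N <= rho - be by rewrite rE; move: dlt; lra.
  have p2 : be <= (al - eps / 2) * (rho + be) by nra.
  have p3 : (h + eps * N) * be <= (rho - be) * ((al - eps / 2) * (rho + be)).
    by apply: ler_pM => //.
  have p4 : (al - eps / 2) * Z = (rho - be) * ((al - eps / 2) * (rho + be)) + 
     be * (al * N) - be * (eps * N / 2) - be * (al - eps / 2) by rewrite /Z; ring.
  have p5 : rho * be = be * (al * N) + h * be by rewrite rE; ring.
  have p6 : 0 <= be * (eps * N / 2 - (al - eps / 2)).
    by rewrite mulr_ge0 //; move: S2 al2 e0; lra.
  rewrite p4 p5; move: p3 p6; lra.
have Z0 : 0 < Z.
  have : rho >= 2 / 3 * N - 1 by apply: le_trans rge; nra.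
  rewrite /Z; have : be <= N by []. nra.
have hw : rho * w <= (al - eps / 2) * (X - w).
  rewrite -(ler_pM2r Z0).
  apply: (@le_trans _ _ (rho * be * (X - w))).
    by rewrite -(mulrA rho be) -(mulrA rho w); apply: (ler_wpM2l rho0).
  by rewrite -[X in _ <= X]mulrAC; rewrite ler_wpM2r // ltW.
have ray := @rayleigh R (induced (S :\ u)) T0 (fun a => if a == u then 0 else x a).
have := qform_off (@edge_sym (induced S)) x0 xE (pred1 u).
rewrite (sum_off _ (pred1 u)) in ray; rewrite big_pred1_eq in ray; rewrite big_pred1_eq -/X -/w.
have -> : qform (@edge (induced S)) (fun a => if pred1 u a then 0 else x a) =
  qform (@edge (induced (S :\ u))) (fun a => if a == u then 0 else x a).
  apply: eq_bigr => a _; apply: eq_bigr => b _; rewrite /= /subrel_on /=.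
  by rewrite !inE; case: (a == u); case: (b == u); rewrite /= ?mul0r ?mulr0.
move=> /le_trans/(_ ray); rewrite -/(rhoS _) -/X -/w => fin.
rewrite -(ler_pM2r Xw); move: fin hw; rewrite !mulrBl -!mulrA; lra.
Qed.

(** Take S of least cardinality with f S >= f setT, where f S is the
    spectral radius minus (al - eps / 2) times the cardinality. A vertex of
    small degree could be deleted by [delete_vertex], against minimality. So S
    is r-partite, and [rpartite_rho] together with f S >= f setT shows that S
    is large. *)
Theorem dense_core r (al eps : R) N1 :
  (0 < r)%N -> al = 1 - r%:R^-1 -> 2 / 3 <= al -> 0 < eps -> eps <= 1 / 3 ->
  (forall S : {set T}, (N1 <= #|S|)%N ->
    (forall v, v \in S -> (al - eps) * #|S|%:R <= (deg_in e S v)%:R) ->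
    exists c : T -> 'I_r, proper_on e S c) ->
  N1%:R + 2 / eps + 1 <= eps / 2 * #|T|%:R ->
  al * #|T|%:R - 1 <= rhoS setT ->
  exists S : {set T}, [/\ #|T|%:R - 2 / eps <= #|S|%:R,
    forall v, v \in S -> (al - eps) * #|S|%:R <= (deg_in e S v)%:R &
    exists c : T -> 'I_r, proper_on e S c].
Proof.
move=> r0 alE al1 e0 e1 col Tbig rge.
have TR : 0 < #|T|%:R :> R.
  have : 0 < 2 / eps by rewrite divr_gt0.
  have : 0 <= N1%:R :> R by [].
  by move=> *; have : 0 < eps / 2 * #|T|%:R; [lra | rewrite pmulr_rgt0 ?divr_gt0].
have T0 : (0 < #|T|)%N by rewrite ltr0n in TR.
have al2 : al <= 1 by rewrite alE lerBlDr lerDl invr_ge0.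
(* Only these properties of the spectral radii of induced subgraphs matter. *)
have [g [gle gpart gdel gT]] : exists g : {set T} -> R, [/\
    forall S, g S <= #|S|%:R,
    forall S (c : T -> 'I_r), proper_on e S c -> g S <= al * #|S|%:R,
    forall (S : {set T}) v0, v0 \in S ->
      2 <= eps * #|S|%:R -> al * #|S|%:R - 1 <= g S ->
      (deg_in e S v0)%:R < (al - eps) * #|S|%:R ->
      exists2 u, u \in S & g S - (al - eps / 2) <= g (S :\ u) &
    al * #|T|%:R - 1 <= g setT].
  exists rhoS; split=> //.
  - by move=> S; apply: rhoS_le.
  - by move=> S c pc; rewrite alE; apply: rpartite_rho pc T0.
  - by move=> S v0 vS; apply: delete_vertex.
clear rge.
pose f S := g S - (al - eps / 2) * #|S|%:R.
have [S fS Smin] : exists2 S : {set T}, f setT <= f S &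
    forall S', f setT <= f S' -> (#|S| <= #|S'|)%N.
  by exists [arg min_(S < setT | (f setT <= f S)%R) #|S|]%N; case: arg_minnP.
have fT : eps / 2 * #|T|%:R - 1 <= f setT by rewrite /f cardsT; lra.
have Sle : #|S|%:R <= #|T|%:R :> R by rewrite ler_nat max_card.
have rS : (al - eps / 2) * #|S|%:R + eps / 2 * #|T|%:R - 1 <= g S.
  by move: fS fT; rewrite /f; lra.
have Sr := gle S.
have S0 : 0 <= #|S|%:R :> R by [].
have Sge : N1%:R + 2 / eps <= #|S|%:R.
  apply: le_trans Sr; apply: le_trans rS.
  have : 0 <= (al - eps / 2) * #|S|%:R by rewrite mulr_ge0 //; lra.
  lra.
have rS' : al * #|S|%:R - 1 <= g S by apply: le_trans rS; nra.
have minS v : v \in S -> (al - eps) * #|S|%:R <= (deg_in e S v)%:R.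
  move=> vS; rewrite leNgt; apply/negP => dv.
  have eS : 2 <= eps * #|S|%:R.
    have : eps * (2 / eps) = 2 by rewrite mulrC divfK // gt_eqF.
    have h : 0 <= N1%:R :> R by [].
    by move=> <-; rewrite ler_pM2l //; lra.
  have [u uS ru] := gdel S v vS eS rS' dv.
  have : (#|S| <= #|S :\ u|)%N.
    apply: Smin; apply: le_trans fS _; rewrite /f.
    have -> : #|S|%:R = 1 + #|S :\ u|%:R :> R by rewrite (cardsD1 u S) uS natrD.
    move: ru; lra.
  by rewrite (cardsD1 u S) uS add1n ltnn.
have N1S : (N1 <= #|S|)%N.
  have h : 0 < 2 / eps by rewrite divr_gt0.
  by rewrite -(ler_nat R); lra.
have [c pc] := col S N1S minS.
exists S; split=> //; last by exists c.
have rle := gpart S c pc.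
rewrite lerBlDr -lerBlDl ler_pdivlMr //; move: rS rle; lra.
Qed.

End Sub.
End Deletion.

(** * The graphs one vertex away from complete multipartite *)

Section YRel.
Variables (T : finType) (r : nat) (c : T -> 'I_r) (u w v : T).

(** The candidates for G. They are built like Y_r(n), but with classes c of
    any size: u is the added vertex, and w, v are its neighbours in the two
    classes that it otherwise avoids. *)
Definition yrel : rel T := [rel a b |
  if a == u then (b != u) && [|| b == w, b == v | (c b != c w) && (c b != c v)]
  else if b == u then [|| a == w, a == v | (c a != c w) && (c a != c v)]
  else (c a != c b) && ~~ ((a == w) && (b == v) || (a == v) && (b == w))].

Lemma yrel_irr : irreflexive yrel.
Proof. by move=> a; rewrite /yrel /=; case: eqVneq => [_|_] //; rewrite eqxx. Qed.

Lemma yrel_sym : symmetric yrel.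
Proof.
move=> a b; rewrite /yrel /=.
case: (eqVneq a u) => _; case: (eqVneq b u) => _ //=.
by rewrite [c b == c a]eq_sym orbC [(b == w) && _]andbC [(b == v) && _]andbC.
Qed.

Hypotheses (uw : u != w) (uv : u != v) (cwv : c w != c v).

Lemma pigeon_ord (g : 'I_r.+1 -> 'I_r) : exists i j, i != j /\ g i = g j.
Proof.
case: (boolP (injectiveb g)) => [/injectiveP/leq_card|].
  by rewrite !card_ord ltnn.
move/injectivePn => [i [j ij gij]]; by exists i, j.
Qed.

(** Recolouring u by the colour of w, the only monochromatic edge is u w,
    so a clique with r + 1 vertices contains it. By symmetry it contains v. *)
Lemma clique_through (f : 'I_r.+1 -> T) :
  (forall i j, i != j -> yrel (f i) (f j)) -> (exists i, f i = w) /\ exists i, f i = v.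
Proof.
move=> fe; split.
  have [i [j [ij]]] := pigeon_ord (fun i => if f i == u then c w else c (f i)).
  have := fe i j ij; rewrite /yrel /=.
  case: eqVneq => [fi|fi]; case: eqVneq => [fj|fj] //=.
  - case/or3P => [/eqP<-|/eqP-> /eqP|/andP[/negPf h _] /eqP]; first by exists j.
      by rewrite (negPf cwv).
    by rewrite eq_sym h.
  - case/or3P => [/eqP<-|/eqP-> /eqP|/andP[/negPf h _] /eqP]; first by exists i.
      by rewrite eq_sym (negPf cwv).
    by rewrite h.
  - by case/andP => /negPf h _ /eqP; rewrite h.
have [i [j [ij]]] := pigeon_ord (fun i => if f i == u then c v else c (f i)).
have := fe i j ij; rewrite /yrel /=.
case: eqVneq => [fi|fi]; case: eqVneq => [fj|fj] //=.
- case/or3P => [/eqP-> /eqP|/eqP<-|/andP[_ /negPf h] /eqP]; last by rewrite eq_sym h.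
    by rewrite eq_sym (negPf cwv).
  by exists j.
- case/or3P => [/eqP-> /eqP|/eqP<-|/andP[_ /negPf h] /eqP]; last by rewrite h.
    by rewrite (negPf cwv).
  by exists i.
- by case/andP => /negPf h _ /eqP; rewrite h.
Qed.

Lemma yrel_wv : ~~ yrel w v.
Proof. by rewrite /yrel /= [w == u]eq_sym [v == u]eq_sym (negPf uw) (negPf uv) !eqxx andbF. Qed.

Lemma yrel_noclique (f : 'I_r.+1 -> T) :
  ~ (forall i j, i != j -> yrel (f i) (f j)).
Proof.
move=> fe; have [[i fi] [j fj]] := clique_through fe.
have := fe i j; rewrite fi fj (negPf yrel_wv); case: eqVneq => [ij|_ /(_ isT)] //.
by move: cwv; rewrite -fi -fj ij eqxx.
Qed.

(** The 5-cycle u w v' y v, joined to one vertex of each of the other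
    classes, needs r + 1 colours. *)
Lemma yrel_not_colorable y v' (s : 'I_r -> T) (k : T -> 'I_r) :
  c y = c w -> y != u -> y != w -> c v' = c v -> v' != u -> v' != v ->
  (forall l, s l != u) -> (forall l, c (s l) = l) ->
  ~ (forall a b, yrel a b -> k a != k b).
Proof.
move=> cy yu yw cv' v'u v'v su cs ke.
pose psi l := if l == c w then w else if l == c v then u else s l.
have sw l : l != c w -> s l != w by apply: contraNneq => h; rewrite -(cs l) h.
have sv l : l != c v -> s l != v by apply: contraNneq => h; rewrite -(cs l) h.
have us l : l != c w -> l != c v -> yrel u (s l).
  by move=> lw lv; rewrite /yrel /= eqxx (negPf (su l)) cs lw lv !orbT.
have as_ l a : l != c w -> l != c v -> a != u -> c a != l -> yrel a (s l).
  move=> lw lv au al; rewrite /yrel /= (negPf au) (negPf (su l)) cs al.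
  by rewrite (negPf (sw l lw)) (negPf (sv l lv)) !andbF.
have yuw : yrel u w by rewrite /yrel /= eqxx [w == u]eq_sym uw eqxx.
have yuv : yrel u v by rewrite /yrel /= eqxx [v == u]eq_sym uv eqxx orbT.
have inj : injective (k \o psi).
  move=> i j /= /eqP; have [//|ij] := eqVneq i j; rewrite -[_ == _]negbK; case/negP.
  have nsym a b : yrel a b -> k b != k a by rewrite eq_sym; apply: ke.
  rewrite /psi; have [iw|iw] := eqVneq i (c w); have [jw|jw] := eqVneq j (c w).
  - by move: ij; rewrite iw jw eqxx.
  - have [jv|jv] := eqVneq j (c v); first exact: nsym.
    by apply/ke/as_ => //; rewrite ?[w == u]eq_sym // eq_sym.
  - have [iv|iv] := eqVneq i (c v); first exact: ke.
    by apply/nsym/as_ => //; rewrite ?[w == u]eq_sym // eq_sym.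
  - have [iv|iv] := eqVneq i (c v); have [jv|jv] := eqVneq j (c v).
    + by move: ij; rewrite iv jv eqxx.
    + exact/ke/us.
    + exact/nsym/us.
    + by apply/ke/as_; rewrite ?cs.
have two a : a != u -> (c a == c w) || (c a == c v) -> k a = k w \/ k a = k u.
  move=> au ca; have [l kl] : exists l, k (psi l) = k a.
    by have := injF_onto inj (k a) => /codomP[l ->]; exists l.
  move: kl; rewrite /psi; case: eqVneq => [_ <-|lw]; first by left.
  case: eqVneq => [_ <-|lv]; first by right.
  move/esym/eqP; rewrite -[_ == _]negbK; case/negP; apply/ke/as_ => //.
  by case/orP: ca => /eqP ->; rewrite eq_sym.
have wu : w != u by rewrite eq_sym.
have vu : v != u by rewrite eq_sym.
have cvw : c v != c w by rewrite eq_sym.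
have wv : w != v by apply: contraNneq cwv => ->.
have v'w : v' != w by apply: contraNneq cwv => <-; rewrite cv'.
have kv : k v = k w.
  have [//|kvu] := two v vu (ltac:(by rewrite eqxx orbT)).
  by have := ke u v yuv; rewrite kvu eqxx.
have kv' : k v' = k u.
  have [kvw|//] := two v' v'u (ltac:(by rewrite cv' eqxx orbT)).
  have : yrel w v'.
    by rewrite /yrel /= (negPf wu) (negPf v'u) cv' cwv (negPf v'v) (negPf wv) andbF.
  by move/ke; rewrite kvw eqxx.
have yv : yrel y v.
  rewrite /yrel /= (negPf yu) (negPf vu) cy cwv (negPf yw) /=.
  by rewrite [v == w]eq_sym (negPf wv) andbF.
have yv' : yrel y v'.
  by rewrite /yrel /= (negPf yu) (negPf v'u) cy cv' cwv (negPf yw) (negPf v'w) andbF.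
have [kyw|kyu] := two y yu (ltac:(by rewrite cy eqxx)).
  by have := ke y v yv; rewrite kyw kv eqxx.
by have := ke y v' yv'; rewrite kyu kv' eqxx.
Qed.

Hypothesis big : forall l, 3 < #|[set a | c a == l]|.

Lemma class_pick l : exists a, [/\ c a = l, a != u, a != w & a != v].
Proof using big.
have : ~~ ([set a | c a == l] \subset [set u; w; v]).
  apply: contraL (big l) => /subset_leq_card h; rewrite -leqNgt; apply: leq_trans h _.
  rewrite -setUA; apply: leq_trans (leq_card_setU _ _) _; rewrite cards1 cards2.
  by case: (w != v).
case/subsetPn => a; rewrite !inE !negb_or => /eqP ca /andP[/andP[? ?] ?].
by exists a.
Qed.

Lemma yrel_uncolorable :
  ~ exists k : T -> 'I_r, forall a b, yrel a b -> k a != k b.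
Proof using uw uv cwv big.
have [y [cy yu yw _]] := class_pick (c w); have [v' [cv' v'u _ v'v]] := class_pick (c v).
have pick' l : exists a, c a = l /\ a != u by have [a [? ? _ _]] := class_pick l; exists a.
have [s sP] := boolp.choice pick'.
move=> [k kP]; apply: (yrel_not_colorable cy yu yw cv' v'u v'v _ _ kP (s := s)).
  by move=> l; case: (sP l).
by move=> l; case: (sP l).
Qed.

End YRel.

Section Forbidden.
Variables (r : nat) (t : (r - 2).-tuple nat).
Hypotheses (r3 : 2 < r) (t1 : all (leq 1) t).

Local Notation F := (complete_multipartite [tuple of [:: 1, 1, 1 & t]]).

(** Pick one vertex in each part; the hypothesis on t makes the parts
    nonempty. *)
Lemma forbidden_clique (G : sgraph) : has_subgraph F G ->
  exists f : 'I_r.+1 -> G, forall i j, i != j -> edge (f i) (f j).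
Proof.
have rE : r.+1 = (r - 2).+3 by lia.
move=> [g ginj ge].
have pos (i : 'I_(r - 2).+3) : 0 < tnth [tuple of [:: 1, 1, 1 & t]] i.
  rewrite (tnth_nth 0) /=; case: i => [[|[|[|i]]] ir] //=.
  by apply: (allP t1); rewrite mem_nth // size_tuple.
pose p (i : 'I_(r - 2).+3) : F := Tagged (fun i => 'I_(tnth _ i)) (Ordinal (pos i)).
exists (fun i => g (p (cast_ord rE i))) => i j ij; apply: ge.
have ne : cast_ord rE i != cast_ord rE j by rewrite (inj_eq (@cast_ord_inj _ _ _)).
apply/andP; split; last by rewrite /= ne.
by apply: contra_neq ne => /(congr1 tag).
Qed.

(** Larger parts make a larger graph, so tm may exceed the entries of t. *)
Lemma free_tame (G : sgraph) (tm : nat) : Defs.free F G -> (forall x, x \in t -> x <= tm) ->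
  tame (@edge G) r tm.
Proof.
move=> fF tle x y w B xy xw yw Bt Bxyw Be; apply: fF.
pose U (i : 'I_(r - 2).+3) : {set G} :=
  match val i with 0 => [set x] | 1 => [set y] | 2 => [set w] | k.+3 => B k end.
apply: (multipartite_embed (U := U)).
  move=> i; rewrite (tnth_nth 0) /U; case: i => [[|[|[|i]]] ir] /=; rewrite ?cards1 //.
  apply: leq_trans (Bt i _) => //; apply: tle; rewrite mem_nth // size_tuple.
  by move: ir; rewrite !ltnS.
move=> [[|[|[|i]]] ir] [[|[|[|j]]] jr] //= ij a b; rewrite /U /= ?inE.
- by move=> /eqP-> /eqP->.
- by move=> /eqP-> /eqP->.
- by move=> /eqP-> /(Bxyw j b (ltac:(by move: jr; rewrite !ltnS)))/and3P[].
- by move=> /eqP-> /eqP->.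
- by move=> /eqP-> /(Bxyw j b (ltac:(by move: jr; rewrite !ltnS)))/and3P[].
- by move=> /eqP-> /(Bxyw j b (ltac:(by move: jr; rewrite !ltnS)))/and3P[].
apply: (Be i j); move: ij jr; rewrite !ltnS => ij jr; apply/andP; split=> //.
Qed.

End Forbidden.

Section Transport.
Variable R : realType.

Lemma chromatic_lt (G : sgraph) r : (r < chromatic_number G) = ~~ colorable G r.
Proof.
rewrite /chromatic_number; case: ex_minnP => m colm mmin.
apply/idP/idP => [rm|ncol]; first by apply: contraL rm => /mmin; rewrite leqNgt.
rewrite ltnNge; apply: contra ncol => mr.
have /existsP[f fP] := colm; apply/existsP; exists [ffun x => widen_ord mr (f x)].
apply/forallP => x; apply/forallP => y; apply/implyP => xy; rewrite !ffunE.
have /forallP/(_ x)/forallP/(_ y)/implyP/(_ xy) := fP.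
by apply: contra_neq => /(congr1 val)/= /val_inj.
Qed.

Lemma colorableP (G : sgraph) r :
  reflect (exists k : G -> 'I_r, forall a b, edge a b -> k a != k b) (colorable G r).
Proof.
apply: (iffP existsP) => [[f fP]|[k kP]].
  by exists f => a b ab; have /forallP/(_ a)/forallP/(_ b)/implyP/(_ ab) := fP.
exists [ffun a => k a]; apply/forallP => a; apply/forallP => b; apply/implyP => /kP.
by rewrite !ffunE.
Qed.

Lemma iso_sym (G H : sgraph) : isomorphic G H -> isomorphic H G.
Proof.
move=> [f [g fK gK] fe]; exists g; first by exists f.
by move=> x y; rewrite -fe !gK.
Qed.

Lemma iso_trans (G H K : sgraph) : isomorphic G H -> isomorphic H K -> isomorphic G K.
Proof.
move=> [f bf fe] [g bg ge]; exists (g \o f); first exact: bij_comp.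
by move=> x y /=; rewrite ge fe.
Qed.

(** Transport the Perron vector and apply the Rayleigh bound. *)
Lemma iso_spectral_le (G H : sgraph) : 0 < #|G| -> isomorphic G H ->
  (spectral_radius (adjacency R G) <= spectral_radius (adjacency R H))%R.
Proof.
move=> G0 [f [g fK gK] fe].
have H0 : 0 < #|H| by rewrite -(bij_eq_card (f := f)) //; exists g.
have [x [x0 _ [a0 xa0] xE]] := @perron R G G0.
have := @rayleigh R H H0 (x \o g).
have -> : (\sum_a (x \o g) a ^+ 2 = \sum_a x a ^+ 2)%R.
  by rewrite (reindex f) /=; [apply: eq_bigr => a _; rewrite fK | exists g => a _].
have -> : qform (@edge H) (x \o g) = qform (@edge G) x.
  rewrite /qform (reindex f) /=; last by exists g => a _.
  apply: eq_bigr => a _; rewrite (reindex f) /=; last by exists g => b _.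
  by apply: eq_bigr => b _; rewrite fe !fK.
rewrite (qform_eigen xE) ler_pM2r //.
rewrite (bigD1 a0) //= xa0 expr1n ltr_wpDr // sumr_ge0 // => a _.
exact: sqr_ge0.
Qed.

Lemma iso_card (G H : sgraph) : isomorphic G H -> #|G| = #|H|.
Proof. by move=> [f bf _]; apply: bij_eq_card bf. Qed.

Lemma iso_spectral (G H : sgraph) : 0 < #|G| -> isomorphic G H ->
  spectral_radius (adjacency R G) = spectral_radius (adjacency R H).
Proof.
move=> G0 GH; apply/eqP; rewrite eq_le !iso_spectral_le -?(iso_card GH) //; exact: iso_sym.
Qed.

Lemma iso_admissible r n (F G H : sgraph) : isomorphic G H ->
  admissible r n F G -> admissible r n F H.
Proof.
move=> [f [g fK gK] fe] [cG chG fG]; split.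
- by rewrite -cG; apply/esym/bij_eq_card; exists g.
- move: chG; rewrite !chromatic_lt; apply: contra => /colorableP[k kP].
  by apply/colorableP; exists (k \o f) => a b; rewrite -fe => /kP.
move=> [h hinj he]; apply: fG; exists (g \o h); first by apply: inj_comp => //; apply: can_inj gK.
by move=> x y /he; rewrite -fe /= !gK.
Qed.

End Transport.

(** * Rewiring vertices *)

Section Comparison.
Variable R : realType.
Local Open Scope ring_scope.
Variables (T : finType) (e e' : rel T) (rho : R) (x : T -> R) (D : pred T).
Hypotheses (symE : symmetric e) (symE' : symmetric e').
Hypotheses (x0 : forall a, 0 <= x a) (rho0 : 0 < rho).
Hypothesis xE : forall a, rho * x a = \sum_(b | e a b) x b.
Hypothesis ray : forall y : T -> R, qform e' y <= rho * \sum_a y a ^+ 2.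
Hypothesis sub : forall a b, ~~ D a -> ~~ D b -> e a b -> e' a b.

Let del a := \sum_(b | ~~ D b && e' a b) x b.

(** Keep the Perron vector x outside D and optimise the test vector on D:
    its entries there become the weighted degrees divided by rho. The edges
    inside D contribute nonnegatively to e' and can be ignored. *)
Lemma compare_degrees : \sum_(a | D a) del a ^+ 2 <= \sum_(a | D a) (rho * x a) ^+ 2.
Proof.
have del0 a : 0 <= del a by apply: sumr_ge0.
pose off a := if D a then 0 else x a.
pose y a := if D a then del a / rho else x a.
have y0 a : 0 <= y a by rewrite /y; case: (D a) => //; rewrite divr_ge0 // ltW.
set A := \sum_(a | D a) del a ^+ 2; set B := \sum_(a | D a) (rho * x a) ^+ 2.
have BE : B = rho ^+ 2 * \sum_(a | D a) x a ^+ 2.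
  by rewrite /B mulr_sumr; apply: eq_bigr => a _; rewrite exprMn.
have h1 := qform_off symE x0 xE D; rewrite -/off in h1.
have h2 : qform e off <= qform e' off.
  apply: ler_sum => a _; apply: ler_sum => b _; rewrite /off.
  have [Da|Da] := boolP (D a); first by rewrite mul0r !mulr0.
  have [Db|Db] := boolP (D b); first by rewrite !mulr0.
  rewrite ler_wpM2r ?mulr_ge0 // ler_nat.
  by case eab: (e a b) => //; rewrite (sub Da Db eab).
have g1 : \sum_(a | D a) y a * del a = A / rho.
  rewrite /A mulr_suml; apply: eq_bigr => a Da; rewrite /y Da expr2; ring.
have g2 : \sum_a \sum_b (D a && ~~ D b)%:R * ((e' a b)%:R * (y a * y b)) = A / rho.
  rewrite -g1 [RHS]big_mkcond; apply: eq_bigr => a _; case Da: (D a) => /=; last first.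
    by rewrite big1 // => b _; rewrite mul0r.
  rewrite mulr_sumr [RHS]big_mkcond; apply: eq_bigr => b _.
  rewrite {2}/y; case: (D b) => /=; first by rewrite mul0r.
  by case: (e' a b); rewrite /= ?mul1r ?mul0r ?mulr0.
have g3 : \sum_a \sum_b (D b && ~~ D a)%:R * ((e' a b)%:R * (y a * y b)) = A / rho.
  rewrite -g2 exchange_big; apply: eq_bigr => a _; apply: eq_bigr => b _.
  by rewrite symE' [y b * _]mulrC.
have h3 : qform e' off + 2 * (A / rho) <= qform e' y.
  rewrite mulr_natl mulr2n -{1}g2 -g3 -!big_split; apply: ler_sum => a _ /=.
  rewrite -!big_split; apply: ler_sum => b _ /=.
  have yy : 0 <= y a * y b by rewrite mulr_ge0.
  rewrite /off; case Da: (D a); case Db: (D b); rewrite /= ?(mul0r, mulr0, mul1r, add0r, addr0) ?mulr_ge0 //.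
  by rewrite /y Da Db.
have h4 : \sum_a y a ^+ 2 = \sum_a x a ^+ 2 - \sum_(a | D a) x a ^+ 2 + A / rho ^+ 2.
  rewrite -(sum_off x D) /A mulr_suml [X in _ + X]big_mkcond -big_split.
  apply: eq_bigr => a _ /=; rewrite /y; case: (D a); rewrite ?addr0 //.
  by rewrite expr0n add0r expr_div_n.
have := ray y; rewrite h4 => h5.
rewrite BE; set X := \sum_a x a ^+ 2 in h1 h5; set Z := \sum_(a | D a) x a ^+ 2 in h1 h5 *.
have r1 : rho * (A / rho) = A by rewrite mulrC divfK // gt_eqF.
have r2 : rho * (A / rho ^+ 2) = A / rho.
  have rn : rho != 0 by rewrite gt_eqF.
  by move: (A) => A'; field.
have h6 : A / rho <= rho * Z.
  move: h1 h2 h3 h5; rewrite !mulrDr mulrN r2 -mulrA; lra.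
by rewrite -r1 expr2 -mulrA ler_pM2l.
Qed.

End Comparison.

Section Clone.
Variables (G F : sgraph) (d : G) (U W : {set G}) (m : nat).

Definition reattach : rel G := [rel a b |
  if a == d then (b != d) && (b \in U) else
  if b == d then a \in U else edge a b].

Lemma reattach_irr : irreflexive reattach.
Proof. by move=> a; rewrite /reattach /=; case: eqVneq => //; rewrite edge_irr. Qed.

Lemma reattach_sym : symmetric reattach.
Proof.
move=> a b; rewrite /reattach /=; case: (eqVneq a d) => _; case: (eqVneq b d) => _ //=.
exact: edge_sym.
Qed.

(** In a copy of F that uses d, the vertex d can be replaced by an unused
    vertex of W joined to all of its neighbours in the copy: each of the at
    most #|F| other vertices excludes at most m + 1 candidates. *)
Lemma clone_free : Defs.free F G ->
  (forall a, a \in U -> #|[set b in W | ~~ edge a b]| <= m) -> #|F| * m.+1 < #|W| ->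
  Defs.free F (SGraph reattach_sym reattach_irr).
Proof.
move=> fF Um Wbig [h hinj he].
case: (pickP [pred p | h p == d]) => [p /= /eqP hp|no]; last first.
  apply: fF; exists h => // a b ab; have := he a b ab; rewrite /= /reattach /=.
  by have := no a; have := no b; rewrite /= => -> ->.
pose bad q := if edge p q then [set b in W | ~~ @edge G (h q) b] :|: [set (h q : G)] else [set (h q : G)].
have badm q : #|bad q| <= m.+1.
  rewrite /bad; case: ifP => pq; last by rewrite cards1.
  apply: leq_trans (leq_card_setU _ _) _; rewrite cards1 addn1 ltnS; apply: Um.
  have := he p q pq; rewrite /= /reattach /= hp eqxx => /andP[_ //].
have : ~~ (W \subset \bigcup_(q in [set: F]) bad q).
  apply: contraL Wbig => /subset_leq_card h1; rewrite -leqNgt; apply: leq_trans h1 _.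
  by rewrite -cardsT; apply: card_bigcup_le.
case/subsetPn => v vW /bigcupP nv.
have vh q : v != h q.
  apply: contra_notN nv => /eqP ->; exists q; rewrite ?inE // /bad.
  by case: ifP; rewrite !inE eqxx ?orbT.
have ve q : edge p q -> @edge G (h q) v.
  move=> pq; apply: contra_notT nv => nhv; exists q; rewrite ?inE // /bad pq !inE vW /=.
  by rewrite nhv.
apply: fF; exists (fun q => if q == p then v else h q).
  move=> a b; case: eqVneq => [->|ap]; case: eqVneq => [->|bp] //.
  - by move=> hv; have := vh b; rewrite hv eqxx.
  - by move=> hv; have := vh a; rewrite hv eqxx.
  - exact: hinj.
move=> a b ab; case: eqVneq => [ap|ap]; case: eqVneq => [bp|bp].
- by move: ab; rewrite ap bp edge_irr.
- by rewrite edge_sym; apply: ve; rewrite -ap.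
- by apply: ve; rewrite -bp edge_sym.
have ha : h a != d by rewrite -hp (inj_eq hinj).
have hb : h b != d by rewrite -hp (inj_eq hinj).
by have := he a b ab; rewrite /= /reattach /= (negPf ha) (negPf hb).
Qed.

End Clone.

(** * Perron weights of the core *)

Section CorePerron.
Variable R : realType.
Local Open Scope ring_scope.
Variables (T : finType) (e : rel T) (r t : nat).
Hypotheses (symE : symmetric e) (r3 : (2 < r)%N) (t0 : (0 < t)%N) (tameT : tame e r t).
Variables (S : {set T}) (c : T -> 'I_r) (D : nat).
Local Notation n := (#|T|%:R : R).
Local Notation q := (n / r%:R).
Hypotheses (D0 : (0 < D)%N) (Sge : n - D%:R <= #|S|%:R).
Hypothesis degS : forall v, v \in S -> n - q - D%:R <= (deg_in e S v)%:R.
Hypothesis properS : proper_on e S c.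
Variables (rho : R) (x : T -> R).
Hypotheses (x0 : forall a, 0 <= x a) (x1 : forall a, x a <= 1) (xmax : exists a, x a = 1).
Hypothesis xE : forall a, rho * x a = \sum_(b | e a b) x b.
Hypothesis rhoge : n - q - 1 <= rho.

Definition core_err : R := (core_const r t)%:R * D%:R.
Local Notation E := core_err.
Hypothesis Eq : 2 * r%:R * E <= q.

Definition wt l := \sum_(b in cls S c l) x b.
Definition nwt v l := \sum_(b in cls S c l | e v b) x b.

Let r2 : (1 < r)%N := ltnW r3.
Let rqE : r%:R * q = n := @rq R r r2 n.
Let Sle : #|S|%:R <= n. Proof. by rewrite ler_nat max_card. Qed.
Let r3R : 3 <= r%:R :> R. Proof. by rewrite ler_nat. Qed.
Let D1 : 1 <= D%:R :> R. Proof. by rewrite ler1n. Qed.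

Lemma core_errE : 2 * (tau r t D)%:R + 2 * (missing r D)%:R + r%:R * D%:R <= E.
Proof. exact: core_const_le. Qed.

Lemma missingE : (missing r D)%:R = (r%:R + 1) * D%:R :> R.
Proof. by rewrite /missing natrM -addn1 natrD. Qed.

Let rD : D%:R <= r%:R * D%:R :> R.
Proof. by rewrite ler_peMl // ler1n ltnW. Qed.

Let q0 : 0 <= q. Proof. by rewrite divr_ge0. Qed.
Let tau0 : 0 <= (tau r t D)%:R :> R. Proof. by []. Qed.

Let E0 : 0 <= E. Proof. by rewrite mulr_ge0. Qed.

Lemma Ebig : 11 <= E.
Proof.
have := core_errE; rewrite missingE; have : 3 * D%:R <= r%:R * D%:R :> R by apply: ler_wpM2r => //; exact: r3R.
move: tau0 D1; lra.
Qed.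

Lemma core_class_le l : #|cls S c l|%:R <= q + D%:R.
Proof. exact: class_le Sle degS properS l. Qed.

Lemma core_class_ge l : q - r%:R * D%:R <= #|cls S c l|%:R.
Proof. exact: (class_ge r2 Sle Sge degS properS). Qed.

Lemma wt_le l : wt l <= #|cls S c l|%:R.
Proof. by rewrite /wt -sumr_const; apply: ler_sum. Qed.

Lemma nwt_ge0 v l : 0 <= nwt v l.
Proof. by apply: sumr_ge0. Qed.

Lemma nwt_wt v l : nwt v l <= wt l.
Proof.
rewrite /wt (bigID (fun b => e v b)) /= lerDl; exact: sumr_ge0.
Qed.

Lemma nwt_card v l : nwt v l <= #|[set w in cls S c l | e v w]|%:R.
Proof.
rewrite /nwt -sum1dep_card natr_sum; apply: ler_sum => b _; exact: x1.
Qed.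

Lemma nwt_pair v w l :
  nwt v l + nwt w l <= #|cls S c l|%:R + #|[set b in cls S c l | e v b && e w b]|%:R.
Proof.
have h : (#|[set b in cls S c l | e v b]| + #|[set b in cls S c l | e w b]| <=
   #|cls S c l| + #|[set b in cls S c l | e v b && e w b]|)%N.
  rewrite -cardsUI; apply: leq_add; apply: subset_leq_card; apply/subsetP => b; rewrite !inE.
    by case/orP => /andP[].
  by case: (b \in S) => //=; case: (c b == l) => //=.
move: h; rewrite -(ler_nat R) !natrD; have := nwt_card v l; have := nwt_card w l; lra.
Qed.

Lemma nbr_sum v : \sum_l nwt v l <= rho * x v <= D%:R + \sum_l nwt v l.
Proof.
rewrite xE (bigID (fun b => b \in S)) /=.
have -> : \sum_(b | e v b && (b \in S)) x b = \sum_l nwt v l.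
  rewrite (partition_big c predT) //=; apply: eq_bigr => l _.
  by apply: eq_bigl => b; rewrite !inE -andbA andbC.
have out : \sum_(b | e v b && (b \notin S)) x b <= D%:R.
  apply: (@le_trans _ _ (\sum_(b in ~: S) 1)).
    rewrite big_mkcond [X in _ <= X]big_mkcond; apply: ler_sum => b _; rewrite !inE.
    by case: (b \in S); rewrite ?andbF // andbT; case: (e v b).
  rewrite sumr_const; have := cardsC S; move/(congr1 (fun k => k%:R : R)); rewrite natrD.
  by move: Sge; lra.
have out0 : 0 <= \sum_(b | e v b && (b \notin S)) x b by apply: sumr_ge0.
move: out out0; lra.
Qed.

(** The vertex v has few neighbours in some class, by [near_vertex]. *)
Lemma perron_le v : rho * x v <= n - q + E - D%:R.
Proof.
have /andP[_ h] := nbr_sum v.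
have [i ile] := near_vertex r2 t0 tameT Sle Sge degS properS v.
move: h; rewrite (bigD1 i) //=.
have := sum_le1 (F := nwt v) (i := i) (fun l _ => le_trans (nwt_wt v l) (le_trans (wt_le l) (core_class_le l))).
have hi : nwt v i <= (tau r t D)%:R by apply: le_trans (nwt_card v i) _; rewrite ler_nat ltnW.
have := core_errE; rewrite missingE; move: rqE tau0 D1 rD hi; lra.
Qed.

Lemma rho_le : rho <= n - q + E - D%:R.
Proof. by have [a xa] := xmax; have := perron_le a; rewrite xa mulr1. Qed.

(** A core vertex misses few vertices outside its class. *)
Lemma nwt_class v : v \in S -> \sum_(l | l != c v) wt l - (missing r D)%:R <= \sum_l nwt v l.
Proof.
move=> vS; rewrite [X in _ <= X](bigD1 (c v)) //=.
have -> : \sum_(l | l != c v) wt l = \sum_(l | l != c v) nwt v l +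
    \sum_(l | l != c v) \sum_(b in cls S c l | ~~ e v b) x b.
  by rewrite -big_split; apply: eq_bigr => l _; rewrite /wt (bigID (fun b => e v b)).
have h := miss_le r2 Sle Sge degS properS (degS vS) (fun w => nbr_class properS vS).
have : \sum_(l | l != c v) \sum_(b in cls S c l | ~~ e v b) x b <= (missing r D)%:R.
  apply: (@le_trans _ _ #|[set b in S | (c b != c v) && ~~ e v b]|%:R); last by rewrite ler_nat.
  rewrite -sum1dep_card natr_sum (partition_big c (fun l => l != c v)) /=; last first.
    by move=> b /and3P[].
  apply: ler_sum => l lv.
  rewrite (eq_bigl (fun b => [&& b \in S, c b != c v & ~~ e v b] && (c b == l))).
    by apply: ler_sum => b _; apply: x1.
  move=> b; rewrite !inE; case: (b \in S) => //=; case: eqP => [->|]; rewrite ?andbF //=.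
  by rewrite lv andbT.
have := nwt_ge0 v (c v); lra.
Qed.

(** A vertex of weight 1 is nearly joined to r - 1 classes, and the
    eigenvalue equation there bounds their weights from below. The remaining
    class i is heavy too, since each of its core vertices is joined to nearly
    all other classes and so has weight close to 1. *)
Lemma wt_ge l : q - E <= wt l.
Proof.
have [u xu] := xmax; have /andP[_ hu] := nbr_sum u.
have [i ile] := near_vertex r2 t0 tameT Sle Sge degS properS u.
have hi : nwt u i <= (tau r t D)%:R by apply: le_trans (nwt_card u i) _; rewrite ler_nat ltnW.
rewrite xu mulr1 (bigD1 i) //= in hu.
have EE := core_errE; rewrite missingE in EE.
have wle j : wt j <= q + D%:R := le_trans (wt_le j) (core_class_le j).
have others j : j != i -> q - E <= wt j.
  move=> ji; have h2 : \sum_(l | l != i) nwt u l <= wt j + (r%:R - 2) * (q + D%:R).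
    rewrite (bigD1 j) //=; apply: lerD; first exact: nwt_wt.
    apply: sum_le2; rewrite 1?eq_sym // => k _ _.
    exact: le_trans (nwt_wt u k) (wle k).
  move: hu hi h2 EE rhoge rqE tau0 D1 rD; lra.
have [->|] := eqVneq l i; last exact: others.
have rsum : rho - D%:R - (tau r t D)%:R <= \sum_(k | k != i) wt k.
  have : \sum_(k | k != i) nwt u k <= \sum_(k | k != i) wt k.
    by apply: ler_sum => k _; apply: nwt_wt.
  move: hu hi; lra.
have hv v : v \in cls S c i -> rho - D%:R - (tau r t D)%:R - (missing r D)%:R <= rho * x v.
  rewrite inE => /andP[vS /eqP vi]; have /andP[h _] := nbr_sum v.
  have := nwt_class vS; rewrite vi; move: h rsum; lra.
have hs : #|cls S c i|%:R * (rho - D%:R - (tau r t D)%:R - (missing r D)%:R) <= rho * wt i.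
  rewrite mulr_natl -sumr_const /wt mulr_sumr; apply: ler_sum => v; exact: hv.
have ci := core_class_le i; have cg := core_class_ge i.
have m0 : 0 <= (missing r D)%:R :> R by [].
have Eb := Ebig.
have rq2 : q + D%:R <= rho.
  by move: rhoge rqE Eq EE m0 tau0 D1 q0 r3R E0 Eb; rewrite missingE; nra.
have rho0 : 0 < rho by move: rq2 q0 D1; lra.
rewrite -(ler_pM2l rho0).
have h7 : #|cls S c i|%:R * (D%:R + (tau r t D)%:R + (missing r D)%:R) <=
    rho * (D%:R + (tau r t D)%:R + (missing r D)%:R).
  by rewrite ler_wpM2r ?(le_trans ci) // !addr_ge0.
have h8 : rho * (q - r%:R * D%:R) <= rho * #|cls S c i|%:R by rewrite ler_wpM2l // ltW.
have h9 : rho * (D%:R + (tau r t D)%:R + (missing r D)%:R + r%:R * D%:R) <= rho * E.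
  by rewrite ler_wpM2l ?(ltW rho0) // missingE; move: EE D1 rD tau0; lra.
move: hs h7 h8 h9; lra.
Qed.

Lemma wt_sum1 i : n - q - r%:R * E + E <= \sum_(l | l != i) wt l.
Proof.
have := sum_ge1 (F := wt) (i := i) (fun l _ => wt_ge l).
move: rqE; lra.
Qed.

Lemma wt_sum2 i j : i != j -> n - 2 * q - r%:R * E + 2 * E <=
  \sum_(l | (l != i) && (l != j)) wt l.
Proof.
move=> ij; have := sum_ge2 (F := wt) ij (fun l _ _ => wt_ge l).
move: rqE; lra.
Qed.

End CorePerron.

(** * The critical vertex *)

(** Here a and b stand for rho x z and rho x d, with X = n - q and Y = n -
    2 q. The square inequality together with an upper bound on a + b or on b
    confines (a, b) to a neighbourhood of (Y, X). *)
Section Alg.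
Local Open Scope ring_scope.
Variable R : realType.
Variables (X Y q r E a b : R).
Hypotheses (XY : X = Y + q) (rq : r * q = X + q) (r3 : 3 <= r) (E0 : 0 < E) (Eq : 144 * r ^+ 4 * E <= q).
Hypotheses (a0 : 0 <= a) (ab : a <= b).
Hypothesis sq : (X - r * E) ^+ 2 + (Y - r * E) ^+ 2 <= a ^+ 2 + b ^+ 2.

Let r0 : 0 < r. Proof. by move: r3; lra. Qed.
Let r2 : 9 <= r ^+ 2. Proof. by move: r3; nra. Qed.
Let r24 : 9 * r ^+ 2 <= r ^+ 4. 
Proof. by rewrite (_ : r ^+ 4 = r ^+ 2 * r ^+ 2) ?ler_pM2r //; [exact: lt_le_trans r2|rewrite -exprD]. Qed.
Let r12 : 3 * r <= r ^+ 2. Proof. by rewrite expr2 ler_pM2r. Qed.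
Let q0 : 0 < q. Proof. by apply: lt_le_trans Eq; rewrite mulr_gt0 // mulr_gt0 // exprn_gt0. Qed.
Let Eq2 : 1296 * (r ^+ 2 * E) <= q.
Proof. apply: le_trans Eq; have : 9 * r ^+ 2 * E <= r ^+ 4 * E by rewrite ler_pM2r. by move=> h; lra. Qed.
Let YE : Y = r * q - 2 * q. Proof. by move: XY rq; lra. Qed.
Let XE' : X = r * q - q. Proof. by move: rq; lra. Qed.
Let Yq : q <= Y. Proof. by rewrite YE; have := ler_wpM2r (ltW q0) r3; lra. Qed.
Let rE0 : 0 < r * E. Proof. by rewrite mulr_gt0. Qed.
Let rE3 : 3 * (r * E) <= r ^+ 2 * E. Proof. by rewrite mulrA ler_pM2r. Qed.
Let E9 : 9 * E <= r ^+ 2 * E. Proof. by rewrite ler_pM2r. Qed.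

Lemma critical_alg_le : a + b <= X + Y + 2 * E -> a <= Y + 12 * r ^+ 2 * E.
Proof.
move=> sum; rewrite leNgt; apply/negP => big.
pose s := a - Y; pose b' := X - s + 2 * E.
have bb' : b <= b' by rewrite /b' /s; lra.
have s2 : 2 * s <= q + 2 * E by move: ab bb'; rewrite /b' /s XY; lra.
have C0 : 0 < r ^+ 2 * E by apply: lt_le_trans E9; rewrite mulr_gt0.
have s0 : 0 < s by rewrite /s; move: big; lra.
have b0 : 0 <= b := le_trans a0 ab.
have hb : b ^+ 2 <= b' ^+ 2 by rewrite ler_sqr ?nnegrE // (le_trans b0).
have e1 : a ^+ 2 + b' ^+ 2 = X ^+ 2 + Y ^+ 2 + 4 * X * E + 4 * E ^+ 2 - 2 * s * (q + 2 * E - s).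
  by rewrite /b' /s XY; ring.
have e2 : (X - r * E) ^+ 2 + (Y - r * E) ^+ 2 = X ^+ 2 + Y ^+ 2 - 2 * (r * E) * (X + Y) + 2 * (r * E) ^+ 2 by ring.
have h1 : s * q <= 2 * s * (q + 2 * E - s).
  have : s * (q + 2 * E) <= s * (2 * (q + 2 * E - s)) by rewrite ler_pM2l //; lra.
  have : 0 < s * E by rewrite mulr_gt0.
  lra.
have h2 : s * q <= 4 * X * E + 4 * E ^+ 2 + 2 * (r * E) * (X + Y).
  move: sq hb h1; rewrite e2; have := sqr_ge0 (r * E); move: e1; lra.
have h3 : 4 * X * E <= 4 * (r * E) * q.
  have : 0 < E * q by rewrite mulr_gt0.
  rewrite XE'; lra.
have h4 : 2 * (r * E) * (X + Y) <= 4 * (r ^+ 2 * E) * q.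
  have : 0 < r * E * q by rewrite mulr_gt0.
  rewrite XE' YE expr2; lra.
have h5 : 4 * E ^+ 2 <= E * q.
  by rewrite expr2 mulrCA ler_pM2l //; move: Eq2 E9; lra.
have h6 : s * q <= (4 * (r * E) + E + 4 * (r ^+ 2 * E)) * q by lra.
move: h6; rewrite ler_pM2r // /s; move: big rE3 E9; lra.
Qed.

Let C := r ^+ 2 * E.
Let C0 : 0 < C. Proof. by apply: lt_le_trans E9; rewrite mulr_gt0. Qed.

(** If a and b exceed their targets by multiples of C, the excess in the
    sum of the squares must make up for the deficit 2 r E (X + Y), which is at
    most 2 / 3 C (X + Y). *)
Lemma critical_defect (al be : R) : a <= Y + al * C -> b <= X + be * C ->
  0 <= (2 * al + 2 / 3) * Y + (2 * be + 2 / 3) * X + (al ^+ 2 + be ^+ 2) * C.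
Proof.
move=> ha hb; have b0 : 0 <= b := le_trans a0 ab.
have {}ha : a ^+ 2 <= (Y + al * C) ^+ 2 by rewrite ler_sqr ?nnegrE // (le_trans a0).
have {}hb : b ^+ 2 <= (X + be * C) ^+ 2 by rewrite ler_sqr ?nnegrE // (le_trans b0).
have XY0 : 0 <= X + Y by move: XY Yq q0; lra.
have CXY : r * E * (X + Y) <= C / 3 * (X + Y) by rewrite ler_wpM2r // /C; move: rE3; lra.
have sE := sqr_ge0 (r * E); rewrite -(pmulr_rge0 _ C0).
move: sq ha hb CXY sE; move: (r * E) C => rE c; lra.
Qed.

Lemma critical_alg_ge : a <= Y + 12 * r ^+ 2 * E -> X - 30 * r ^+ 2 * E <= b.
Proof.
rewrite -[12 * _ * _]mulrA -[30 * _ * _]mulrA -/C => aY; rewrite leNgt; apply/negP => lt.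
have := critical_defect aY (be := -30) (ltac:(by move: lt; lra)).
by move: XY Yq q0 Eq2 C0; rewrite -/C; lra.
Qed.

Lemma critical_alg_ge' : b <= X + E -> Y - 12 * r ^+ 2 * E <= a.
Proof.
rewrite -[12 * _ * _]mulrA -/C => bX; rewrite leNgt; apply/negP => lt.
have := critical_defect (al := -12) (be := 1 / 9) (ltac:(by move: lt; lra))
  (ltac:(by move: bX E9; rewrite -/C; lra)).
by move: XY Yq q0 Eq2 C0; rewrite -/C; lra.
Qed.
End Alg.

Lemma exists_other r (i : 'I_r) : 1 < r -> exists j : 'I_r, j != i.
Proof.
case: r i => [|[|r]] i // _; exists (if i == ord0 then ord_max else ord0).
by case: (eqVneq i ord0) => [->|]; rewrite // eq_sym.
Qed.

Lemma ler_sum_sub (R : realType) (I : finType) (P Q : pred I) (x : I -> R) :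
  (forall a, 0 <= x a)%R -> (forall a, P a -> Q a) ->
  (\sum_(a | P a) x a <= \sum_(a | Q a) x a)%R.
Proof.
move=> x0 PQ; rewrite big_mkcond [X in (_ <= X)%R]big_mkcond; apply: ler_sum => a _.
by case Pa: (P a); [rewrite (PQ a Pa) | case: (Q a)].
Qed.

Section Extremal.
Variable R : realType.
Local Open Scope ring_scope.
Variables (F G : sgraph) (r t : nat).
Hypotheses (r3 : (2 < r)%N) (t0 : (0 < t)%N) (tameT : tame (@edge G) r t).
Hypothesis cliqueF : forall H : sgraph, has_subgraph F H ->
  exists f : 'I_r.+1 -> H, forall i j, i != j -> edge (f i) (f j).
Hypothesis freeF : Defs.free F G.
Hypothesis ncol : ~ exists k : G -> 'I_r, forall a b, edge a b -> k a != k b.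
Variables (rho : R) (x : G -> R).
Hypotheses (x0 : forall a, 0 <= x a) (x1 : forall a, x a <= 1) (xmax : exists a, x a = 1).
Hypothesis xE : forall a, rho * x a = \sum_(b | edge a b) x b.
Local Notation n := (#|G|%:R : R).
Local Notation q := (n / r%:R).
Hypothesis rhoge : n - q - 1 <= rho.
Hypothesis ext : forall (e' : rel G) (s : symmetric e') (i : irreflexive e'),
  Defs.free F (SGraph s i) ->
  ~ (exists k : G -> 'I_r, forall a b, e' a b -> k a != k b) ->
  forall y : G -> R, qform e' y <= rho * \sum_a y a ^+ 2.

Lemma ext_yrel (c : G -> 'I_r) u w v : u != w -> u != v -> c w != c v ->
  (forall l, (3 < #|[set a | c a == l]|)%N) ->
  forall y : G -> R, qform (yrel c u w v) y <= rho * \sum_a y a ^+ 2.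
Proof.
move=> uw uv cwv big; apply: (ext (s := yrel_sym c u w v) (i := @yrel_irr _ _ c u w v)).
  by move=> /cliqueF[f fe]; apply: (yrel_noclique uw uv cwv fe).
exact: yrel_uncolorable.
Qed.

Section Core.
Variables (S : {set G}) (c : G -> 'I_r) (D : nat).
Hypotheses (D0 : (0 < D)%N) (Sge : n - D%:R <= #|S|%:R).
Hypothesis degS : forall v, v \in S -> n - q - D%:R <= (deg_in (@edge G) S v)%:R.
Hypothesis properS : proper_on (@edge G) S c.
Local Notation E := (core_err R r t D).
Hypothesis Eq : 2 * r%:R * E <= q.

Let rho_gt0 : 0 < rho.
Proof.
have := @rq R r (ltnW r3) n; have := @Ebig R r t r3 D D0 => h1 h2.
have r3R : 3 <= r%:R :> R by rewrite ler_nat.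
have q2 : 2 * 3 * 11 <= q by apply: le_trans Eq; nra.
by move: rhoge h2 q2 r3R; nra.
Qed.

(** Reattach d to all core vertices outside its class: the new graph is
    free of F by [clone_free] and still needs r + 1 colours because G - d does. *)
Lemma perron_noncolorable d : #|F|%:R * (missing r D).+1%:R < q - E ->
  ~ (exists k : G -> 'I_r, proper_on (@edge G) (setT :\ d) k) ->
  n - q - r%:R * E <= rho * x d.
Proof.
move=> Fsmall ncold.
have Sle : #|S|%:R <= n by rewrite ler_nat max_card.
pose i := c d; pose U := [set a in S | c a != i].
have dU : d \notin U by rewrite inE eqxx andbF.
have ray : forall y : G -> R, qform (reattach d U) y <= rho * \sum_a y a ^+ 2.
  apply: (ext (s := reattach_sym d U) (i := reattach_irr d U)).
    apply: (clone_free (W := cls S c i) (m := missing r D)) => //.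
      move=> a; rewrite inE => /andP[aS ai].
      apply: (near_cls (ltnW r3) Sle Sge degS properS ai (a := a)).
      by rewrite inE aS eqxx.
    rewrite -(ltr_nat R) natrM; apply: lt_le_trans Fsmall _.
    apply: (le_trans _ (wt_le S c x1 i)).
    exact: (wt_ge r3 t0 tameT D0 Sge degS properS x0 x1 xmax xE rhoge Eq).
  move=> [k kP]; apply: ncold; exists k => a b; rewrite !inE => /andP[ad _] /andP[bd _] ab.
  by apply: kP; rewrite /reattach /= (negPf ad) (negPf bd).
have := compare_degrees (@edge_sym G) (reattach_sym d U) x0 rho_gt0 xE ray (D := pred1 d).
rewrite !big_pred1_eq => h; have {}h := h (ltac:(by move=> a b /= ad bd ab; rewrite /reattach /= (negPf ad) (negPf bd))).
rewrite ler_sqr ?nnegrE ?mulr_ge0 ?(ltW rho_gt0) // in h; last by apply: sumr_ge0.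
apply: le_trans h.
have := wt_sum1 r3 t0 tameT D0 Sge degS properS x0 x1 xmax xE rhoge Eq i.
have Eb : 11 <= E by apply: Ebig.
move=> ws; apply: (@le_trans _ _ (\sum_(l | l != i) wt S c x l)); first by move: ws Eb; lra.
rewrite le_eqVlt; apply/orP; left; apply/eqP.
rewrite (partition_big c (fun l => l != i)) /=; last first.
  by move=> b; rewrite /reattach /= eqxx => /and3P[_ _]; rewrite inE => /andP[].
apply: eq_bigr => l li; apply: eq_bigl => b.
rewrite /reattach /= eqxx !inE; have [->|bd] := eqVneq b d.
  by rewrite -/i eq_sym (negPf li) andbF.
case: (b \in S) => //=; case: eqP => [->|]; rewrite ?andbF //.
by rewrite li.
Qed.

(** The vertex z of least weight: if G - z is not r-colourable, then x z is
    large by [perron_noncolorable], hence so are all entries of x and all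
    degrees. *)
Lemma exists_critical : #|F|%:R * (missing r D).+1%:R < q - E ->
  ((forall v, n - q - r%:R * E <= (deg_in (@edge G) setT v)%:R) ->
    exists k : G -> 'I_r, proper_on (@edge G) setT k) ->
  exists z, exists2 A : G -> 'I_r, proper_on (@edge G) (setT :\ z) A & forall a, x z <= x a.
Proof.
move=> Fsmall col; have [a0 _] := xmax.
have [z zmin] : exists z, forall a, x z <= x a.
  by exists [arg min_(a < a0) x a]%O; case: arg_minP => // z _ zm a; apply: zm.
exists z; apply: boolp.contrapT => nA.
have hz : n - q - r%:R * E <= rho * x z.
  by apply: perron_noncolorable => // -[A pA]; apply: nA; exists A.
apply: ncol; have [v|k kP] := col; last by exists k => a b ab; apply: kP; rewrite ?inE.
apply: le_trans hz _; apply: (@le_trans _ _ (rho * x v)); first by rewrite ler_wpM2l ?(ltW rho_gt0).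
rewrite xE /deg_in -sum1dep_card natr_sum big_mkcond [X in _ <= X]big_mkcond.
by apply: ler_sum => b _; rewrite !inE /=; case: (edge v b).
Qed.

Section Critical.
Variable z : G.
Hypotheses (zS : z \notin S) (properz : proper_on (@edge G) (setT :\ z) c).
Hypothesis zmin : forall a, x z <= x a.
Local Notation X := (n - q).
Local Notation Y := (n - 2 * q).

(** Otherwise z could receive colour l. *)
Lemma critical_nbr l : exists2 b, edge z b & c b = l.
Proof.
apply: boolp.contrapT => no; apply: ncol.
exists (fun a => if a == z then l else c a) => a b ab.
case: (eqVneq a z) => [az|az]; case: (eqVneq b z) => [bz|bz].
- by move: ab; rewrite az bz edge_irr.
- by apply: contra_notN no => /eqP lb; exists b; rewrite -?az.
- by apply: contra_notN no => /eqP lb; exists a; rewrite // -bz edge_sym.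
- by apply: properz; rewrite ?inE ?az ?bz.
Qed.

Let rqE : r%:R * q = n := @rq R r (ltnW r3) n.
Let r3R : 3 <= r%:R :> R. Proof. by rewrite ler_nat. Qed.
Let Eb : 11 <= E. Proof. exact: Ebig. Qed.
Let q66 : 66 <= q. Proof. by move: Eq r3R Eb; nra. Qed.
Let Sle : #|S|%:R <= n. Proof. by rewrite ler_nat max_card. Qed.

Lemma class_big l : (4 < #|[set a | c a == l]|)%N.
Proof.
have h1 := wt_ge r3 t0 tameT D0 Sge degS properS x0 x1 xmax xE rhoge Eq l.
have h2 := wt_le S c x1 l.
have h3 : #|cls S c l|%:R <= #|[set a | c a == l]|%:R :> R.
  by rewrite ler_nat subset_leq_card //; apply/subsetP => a; rewrite !inE => /andP[].
rewrite -(ltr_nat R); move: h1 h2 h3 q66 Eq r3R Eb; nra.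
Qed.

(** Compare G with the graph yrel c z d v, for a core vertex v of another
    class: only edges at z or d are lost, so [compare_degrees] applies to these
    two vertices. In the new graph z sees r - 2 classes and d sees r - 1
    classes. *)
Lemma critical_pair d : d != z ->
  (X - r%:R * E) ^+ 2 + (Y - r%:R * E) ^+ 2 <= (rho * x z) ^+ 2 + (rho * x d) ^+ 2.
Proof.
move=> dz; pose i := c d.
have [j ji] := exists_other i (ltnW r3).
have WG l := wt_ge r3 t0 tameT D0 Sge degS properS x0 x1 xmax xE rhoge Eq l.
have [v] : exists v, v \in cls S c j.
  apply/card_gt0P; rewrite -(ltr_nat R); apply: lt_le_trans (wt_le S c x1 j).
  by apply: lt_le_trans (WG j); move: q66 Eq r3R Eb; nra.
rewrite inE => /andP[vS /eqP vj].
have vz : v != z by apply: contraNneq zS => <-.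
have vd : v != d by apply: contraNneq ji => vd; rewrite -vj vd.
have ray := @ext_yrel c z d v (ltac:(by rewrite eq_sym)) (ltac:(by rewrite eq_sym))
  (ltac:(by rewrite vj eq_sym)) (fun l => ltnW (class_big l)).
have sub a b : ~~ pred2 z d a -> ~~ pred2 z d b -> edge a b -> yrel c z d v a b.
  rewrite /= !negb_or => /andP[az ad] /andP[bz bd] ab.
  rewrite /yrel /= (negPf az) (negPf bz) (negPf ad) (negPf bd) /= andbF andbT.
  by apply: properz; rewrite ?inE ?az ?bz.
have := compare_degrees (@edge_sym G) (yrel_sym c z d v) x0 rho_gt0 xE ray sub.
have pair (f : G -> R) : \sum_(a | pred2 z d a) f a = f z + f d.
  rewrite (bigD1 z) /= ?eqxx // (bigD1 d) /=; last by rewrite dz eqxx orbT.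
  by rewrite big_pred0 ?addr0 // => a /=; case: (a == z); case: (a == d).
rewrite !pair => h; apply: le_trans h.
have ws1 := wt_sum1 r3 t0 tameT D0 Sge degS properS x0 x1 xmax xE rhoge Eq i.
have ws2 := wt_sum2 r3 t0 tameT D0 Sge degS properS x0 x1 xmax xE rhoge Eq ji.
have rE0 : 0 <= r%:R * E by rewrite mulr_ge0 //; move: Eb; lra.
have Eq3 : 3 * E <= r%:R * E by rewrite ler_wpM2r //; move: Eb; lra.
have qr : 3 * q <= n by rewrite -[X in _ <= X]rqE ler_wpM2r //; move: q66; lra.
have dz1 : Y - r%:R * E <= \sum_(b | ~~ pred2 z d b && yrel c z d v z b) x b.
  apply: (@le_trans _ _ (\sum_(l | (l != j) && (l != i)) wt S c x l)); first by move: ws2 Eb; lra.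
  rewrite /wt; have -> : \sum_(l | (l != j) && (l != i)) \sum_(b in cls S c l) x b =
     \sum_(b | [&& b \in S, c b != j & c b != i]) x b.
    rewrite [RHS](partition_big c (fun l => (l != j) && (l != i))) /=; last by move=> b /and3P[_ -> ->].
    apply: eq_bigr => l /andP[lj li]; apply: eq_bigl => b; rewrite !inE.
    by case: (b \in S) => //=; case: eqP => [->|]; rewrite ?lj ?li ?andbF.
  apply: ler_sum_sub => // b /and3P[bS bj bi].
  have bz : b != z by apply: contraNneq zS => <-.
  have bd : b != d by apply: contraNneq bi => ->.
  by rewrite /= (negPf bz) (negPf bd) /yrel /= eqxx bz vj bj bi !orbT.
have dd1 : X - r%:R * E <= \sum_(b | ~~ pred2 z d b && yrel c z d v d b) x b.
  suff : \sum_(l | l != i) wt S c x l <= 1 + \sum_(b | ~~ pred2 z d b && yrel c z d v d b) x b.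
    by move: ws1 Eb; lra.
  rewrite /wt; have -> : \sum_(l | l != i) \sum_(b in cls S c l) x b =
     \sum_(b | (b \in S) && (c b != i)) x b.
    rewrite [RHS](partition_big c (fun l => l != i)) /=; last by move=> b /andP[].
    apply: eq_bigr => l li; apply: eq_bigl => b; rewrite !inE.
    by case: (b \in S) => //=; case: eqP => [->|]; rewrite ?li ?andbF.
  rewrite (bigD1 v) /=; last by rewrite vS vj.
  apply: lerD => //; apply: ler_sum_sub => // b /andP[/andP[bS bi] bv].
  have bz : b != z by apply: contraNneq zS => <-.
  have bd : b != d by apply: contraNneq bi => ->.
  rewrite /= (negPf bz) (negPf bd) /yrel /= (negPf dz) (negPf bz) (negPf bv) andbF /=.
  by rewrite eq_sym bi /= (eq_sym d) (negPf vd).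
have Y0 : 0 <= Y - r%:R * E by move: qr Eq r3R q66 rE0; lra.
have X0 : 0 <= X - r%:R * E by move: Y0 q66; lra.
by rewrite addrC; apply: lerD; rewrite ler_sqr ?nnegrE ?sumr_ge0.
Qed.

Hypothesis Eq4 : 144 * r%:R ^+ 4 * E <= q.

Let XY : X = Y + q. Proof. ring. Qed.
Let rqX : r%:R * q = X + q. Proof. rewrite rqE; ring. Qed.
Let E0 : 0 < E. Proof. by move: Eb; lra. Qed.
Let xz0 : 0 <= rho * x z. Proof. by rewrite mulr_ge0 ?(ltW rho_gt0). Qed.
Let xzd d : rho * x z <= rho * x d. Proof. by rewrite ler_wpM2l ?(ltW rho_gt0). Qed.
Let perron_le' v : rho * x v <= X + E.
Proof.
have := perron_le r3 t0 tameT D0 Sge degS properS x0 x1 xE v.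
by have : 0 <= D%:R :> R by []; lra.
Qed.

(** Take a neighbour v of z in the class i that z sees least. By
    [near_edge] the two have few common neighbours in some other class j. So
    classes i and j together contribute at most about q to rho x z + rho x v,
    which bounds that sum by X + Y. *)
Lemma critical_le : rho * x z <= Y + 12 * r%:R ^+ 2 * E.
Proof.
have [i ile] := near_vertex (ltnW r3) t0 tameT Sle Sge degS properS z.
have [v zv vi] := critical_nbr i.
have vz : v != z by apply: contraTneq zv => ->; rewrite edge_irr.
have [j ji jle] := near_edge (ltnW r3) t0 tameT Sle Sge degS properS i zv.
apply: (critical_alg_le XY rqX r3R E0 Eq4 xz0 (xzd v)); first exact: critical_pair.
have /andP[_ hz] := nbr_sum c Sge x0 x1 xE z.
have /andP[_ hv] := nbr_sum c Sge x0 x1 xE v.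
have gi : nwt (@edge G) S c x z i <= (tau r t D)%:R.
  by apply: le_trans (nwt_card _ _ _ x1 _ _) _; rewrite ler_nat ltnW.
have gv : nwt (@edge G) S c x v i = 0.
  rewrite /nwt big_pred0 // => b; rewrite !inE; apply/negP => /andP[/andP[bS /eqP bi] vb].
  have bz : b != z by apply: contraNneq zS => <-.
  have : c v != c b by apply: properz; rewrite ?inE ?vz ?bz.
  by rewrite vi bi eqxx.
have gj : nwt (@edge G) S c x z j + nwt (@edge G) S c x v j <= q + D%:R + (tau r t D)%:R.
  apply: le_trans (nwt_pair _ _ _ x1 _ _ _) _; apply: lerD; last by rewrite ler_nat ltnW.
  exact: (class_le Sle degS properS j).
have gl w l : nwt (@edge G) S c x w l <= q + D%:R.
  apply: le_trans (nwt_wt _ _ _ x0 _ _) _; apply: le_trans (wt_le _ _ x1 _) _.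
  exact: (class_le Sle degS properS l).
have s1 := sum_le2 ji (fun l _ _ => gl z l); have s2 := sum_le2 ji (fun l _ _ => gl v l).
move: hz hv; rewrite !(sum_split2 _ ji) gv.
have := core_errE R r t D0; rewrite missingE.
have : 0 <= (tau r t D)%:R :> R by []. have : 0 <= D%:R :> R by [].
have : 3 * D%:R <= r%:R * D%:R :> R by rewrite ler_wpM2r.
move: gi gj s1 s2 rqE; lra.
Qed.

Lemma critical_ge : Y - 12 * r%:R ^+ 2 * E <= rho * x z.
Proof.
have [d dz] : exists d, d != z.
  have [v zv _] := critical_nbr (Ordinal (ltnW (ltnW r3))).
  by exists v; apply: contraTneq zv => ->; rewrite edge_irr.
exact: (critical_alg_ge' XY rqX r3R E0 Eq4 xz0 (xzd d) (critical_pair dz) (perron_le' d)).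
Qed.

Lemma noncritical_ge d : d != z -> X - 30 * r%:R ^+ 2 * E <= rho * x d.
Proof.
move=> dz.
exact: (critical_alg_ge XY rqX r3R E0 Eq4 xz0 (xzd d) (critical_pair dz) critical_le).
Qed.

End Critical.
End Core.
End Extremal.

(** * Exact structure around the critical vertex *)

Section Exact.
Variable R : realType.
Local Open Scope ring_scope.
Variables (G : sgraph) (r t : nat).
Hypotheses (r3 : (2 < r)%N) (t0 : (0 < t)%N) (tameT : tame (@edge G) r t).
Variables (rho : R) (x : G -> R).
Hypotheses (rho_gt0 : 0 < rho) (x0 : forall a, 0 <= x a) (x1 : forall a, x a <= 1).
Hypothesis xE : forall a, rho * x a = \sum_(b | edge a b) x b.
Local Notation n := (#|G|%:R : R).
Local Notation q := (n / r%:R).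
Local Notation X := (n - q).
Local Notation Y := (n - 2 * q).
Variables (z : G) (A : G -> 'I_r) (D : nat).
Hypotheses (properz : proper_on (@edge G) (setT :\ z) A) (D0 : (0 < D)%N).
Hypothesis nbrz : forall l, exists2 b, edge z b & A b = l.
Hypothesis noncritical : forall d, d != z -> X - D%:R + 1 <= rho * x d.
Hypotheses (zge : Y - D%:R <= rho * x z) (zle : rho * x z <= Y + D%:R).
Local Notation E := (core_err R r t D).
Hypothesis Eq : 4 * r%:R * E <= q.
Hypothesis ray : forall w v, z != w -> z != v -> A w != A v ->
  forall y, qform (yrel A z w v) y <= rho * \sum_a y a ^+ 2.

Let S : {set G} := setT :\ z.
Let inS a : (a \in S) = (a != z). Proof. by rewrite !inE andbT. Qed.
Let rqE : r%:R * q = n := @rq R r (ltnW r3) n.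
Let r3R : 3 <= r%:R :> R. Proof. by rewrite ler_nat. Qed.
Let Eb : 11 <= E. Proof. exact: Ebig. Qed.
Let EE : 2 * (tau r t D)%:R + 2 * (missing r D)%:R + r%:R * D%:R <= E.
Proof. exact: core_errE. Qed.
Let D1 : 1 <= D%:R :> R. Proof. by rewrite ler1n. Qed.
Let Sle : #|S|%:R <= n. Proof. by rewrite ler_nat max_card. Qed.

Let Sge : n - D%:R <= #|S|%:R.
Proof.
have := cardsD1 z (setT : {set G}); rewrite inE cardsT -/S => ->.
by rewrite natrD /=; move: D1; lra.
Qed.

Let degS v : v \in S -> X - D%:R <= (deg_in (@edge G) S v)%:R.
Proof.
rewrite inS => vz; have := noncritical vz; rewrite xE.
have : \sum_(b | edge v b) x b <= 1 + (deg_in (@edge G) S v)%:R.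
  apply: (@le_trans _ _ (\sum_(b | b == z) 1 + \sum_(b | (b \in S) && edge v b) 1)).
    rewrite big_mkcond [X in _ <= X + _]big_mkcond [X in _ <= _ + X]big_mkcond -big_split.
    apply: ler_sum => b _ /=; rewrite inS; have h1 := x1 b.
    by case: eqVneq; case: (edge v b) => //= _; move: h1; lra.
  by rewrite big_pred1_eq /deg_in -sum1dep_card natr_sum.
lra.
Qed.

Let properS : proper_on (@edge G) S A := properz.

Let critical_lt v : v != z -> x z < x v.
Proof.
move=> vz; rewrite -(ltr_pM2l rho_gt0); have := noncritical vz.
have DE : D%:R <= E.
  have : 0 <= (tau r t D)%:R :> R by []. have : 0 <= (missing r D)%:R :> R by [].
  have : D%:R <= r%:R * D%:R :> R by rewrite ler_peMl // ler1n ltnW // ltnW.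
  by move: EE; lra.
have : 12 * E <= 4 * r%:R * E by rewrite ler_wpM2r //; move: Eb r3R; lra.
move: zle Eq Eb DE; lra.
Qed.

Let nz l := [set b in cls S A l | edge z b].

(** The vertex z sees few vertices of two classes i and j, while it has a
    neighbour w in i and v in j. No edge joins a neighbour of z in i to one in
    j, by [embed_triangle], as the other classes are seen by z in large part.
    Let B be the set of further neighbours of z in i and j. Replacing the edge
    from z to each b in B by the edge from b to v or w gains x b (x v - x z) >
    0 or the same with w, since z is lighter than all other vertices. After
    this exchange, all edges lie in yrel A z w v, so the Rayleigh bound makes B
    empty and the two graphs equal. *)
Lemma critical_structure : exists w v, [/\ z != w, z != v, A w != A v &
  forall a b, edge a b = yrel A z w v a b].
Proof.
have CL l : #|cls S A l|%:R <= q + D%:R := class_le Sle degS properS l.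
have nearS := near_cls (ltnW r3) Sle Sge degS properS.
have tau0 : 0 <= (tau r t D)%:R :> R by [].
have m0 : 0 <= (missing r D)%:R :> R by [].
have rD : D%:R <= r%:R * D%:R :> R by rewrite ler_peMl // ler1n ltnW // ltnW.
have E12 : 12 * E <= 4 * r%:R * E by rewrite ler_wpM2r //; move: Eb r3R; lra.
have [i ile] := near_vertex (ltnW r3) t0 tameT Sle Sge degS properS z.
have nzne w : edge z w -> w != z by apply: contraTneq => ->; rewrite edge_irr.
have [w zw wi] := nbrz i; have wz := nzne w zw.
have wV : w \in cls S A i by rewrite inE inS wz wi /=.
have [j ji jle] := near_edge (ltnW r3) t0 tameT Sle Sge degS properS i zw.
have [v zv vj] := nbrz j; have vz := nzne v zv.
have jle' : (#|nz j| <= tau r t D + missing r D)%N.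
  have wj : (#|[set b in cls S A j | ~~ edge w b]| <= missing r D)%N.
    by apply: nearS wV; rewrite eq_sym.
  apply: leq_trans (leq_add (ltnW jle) wj).
  apply: leq_trans (leq_card_setU _ _); apply: subset_leq_card.
  by apply/subsetP => b; rewrite !inE => /andP[-> ->] /=; case: (edge w b).
have big l : l != i -> l != j -> (tau r t D + 2 * missing r D < #|nz l|)%N.
  move=> li lj; rewrite -(ltr_nat R) natrD natrM.
  have : rho * x z <= \sum_l0 #|nz l0|%:R.
    rewrite xE -natr_sum; apply: (@le_trans _ _ #|[set b in S | edge z b]|%:R).
      rewrite -sum1dep_card natr_sum big_mkcond [X in _ <= X]big_mkcond.
      apply: ler_sum => b _ /=; rewrite inS; case: eqVneq => [->|_] /=; first by rewrite edge_irr.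
      by case: ifP.
    by rewrite ler_nat (card_class _ A).
  rewrite (sum_split2 _ ji) (bigD1 l) /=; last by rewrite lj li.
  have : \sum_(k | (k != j) && (k != i) && (k != l)) #|nz k|%:R <= (r%:R - 3) * (q + D%:R).
    apply: (@le_trans _ _ (\sum_(k | (k != j) && (k != i) && (k != l)) (q + D%:R))).
      apply: ler_sum => k _; apply: le_trans (CL k); rewrite ler_nat.
      by apply: subset_leq_card; apply/subsetP => b; rewrite inE => /andP[].
    have := sum_split2 (fun _ : 'I_r => q + D%:R) ji.
    rewrite [X in _ = _ + X](bigD1 l) /=; last by rewrite lj li.
    rewrite sumr_const card_ord -mulr_natl; lra.
  have : #|nz i|%:R <= (tau r t D)%:R :> R by rewrite ler_nat ltnW.
  have : #|nz j|%:R <= (tau r t D)%:R + (missing r D)%:R :> R by rewrite -natrD ler_nat.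
  move: zge rqE Eq EE E12 Eb D1 rD tau0 m0; lra.
have noedge a b : a \in nz i -> b \in nz j -> ~~ edge a b.
  rewrite !inE => /andP[/andP[aS /eqP ai] za] /andP[/andP[bS /eqP bj] zb]; apply/negP => ab.
  have ij : i != j by rewrite eq_sym.
  have [l [li lj]] := embed_triangle (ltnW r3) t0 tameT nearS ij za zb ab.
  have ma : (#|[set u in cls S A l | ~~ edge a u]| <= missing r D)%N.
    by apply: (nearS i l _ a); rewrite ?inE ?aS ?ai ?eqxx // eq_sym.
  have mb : (#|[set u in cls S A l | ~~ edge b u]| <= missing r D)%N.
    by apply: (nearS j l _ b); rewrite ?inE ?bS ?bj ?eqxx // eq_sym.
  have : (#|nz l| <= #|[set u in cls S A l | [&& edge z u, edge a u & edge b u]]| +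
     missing r D + missing r D)%N.
    apply: leq_trans (leq_add (leq_add (leqnn _) ma) mb).
    apply: leq_trans (leq_add (leq_card_setU _ _) (leqnn _)).
    apply: leq_trans (leq_card_setU _ _); apply: subset_leq_card.
    apply/subsetP => u; rewrite !inE => /andP[-> ->] /=.
    by case: (edge a u); case: (edge b u).
  have := big l li lj; rewrite /tau => h1 h2 h3.
  have : (t + r * (t * missing r D) + 2 * missing r D + 2 * missing r D <
     t + r * (t * missing r D) + missing r D + missing r D)%N.
    apply: leq_trans h1 _; apply: leq_trans h2 _; rewrite !leq_add2r; exact: ltnW.
  move: (t + r * (t * missing r D))%N => p; move: (missing r D) => k.
  by rewrite -(addnA p (2 * k)%N) -(addnA p k) ltn_add2l mul2n -addnn ltnNge leq_addr.
exists w, v; split; rewrite 1?eq_sym // ?wi ?vj //.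
have wv : w != v by apply: contraNneq ji => wv; rewrite -wi -vj wv.
pose B b := [&& edge z b, (A b == i) || (A b == j), b != w & b != v].
pose op b := if A b == i then v else w.
pose e' := yrel A z w v.
have zB : ~~ B z by rewrite /B edge_irr.
have opz b : op b != z by rewrite /op; case: ifP.
have opB b : ~~ B (op b) by rewrite /B /op; case: ifP; rewrite eqxx !andbF.
have sE' : symmetric e' by apply: yrel_sym.
have nzE l b : (b \in nz l) = [&& b != z, A b == l & edge z b].
  by rewrite /nz !inE andbT -andbA.
have Bop b : B b -> ~~ edge b (op b) && e' b (op b).
  move=> /and4P[zb bij bw bv]; have bz := nzne b zb.
  have [bi|bi] := eqVneq (A b) i.
    have -> : op b = v by rewrite /op bi eqxx.
    apply/andP; split; first by apply: noedge; rewrite nzE ?bz ?vz ?bi ?vj ?eqxx.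
    by rewrite /e' /yrel /= (negPf bz) (negPf vz) bi vj eq_sym ji (negPf bw) (negPf bv).
  have bj : A b = j by move: bij; rewrite (negPf bi) /= => /eqP.
  have -> : op b = w by rewrite /op (negPf bi).
  apply/andP; split; first by rewrite edge_sym; apply: noedge; rewrite nzE ?bz ?wz ?bj ?wi ?eqxx.
  by rewrite /e' /yrel /= (negPf bz) (negPf wz) bj wi ji (negPf bw) (negPf bv).
have wvno : ~~ edge w v by apply: noedge; rewrite nzE ?wz ?vz ?wi ?vj ?eqxx.
have ezb b : edge z b -> e' z b || B b.
  move=> zb; rewrite /e' /yrel /B /= eqxx zb (nzne b zb) wi vj /=.
  by case: (b == w); case: (b == v); case: (A b == i); case: (A b == j).
(* G with the new pairs b, op b is contained in e' with the pairs z, b to be given up. *)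
have pw a b : (edge a b + (B a && (b == op a)) + (B b && (a == op b)) <=
   e' a b + (B b && (a == z)) + (B a && (b == z)))%N.
  have [->|az] := eqVneq a z; have [->|bz] := eqVneq b z.
  - by rewrite edge_irr (negPf zB).
  - rewrite (negPf zB) /= [z == _]eq_sym (negPf (opz b)) andbF !addn0.
    by case zb: (edge z b) => //; have := ezb b zb; case: (e' z b); case: (B b).
  - rewrite (negPf zB) /= [z == _]eq_sym (negPf (opz a)) andbF !addn0.
    rewrite edge_sym sE'.
    by case za: (edge z a) => //; have := ezb a za; case: (e' z a); case: (B a).
  rewrite !andbF !addn0; case h1: (B a && (b == op a)).
    have /andP[Ba /eqP bo] := h1; have /andP[nab eab] := Bop a Ba.
    by rewrite bo (negPf nab) eab (negPf (opB a)).
  case h2: (B b && (a == op b)).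
    have /andP[Bb /eqP ao] := h2; have /andP[nab eab] := Bop b Bb.
    by rewrite ao edge_sym (negPf nab) sE' eab.
  rewrite !addn0; case ab: (edge a b) => //.
  have Aab : A a != A b by apply: properz; rewrite ?inE ?az ?bz.
  rewrite /e' /yrel /= (negPf az) (negPf bz) Aab /=.
  rewrite lt0b; apply/negP => /orP[] /andP[/eqP aw /eqP bv].
    by move: wvno; rewrite -aw -bv ab.
  by move: wvno; rewrite -aw -bv edge_sym ab.
have xz0 : 0 < x z.
  by rewrite -(pmulr_rgt0 _ rho_gt0); move: zge rqE Eq EE E12 Eb D1 rD tau0 m0 r3R; nra.
have xpos b : 0 < x b.
  by have [->//|bz] := eqVneq b z; apply: lt_trans (critical_lt bz).
have Qle : qform e' x <= qform (@edge G) x.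
  by rewrite (qform_eigen xE); apply: ray; rewrite 1?eq_sym // ?wi ?vj.
pose W := \sum_(b | B b) x b * (x (op b) - x z).
have pairs (f : G -> G) : \sum_a \sum_b (B a && (b == f a))%:R * (x a * x b) = \sum_(b | B b) x b * x (f b).
  rewrite [RHS]big_mkcond; apply: eq_bigr => a _; case: (B a) => /=; last first.
    by rewrite big1 // => b _; rewrite mul0r.
  rewrite (bigD1 (f a)) //= eqxx mul1r big1 ?addr0 // => b /negPf ->.
  by rewrite mul0r.
have pairs' (f : G -> G) : \sum_a \sum_b (B b && (a == f b))%:R * (x a * x b) = \sum_(b | B b) x b * x (f b).
  rewrite -pairs exchange_big; apply: eq_bigr => a _; apply: eq_bigr => b _.
  by rewrite [x b * _]mulrC.
have WE : W = \sum_(b | B b) x b * x (op b) - \sum_(b | B b) x b * x z.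
  by rewrite -sumrB; apply: eq_bigr => b _; rewrite mulrBr.
have W0 : W <= 0.
  have : qform (@edge G) x + \sum_(b | B b) x b * x (op b) + \sum_(b | B b) x b * x (op b) <=
     qform e' x + \sum_(b | B b) x b * x z + \sum_(b | B b) x b * x z.
    rewrite -{1}(pairs op) -(pairs' op) -{1}(pairs' (fun=> z)) -(pairs (fun=> z)) -!big_split /=; apply: ler_sum => a _.
    rewrite -!big_split /=; apply: ler_sum => b _; rewrite -!mulrDl -!natrD.
    by rewrite ler_wpM2r ?mulr_ge0 // ler_nat pw.
  by move: Qle; rewrite WE; lra.
have B0 b : B b = false.
  apply/negP => Bb; move: W0; rewrite /W (bigD1 b) //=; apply/negP; rewrite -ltNge.
  apply: ltr_pwDl; first by rewrite mulr_gt0 // subr_gt0 critical_lt.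
  by apply: sumr_ge0 => k _; rewrite mulr_ge0 // subr_ge0 ltW // critical_lt.
move=> a b; apply/eqP; apply: contraT => ne.
have le k l : (edge k l <= e' k l)%N by have := pw k l; rewrite !B0 !addn0.
have [nab eab] : edge a b = false /\ e' a b = true.
  by have := le a b; move: ne; rewrite -/e'; case: (edge a b); case: (e' a b).
have : qform (@edge G) x < qform e' x.
  rewrite /qform (bigD1 a) //= [X in _ < X](bigD1 a) //=; apply: ltr_leD; last first.
    by apply: ler_sum => k _; apply: ler_sum => l _; rewrite ler_wpM2r ?mulr_ge0 // ler_nat.
  rewrite (bigD1 b) //= [X in _ < X](bigD1 b) //=; apply: ltr_leD; last first.
    by apply: ler_sum => l _; rewrite ler_wpM2r ?mulr_ge0 // ler_nat.
  by rewrite nab eab mul0r mul1r mulr_gt0.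
by rewrite ltNge Qle.
Qed.

End Exact.

(** * Spectral radius and class sizes *)

Section Move.
Variable R : realType.
Local Open Scope ring_scope.
Variables (T : finType) (r : nat) (u w v : T).
Hypotheses (uw : u != w) (uv : u != v) (wv : w != v).

Definition nonspecial : pred T := [pred a | [&& a != u, a != w & a != v]].

Definition nsize (c : T -> 'I_r) l := #|[set a | nonspecial a && (c a == l)]|.

Lemma sum_nonspecial (g : T -> R) : \sum_(a | a != u) g a = g w + g v + \sum_(a | nonspecial a) g a.
Proof.
rewrite (bigD1 w) 1?eq_sym //= (bigD1 v) /=; last by rewrite eq_sym uv eq_sym.
by rewrite addrA; congr (_ + _); apply: eq_bigl => a; rewrite /= -andbA.
Qed.

(** On these test vectors the form depends on the classes only through
    their sizes. *)
Definition zvec (c : T -> 'I_r) (p : 'I_r -> R) (y : T -> R) (a : T) :=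
  if nonspecial a then p (c a) else y a.

Definition csum (c : T -> 'I_r) (y : T -> R) l := \sum_(a | (a != u) && (c a == l)) y a.

(** The part of the class sum that comes from w and v. *)
Definition special (c : T -> 'I_r) (y : T -> R) l := (l == c w)%:R * y w + (l == c v)%:R * y v.

Definition outer (c : T -> 'I_r) l := (l != c w) && (l != c v).

Lemma zvec_special c p y : (zvec c p y u = y u) * (zvec c p y w = y w) * (zvec c p y v = y v).
Proof. by rewrite /zvec /nonspecial /= !eqxx !andbF. Qed.

Lemma csum_zvec c p y l : csum c (zvec c p y) l = (nsize c l)%:R * p l + special c y l.
Proof.
rewrite /csum big_mkcondr sum_nonspecial !zvec_special /special addrC; congr (_ + _).
  rewrite -big_mkcondr /= /nsize -sum1dep_card natr_sum mulr_suml.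
  by apply: eq_bigr => a /andP[na /eqP ca]; rewrite /zvec na ca mul1r.
rewrite ![l == _]eq_sym.
by case: (_ == _); case: (_ == _); rewrite ?mul1r ?mul0r.
Qed.

Lemma sqr_zvec c p y : \sum_a zvec c p y a ^+ 2 =
  y u ^+ 2 + y w ^+ 2 + y v ^+ 2 + \sum_l (nsize c l)%:R * p l ^+ 2.
Proof.
rewrite (bigD1 u) //= sum_nonspecial !zvec_special !addrA; congr (_ + _).
rewrite (partition_big c predT) //=; apply: eq_bigr => l _.
rewrite /nsize -sum1dep_card natr_sum mulr_suml.
by apply: eq_bigr => a /andP[na /eqP ca]; rewrite /zvec na ca mul1r.
Qed.

(** Inclusion-exclusion on pairs: all pairs avoiding u, minus pairs within
    a class, minus the edge w v, plus the edges at u. *)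
Lemma qform_yrel c y : c w != c v -> qform (yrel c u w v) y =
  (\sum_l csum c y l) ^+ 2 - \sum_l csum c y l ^+ 2 - 2 * (y w * y v) +
  2 * y u * (y w + y v + \sum_l (outer c l)%:R * csum c y l).
Proof.
move=> cwv.
(* The adjacency indicator as a combination of products of one-vertex functions. *)
pose nu a : R := (a != u)%:R.
pose nb a : R := (a == w)%:R + (a == v)%:R + ((a != u) && outer c (c a))%:R.
have pw a b : (yrel c u w v a b)%:R = nu a * nu b - nu a * nu b * (c a == c b)%:R
   - ((a == w) && (b == v))%:R - ((a == v) && (b == w))%:R
   + (a == u)%:R * nb b + nb a * (b == u)%:R :> R.
  rewrite /yrel /nu /nb /outer /=.
  have nuw := negPf uw; have nuv := negPf uv; have nwv := negPf wv.
  have nwu : (w == u) = false by rewrite eq_sym. have nvu : (v == u) = false by rewrite eq_sym.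
  have nvw : (v == w) = false by rewrite eq_sym.
  have [->|au] := eqVneq a u; have [->|bu] := eqVneq b u;
    rewrite ?nuw ?nuv /= ?andbF ?(mul0r, mulr0, mul1r, mulr1, addr0, add0r, subr0, oppr0) //.
  - have [->|bw] := eqVneq b w; first by rewrite nwv eqxx /= !addr0.
    by have [->|bv] := eqVneq b v; rewrite ?eqxx ?andbF /= ?addr0 ?add0r.
  - have [->|bw] := eqVneq a w; first by rewrite nwv eqxx /= !addr0.
    by have [->|bv] := eqVneq a v; rewrite ?eqxx ?andbF /= ?addr0 ?add0r.
  - have [->|aw] := eqVneq a w.
      rewrite nwv /= orbF; have [->|bv] := eqVneq b v.
        by rewrite (negPf cwv) /= !subr0 subrr.
      by rewrite andbT !subr0; case: (_ == _); rewrite ?subrr ?subr0.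
    have [->|av] := eqVneq a v.
      have [->|bw] := eqVneq b w; first by rewrite eq_sym (negPf cwv) /= !subr0 subrr.
      by rewrite andbT !subr0; case: (_ == _); rewrite ?subrr ?subr0.
    by rewrite andbT !subr0; case: (_ == _); rewrite ?subrr ?subr0.
have P1 : \sum_a \sum_b nu a * nu b * (y a * y b) = (\sum_l csum c y l) ^+ 2.
  have -> : \sum_l csum c y l = \sum_a nu a * y a.
    rewrite [RHS](partition_big c predT) //=; apply: eq_bigr => l _.
    rewrite /csum big_mkcond [RHS]big_mkcond; apply: eq_bigr => a _; rewrite /nu.
    by case: (a != u); case: (c a == l); rewrite ?mul1r ?mul0r.
  rewrite expr2 mulr_suml; apply: eq_bigr => a _; rewrite mulr_sumr.
  by apply: eq_bigr => b _; ring.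
have P2 : \sum_a \sum_b nu a * nu b * (c a == c b)%:R * (y a * y b) = \sum_l csum c y l ^+ 2.
  rewrite (partition_big c predT) //=; apply: eq_bigr => l _.
  have -> : csum c y l = \sum_(a | c a == l) nu a * y a.
    rewrite /csum big_mkcond [RHS]big_mkcond; apply: eq_bigr => a _; rewrite /nu.
    by case: (a != u); case: (c a == l); rewrite ?mul1r ?mul0r.
  rewrite expr2 mulr_suml; apply: eq_bigr => a /eqP ca.
  rewrite mulr_sumr [RHS]big_mkcond; apply: eq_bigr => b _; rewrite ca eq_sym.
  by case: (_ == _); rewrite ?mulr1 ?mulr0 ?mul0r //; ring.
have delta (s s' : T) : \sum_a \sum_b ((a == s) && (b == s'))%:R * (y a * y b) = y s * y s'.
  rewrite (bigD1 s) //= (bigD1 s') //= !eqxx mul1r !big1 ?addr0 //.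
    by move=> a /negPf as_; rewrite big1 // => b _; rewrite as_ mul0r.
  by move=> b /negPf ->; rewrite mul0r.
have P5 : \sum_a \sum_b (a == u)%:R * nb b * (y a * y b) = y u * (y w + y v + \sum_l (outer c l)%:R * csum c y l).
  rewrite (bigD1 u) //= [X in _ + X]big1 ?addr0; last first.
    by move=> a /negPf au; rewrite big1 // => b _; rewrite au !mul0r.
  have -> : y w + y v + \sum_l (outer c l)%:R * csum c y l = \sum_b nb b * y b.
    rewrite /nb; under [RHS]eq_bigr do rewrite !mulrDl.
    rewrite !big_split /=; congr (_ + _ + _).
    - by rewrite (bigD1 w) //= eqxx mul1r big1 ?addr0 // => b /negPf ->; rewrite mul0r.
    - by rewrite (bigD1 v) //= eqxx mul1r big1 ?addr0 // => b /negPf ->; rewrite mul0r.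
    rewrite [RHS](partition_big c predT) //=; apply: eq_bigr => l _.
    rewrite /csum mulr_sumr big_mkcond [RHS]big_mkcond; apply: eq_bigr => a _.
    by case: (a != u); case: eqP => [e|_] //=; rewrite ?e ?mul0r.
  by rewrite mulr_sumr; apply: eq_bigr => b _; rewrite eqxx mul1r; ring.
have P6 : \sum_a \sum_b nb a * (b == u)%:R * (y a * y b) = y u * (y w + y v + \sum_l (outer c l)%:R * csum c y l).
  by rewrite -P5 exchange_big; apply: eq_bigr => a _; apply: eq_bigr => b _; ring.
rewrite -P1 -P2 mulr_natl mulr2n -{1}(delta w v) mulrC -(delta v w).
rewrite -mulrA mulr_natl mulr2n -{1}P5 -P6 opprD addrA -!sumrN -!big_split /=.
apply: eq_bigr => a _; rewrite -!sumrN -!big_split /=; apply: eq_bigr => b _.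
by rewrite pw; ring.
Qed.

End Move.

Section MoveVertex.
Variable R : realType.
Local Open Scope ring_scope.
Variables (T : finType) (r : nat) (u w v : T).
Hypotheses (uw : u != w) (uv : u != v) (wv : w != v).
Variables (c : T -> 'I_r) (rho : R) (x : T -> R).
Hypotheses (cwv : c w != c v) (rho0 : 0 < rho).
Hypothesis xE : forall a, rho * x a = \sum_(b | yrel c u w v a b) x b.

Local Notation nonsp := (nonspecial u w v).
Local Notation nsz := (nsize u w v).
Local Notation out := (outer w v c).
Local Notation sp := (special w v c x).

Definition xtotal := \sum_l csum u c x l.
(** By [nonspecialE], rho + nsize c l times the common Perron entry of the
    nonspecial vertices of class l. *)
Definition kap l := xtotal + (out l)%:R * x u - sp l.
(** Solving the eigenvalue equation within class l, with the total sum
    frozen at its original value; after a move this is the test vector that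
    makes the form computable. *)
Definition pval (c' : T -> 'I_r) l := kap l / (rho + (nsz c' l)%:R).

Let den (c' : T -> 'I_r) l : 0 < rho + (nsz c' l)%:R.
Proof. by rewrite ltr_pwDl. Qed.

Lemma nonspecial_row a : nonsp a ->
  rho * x a = xtotal + (out (c a))%:R * x u - csum u c x (c a).
Proof.
move=> /and3P[au aw av]; rewrite xE.
pose L := \sum_(b | (b != u) && (c b != c a)) x b.
have -> : xtotal = csum u c x (c a) + L.
  have -> : xtotal = \sum_(b | b != u) x b by rewrite [RHS](partition_big c predT).
  by rewrite [LHS](bigID (fun b => c b == c a)).
suff -> : \sum_(b | yrel c u w v a b) x b = L + (out (c a))%:R * x u by ring.
rewrite (bigID (pred1 u)) /= addrC; congr (_ + _).
  apply: eq_bigl => b; rewrite /yrel /= (negPf au) (negPf aw) (negPf av) /= andbT.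
  by case: eqVneq => [->|_]; rewrite ?andbF //= andbT eq_sym.
rewrite /yrel /= (negPf au); case o: (out (c a)).
  rewrite mul1r (bigD1 u) /=; last by rewrite eqxx -/(out (c a)) o !orbT.
  by rewrite big1 ?addr0 // => b /andP[/andP[_ ->]].
rewrite mul0r big1 // => b /andP[+ /eqP bu].
by rewrite bu eqxx -/(out (c a)) o (negPf aw) (negPf av).
Qed.

Let pE a : nonsp a -> x a = (xtotal + (out (c a))%:R * x u - csum u c x (c a)) / rho.
Proof. by move=> na; rewrite -nonspecial_row // mulrC mulKf // gt_eqF. Qed.

Let csumE l : csum u c x l = (nsz c l)%:R * ((xtotal + (out l)%:R * x u - csum u c x l) / rho) + sp l.
Proof.
rewrite -(csum_zvec uw uv wv c (fun l => (xtotal + (out l)%:R * x u - csum u c x l) / rho)).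
apply: eq_bigr => a _; rewrite /zvec; case: ifP => // na; exact: pE.
Qed.

Lemma nonspecialE a : nonsp a -> x a = pval c (c a).
Proof.
move=> na; apply: (mulIf (x := rho + (nsz c (c a))%:R)); first by rewrite gt_eqF.
rewrite /pval divfK ?gt_eqF // /kap mulrDr mulrC nonspecial_row //.
rewrite {1}csumE (pE na); ring.
Qed.

Lemma zvec_self : zvec u w v c (pval c) x =1 x.
Proof. by move=> a; rewrite /zvec; case: ifP => // na; rewrite -nonspecialE. Qed.

(** The only part of the form at the test vector that depends on the class
    sizes, apart from a square, see [reduced_form]. *)
Definition excess (c' : T -> 'I_r) := \sum_l kap l ^+ 2 * ((nsz c' l)%:R / (rho + (nsz c' l)%:R)).

Let C : R := - 2 * (x w * x v) + 2 * x u * (x w + x v)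
  - rho * (x u ^+ 2 + x w ^+ 2 + x v ^+ 2) + \sum_l (sp l ^+ 2 + 2 * kap l * sp l) - xtotal ^+ 2.

(** Completing the square in the total sum. The square is nonnegative and
    vanishes for c itself, so an increase of [excess] would increase the form. *)
Lemma reduced_form (c' : T -> 'I_r) : c' w = c w -> c' v = c v ->
  let y := zvec u w v c' (pval c') x in
  qform (yrel c' u w v) y - rho * \sum_a y a ^+ 2 =
  (\sum_l csum u c' y l - xtotal) ^+ 2 + excess c' + C.
Proof.
move=> c'w c'v y.
rewrite qform_yrel ?c'w ?c'v // /y (sqr_zvec uw uv wv) !zvec_special.
set s := csum u c' _; pose p := pval c'.
have outE l : outer w v c' l = out l by rewrite /outer c'w c'v.
under [\sum_l (outer _ _ _ _)%:R * _]eq_bigr do rewrite outE.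
have sE l : s l = (nsz c' l)%:R * p l + sp l.
  by rewrite /s csum_zvec // /special c'w c'v.
have [P0 P0E] : exists P0, P0 = xtotal by exists xtotal.
have main : 2 * P0 * (\sum_l s l) - \sum_l s l ^+ 2 + 2 * x u * \sum_l (out l)%:R * s l
    - rho * \sum_l (nsz c' l)%:R * p l ^+ 2 =
    excess c' + \sum_l (sp l ^+ 2 + 2 * kap l * sp l).
  rewrite /excess !mulr_sumr -!sumrN -!big_split /=; apply: eq_bigr => l _.
  have kE : kap l = p l * (rho + (nsz c' l)%:R) by rewrite /p /pval divfK // gt_eqF.
  have tE : P0 = kap l + sp l - (out l)%:R * x u by rewrite P0E /kap; ring.
  have d0 : rho + (nsz c' l)%:R != 0 by rewrite gt_eqF.
  rewrite sE tE kE; field.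
  by rewrite d0.
rewrite -P0E; move: main; rewrite /C -P0E; set A1 := \sum_l s l; set A2 := \sum_l s l ^+ 2.
set A3 := \sum_l (out l)%:R * s l; set A4 := \sum_l (nsz c' l)%:R * _.
set A5 := \sum_l (sp l ^+ 2 + _) => main.
rewrite -[X in _ = _ + X + _](addrK A5) -main; ring.
Qed.

Lemma sum_total : \sum_l csum u c (zvec u w v c (pval c) x) l = xtotal.
Proof.
by apply: eq_bigr => l _; apply: eq_bigr => a _; rewrite zvec_self.
Qed.

Variables (q : T) (l : 'I_r).
Hypotheses (nq : nonsp q) (lq : l != c q).
Let c' a := if a == q then l else c a.
Hypothesis ray : forall y, qform (yrel c' u w v) y <= rho * \sum_a y a ^+ 2.

Let c'w : c' w = c w.
Proof. by rewrite /c'; case: eqP => // wq; move: nq; rewrite -wq /nonspecial /= eqxx andbF. Qed.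

Let c'v : c' v = c v.
Proof. by rewrite /c'; case: eqP => // vq; move: nq; rewrite -vq /nonspecial /= eqxx !andbF. Qed.

Let szk : (nsz c (c q) = (nsz c' (c q)).+1)%N.
Proof.
rewrite /nsize (cardsD1 q) inE nq eqxx add1n; congr _.+1; apply: eq_card => a.
rewrite !inE /c'; case: eqVneq => [->|_] /=; last by [].
by rewrite (negPf lq) andbF.
Qed.

Let szl : (nsz c' l = (nsz c l).+1)%N.
Proof.
rewrite /nsize (cardsD1 q) inE nq /c' eqxx eqxx add1n; congr _.+1; apply: eq_card => a.
rewrite !inE; case: eqVneq => [->|_] //=.
by rewrite [c q == l]eq_sym (negPf lq) andbF.
Qed.

Let szo m : m != c q -> m != l -> nsz c' m = nsz c m.
Proof.
move=> mq ml; apply: eq_card => a; rewrite !inE /c'; case: (eqVneq a q) => [->|] //.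
by rewrite [l == m]eq_sym (negPf ml) [c q == m]eq_sym (negPf mq).
Qed.

(** The Rayleigh bound after the move gives excess c' <= excess c, and only
    the classes of q and l differ. *)
Theorem move_le :
  kap l ^+ 2 * ((rho + (nsz c (c q))%:R) * (rho + (nsz c (c q))%:R - 1)) <=
  kap (c q) ^+ 2 * ((rho + (nsz c l)%:R) * (rho + (nsz c l)%:R + 1)).
Proof.
have h0 : excess c + C = 0.
  have := reduced_form erefl erefl; rewrite /= sum_total subrr expr0n add0r => <-.
  have -> : \sum_a zvec u w v c (pval c) x a ^+ 2 = \sum_a x a ^+ 2.
    by apply: eq_bigr => a _; rewrite zvec_self.
  have -> : qform (yrel c u w v) (zvec u w v c (pval c) x) = qform (yrel c u w v) x.
    by apply: eq_bigr => a _; apply: eq_bigr => b _; rewrite !zvec_self.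
  by rewrite (qform_eigen xE) subrr.
have h1 : excess c' + C <= 0.
  have := reduced_form c'w c'v; rewrite /= => h.
  have := ray (zvec u w v c' (pval c') x); rewrite -subr_le0 h.
  by have := sqr_ge0 (\sum_l csum u c' (zvec u w v c' (pval c') x) l - xtotal); lra.
have h2 : excess c' <= excess c by move: h0 h1; lra.
move: h2; rewrite /excess !(sum_split2 _ lq).
have -> : \sum_(m | (m != l) && (m != c q)) kap m ^+ 2 * ((nsz c' m)%:R / (rho + (nsz c' m)%:R)) =
  \sum_(m | (m != l) && (m != c q)) kap m ^+ 2 * ((nsz c m)%:R / (rho + (nsz c m)%:R)).
  by apply: eq_bigr => m /andP[ml mq]; rewrite szo.
rewrite lerD2r szl szk; set bl := nsz c l; set bk := nsz c' (c q).
rewrite -!natr1; set B : R := bl%:R; set K : R := bk%:R.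
have B0 : 0 <= B by []. have K0 : 0 <= K by [].
move=> h.
have d1 : 0 < rho + B by rewrite ltr_pwDl.
have d2 : 0 < rho + K by rewrite ltr_pwDl.
have d3 : 0 < rho + B + 1 by rewrite addr_gt0.
have d4 : 0 < rho + (K + 1) by rewrite addrA addr_gt0.
have d3' : 0 < rho + (B + 1) by rewrite addrA.
have e1 : (B + 1) / (rho + (B + 1)) - B / (rho + B) = rho / ((rho + B) * (rho + B + 1)).
  by field; rewrite !gt_eqF.
have e2 : (K + 1) / (rho + (K + 1)) - K / (rho + K) = rho / ((rho + (K + 1)) * (rho + K)).
  by field; rewrite !gt_eqF.
have h3 : kap l ^+ 2 * (rho / ((rho + B) * (rho + B + 1))) <=
    kap (c q) ^+ 2 * (rho / ((rho + (K + 1)) * (rho + K))).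
  by rewrite -e1 -e2; move: h; rewrite !mulrBr; lra.
have m1 : 0 < (rho + B) * (rho + B + 1) by rewrite mulr_gt0.
have m2 : 0 < (rho + (K + 1)) * (rho + K) by rewrite mulr_gt0.
have := ler_wpM2r (ltW (mulr_gt0 m1 m2)) h3.
have -> : rho + (K + 1) - 1 = rho + K by ring.
move: (kap l) (kap (c q)) => k1 k2.
have -> : k1 ^+ 2 * (rho / ((rho + B) * (rho + B + 1))) *
    ((rho + B) * (rho + B + 1) * ((rho + (K + 1)) * (rho + K))) =
    k1 ^+ 2 * ((rho + (K + 1)) * (rho + K)) * rho by field; rewrite !gt_eqF.
have -> : k2 ^+ 2 * (rho / ((rho + (K + 1)) * (rho + K))) *
    ((rho + B) * (rho + B + 1) * ((rho + (K + 1)) * (rho + K))) =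
    k2 ^+ 2 * ((rho + B) * (rho + B + 1)) * rho by field; rewrite !gt_eqF.
by rewrite ler_pM2r.
Qed.

End MoveVertex.

(** Write A l for rho + nsize l and S for the total of the entries of x. By
    [move_le], moving a vertex from k to l gives kap l ^ 2 A k (A k - 1) <= kap
    k ^ 2 A l (A l + 1). Here kap is S on the classes other than those of w and
    v, and S - h on these two, with h about 1 + (r - 2) / (r - 1); moreover kap
    l is about A l. So kap l enters as A l with a loss of h on the special
    classes, and each bound on sizes is a quadratic comparison. *)
Section Sizes.
Variable R : realType.
Local Open Scope ring_scope.
Variables (T : finType) (r : nat) (u w v : T).
Hypotheses (uw : u != w) (uv : u != v) (wv : w != v).
Variables (c : T -> 'I_r) (rho : R) (x : T -> R).
Hypotheses (cwv : c w != c v) (r3 : (2 < r)%N).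
Hypothesis xE : forall a, rho * x a = \sum_(b | yrel c u w v a b) x b.
Hypothesis ray : forall q l, nonspecial u w v q -> l != c q -> forall y,
  qform (yrel (fun a => if a == q then l else c a) u w v) y <= rho * \sum_a y a ^+ 2.
Hypothesis filled : forall l, exists2 q, nonspecial u w v q & c q = l.
Local Notation rr := (r%:R : R).
Variable eta : R.
Hypotheses (eta0 : 0 <= eta) (eta_small : 20 * rr * eta <= 1) (rho_big : 20 * rr <= rho).
Hypotheses (x1 : forall a, x a <= 1) (xge : forall a, a != u -> 1 - eta <= x a).
Hypotheses (xuge : (rr - 2) / (rr - 1) - eta <= x u) (xule : x u <= (rr - 2) / (rr - 1) + eta).

Local Notation nsz := (nsize u w v c).
Local Notation kp := (kap u w v c x).
Local Notation out := (outer w v c).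
Local Notation th := ((rr - 2) / (rr - 1)).
Let S := xtotal u c x + x u.
Let A l := rho + (nsz l)%:R.

Let r3R : 3 <= rr. Proof. by rewrite ler_nat. Qed.
Let rho0 : 0 < rho. Proof. by move: rho_big r3R; lra. Qed.
Let rho60 : 60 <= rho. Proof. by move: rho_big r3R; lra. Qed.
Let eta60 : 60 * eta <= 1.
Proof. by apply: le_trans eta_small; rewrite ler_wpM2r //; move: r3R; lra. Qed.
Let thE : th * (rr - 1) = rr - 2. Proof. by rewrite divfK // gt_eqF //; move: r3R; lra. Qed.
Let th_ge : 1 / 2 <= th.
Proof. by rewrite ler_pdivlMr; move: r3R; lra. Qed.
Let th_le : rr * th <= rr - 1.
Proof.
have : th <= 1 by rewrite ler_pdivrMr; move: r3R; lra.
move: thE r3R; lra.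
Qed.

Let A60 l : 60 <= A l. Proof. by rewrite /A; apply: le_trans rho60 _; rewrite lerDl. Qed.
Let Ar l : 20 * rr <= A l. Proof. by apply: le_trans rho_big _; rewrite lerDl. Qed.

Let kapE l : exists2 p, 1 - eta <= p <= 1 & kp l = A l * p.
Proof.
have [q nq cq] := filled l; exists (x q).
  by rewrite x1 andbT xge //; move: nq => /and3P[].
rewrite (nonspecialE uw uv wv rho0 xE nq) cq /pval mulrC divfK // gt_eqF //.
by have := A60 l; rewrite /A; lra.
Qed.

Let kap_outer l : out l -> kp l = S.
Proof.
move=> ol; rewrite /kap ol mul1r /special; move: ol => /andP[/negPf -> /negPf ->].
by rewrite !mul0r addr0 subr0.
Qed.

Let kap_special l : ~~ out l ->
  exists2 h, kp l = S - h & 1 + th - 2 * eta <= h <= 1 + th + eta.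
Proof.
move=> ol; have wu : w != u by rewrite eq_sym. have vu : v != u by rewrite eq_sym.
rewrite /kap (negPf ol) mul0r addr0 /special; move: ol; rewrite /outer negb_and !negbK.
have [lw _|lw /eqP lv] := eqVneq l (c w).
  exists (x u + x w).
    by rewrite lw (negPf cwv) mul1r mul0r addr0 /S; ring.
  by have := xge wu; have := x1 w; move: xuge xule; lra.
exists (x u + x v); first by rewrite lv eqxx mul0r mul1r add0r /S; ring.
by have := xge vu; have := x1 v; move: xuge xule; lra.
Qed.

Let move_kl k l : k != l ->
  kp l ^+ 2 * (A k * (A k - 1)) <= kp k ^+ 2 * (A l * (A l + 1)).
Proof.
move=> kl; have [q nq cq] := filled k; have lq : l != c q by rewrite cq eq_sym.
by have := move_le uw uv wv cwv rho0 xE nq lq (ray nq lq); rewrite cq.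
Qed.

Let A_nat k l m : (nsz l + m <= nsz k)%N -> A l + m%:R <= A k.
Proof. by rewrite -(ler_nat R) natrD /A; lra. Qed.

Lemma size_outer k l : out k -> out l -> (nsz k <= (nsz l).+1)%N.
Proof.
move=> ok ol; have [->//|kl] := eqVneq k l; rewrite leqNgt; apply/negP => lt.
have h := @A_nat k l 2 (ltac:(by rewrite addn2)).
have := move_kl kl; rewrite !kap_outer //.
have [p /andP[p0 p1] Sp] := kapE k; rewrite kap_outer // in Sp.
have S0 : 0 < S by rewrite Sp; have := A60 k; move: p0 eta60; nra.
rewrite ler_pM2l ?exprn_gt0 //.
by have := A60 l; move: h; nra.
Qed.

Lemma size_special_lt k l : ~~ out k -> out l -> (nsz k < nsz l)%N.
Proof.
move=> ok ol; have kl : k != l by apply: contraNneq ok => ->.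
rewrite ltnNge; apply/negP => le.
have := @A_nat k l 0 (ltac:(by rewrite addn0)); rewrite addr0 => AA.
have := move_kl kl; rewrite (kap_outer ol).
have [h -> /andP[h1 h2]] := kap_special ok.
have [p /andP[p0 p1] Sp] := kapE l; rewrite kap_outer // in Sp; rewrite Sp.
have {}h1 : 14 / 10 <= h by move: h1 th_ge eta60; lra.
have h3 : h <= 21 / 10.
  have : th <= 1 by move: th_le r3R; nra.
  by move: h2 eta60; lra.
have p9 : 95 / 100 <= p by move: p0 eta60; lra.
have := A60 l; set a := A l in AA *; set b := A k in AA * => a60.
have bb : a * (a - 1) <= b * (b - 1) by nra.
move=> H.
have {H} H : (a * p) ^+ 2 * (a * (a - 1)) <= (a * p - h) ^+ 2 * (a * (a + 1)).
  by apply: le_trans H; rewrite ler_wpM2l // sqr_ge0.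
have a0 : 0 < a by lra.
have {H} H : (a * p) ^+ 2 * (a - 1) <= (a * p - h) ^+ 2 * (a + 1).
  by rewrite -(ler_pM2r a0); move: H; lra.
have e : (a * p - h) ^+ 2 * (a + 1) - (a * p) ^+ 2 * (a - 1) =
  2 * (a * p) ^+ 2 - 2 * (a * p) * h * (a + 1) + h ^+ 2 * (a + 1) by ring.
have H1 : (a * p) * h * (a + 1) <= (a * p) ^+ 2 + h ^+ 2 * (a + 1) / 2 by move: H e; lra.
have H2 : (a * p) * (14 / 10) * a <= (a * p) * h * (a + 1).
  by rewrite -!mulrA !ler_wpM2l //; nra.
have H3 : (a * p) ^+ 2 <= (a * p) * a by rewrite expr2 ler_wpM2l //; nra.
have H4 : h ^+ 2 * (a + 1) / 2 <= 5 * a.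
  have hh : h ^+ 2 <= 5 by rewrite expr2; nra.
  have a1 : 0 <= a + 1 by lra.
  by have := ler_wpM2r a1 hh; lra.
have H5 : a * (4 / 10 * (a * p)) <= a * 5 by move: H1 H2 H3 H4; lra.
move: H5; rewrite ler_pM2l //; nra.
Qed.

Lemma size_outer_special k l : out k -> ~~ out l -> (nsz k <= (nsz l).+2)%N.
Proof.
move=> ok ol; have kl : k != l by apply: contraNneq ol => <-.
rewrite leqNgt; apply/negP => lt.
have := @A_nat k l 3 (ltac:(by rewrite addn3)) => AA.
have := move_kl kl; rewrite (kap_outer ok).
have [h -> /andP[h1 h2]] := kap_special ol.
have [p /andP[p0 p1] Sp] := kapE k; rewrite kap_outer // in Sp; rewrite Sp.
have h0 : 0 <= h by move: h1 th_ge eta60; lra.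
have p9 : 95 / 100 <= p by move: p0 eta60; lra.
have a60 := A60 k; have l60 := A60 l; have ar := Ar k.
move: AA a60 l60 ar; set a := A k; set b := A l => AA a60 l60 ar H.
have a0 : 0 < a by lra.
have ap : 0 < a * p by rewrite mulr_gt0 //; lra.
have bb : b * (b + 1) <= (a - 3) * (a - 2) by nra.
have {H} H : (a * p - h) ^+ 2 * (a * (a - 1)) <= (a * p) ^+ 2 * ((a - 3) * (a - 2)).
  by apply: le_trans H _; rewrite ler_wpM2l // sqr_ge0.
have e : (a * p - h) ^+ 2 * (a * (a - 1)) - (a * p) ^+ 2 * ((a - 3) * (a - 2)) =
  (a * p) ^+ 2 * (4 * a - 6) - 2 * (a * p) * h * (a * (a - 1)) + h ^+ 2 * (a * (a - 1)) by ring.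
have H1 : (a * p) * (a * p * (4 * a - 6)) <= (a * p) * (2 * h * (a * a)).
  have g1 : 0 <= h ^+ 2 * (a * (a - 1)) by rewrite mulr_ge0 ?sqr_ge0 // mulr_ge0; lra.
  have g2 : (a * p) * (2 * h * (a * (a - 1))) <= (a * p) * (2 * h * (a * a)).
    by rewrite ler_wpM2l ?(ltW ap) // ler_wpM2l ?mulr_ge0 // ler_wpM2l //; lra.
  move: H e g1 g2; lra.
move: H1; rewrite ler_pM2l // => H1.
have H2 : a * (p * (4 * a - 6)) <= a * (2 * h * a) by move: H1; lra.
move: H2; rewrite ler_pM2l // => H2.
have H3 : a * (4 * p - 2 * h) <= 6 by move: H2 p1; lra.
have H4 : 2 - 2 * th - 6 * eta <= 4 * p - 2 * h by move: p0 h2; lra.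
have H5 : 20 * rr * (2 - 2 * th - 6 * eta) <= 6.
  have z0 : 0 <= 2 - 2 * th - 6 * eta.
    have : rr * (2 - 2 * th - 6 * eta) >= 0 by move: th_le eta_small; lra.
    by rewrite pmulr_rge0 //; move: r3R; lra.
  apply: le_trans H3; apply: ler_pM => //; first by rewrite mulr_ge0.
move: H5 th_le eta_small; lra.
Qed.

Lemma size_special k l : ~~ out k -> ~~ out l -> (nsz k <= (nsz l).+1)%N.
Proof.
move=> ok ol; have [->//|kl] := eqVneq k l; rewrite leqNgt; apply/negP => lt.
have AA := @A_nat k l 2 (ltac:(by rewrite addn2)).
have := move_kl kl.
have [h kh /andP[h1 h2]] := kap_special ok.
have [h' kh' /andP[h1' h2']] := kap_special ol.
have [p /andP[p0 p1] kp_l] := kapE l.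
have -> : kp k = A l * p + (h' - h) by rewrite -kp_l kh kh'; ring.
rewrite kp_l.
have g1 : h' - h <= 5 / 100 by move: h2' h1 eta60; lra.
have g2 : - (5 / 100) <= h' - h by move: h1' h2 eta60; lra.
have p9 : 95 / 100 <= p by move: p0 eta60; lra.
have a60 := A60 l; move: AA a60 g1 g2; set a := A l; set b := A k; set g := h' - h.
move=> AA a60 g1 g2 H.
have a0 : 0 < a by lra.
have bb : (a + 2) * (a + 1) <= b * (b - 1) by nra.
have {H} H : (a * p) ^+ 2 * ((a + 2) * (a + 1)) <= (a * p + g) ^+ 2 * (a * (a + 1)).
  by apply: le_trans H; rewrite ler_wpM2l // sqr_ge0.
have {H} H : (a * p) ^+ 2 * (a + 2) <= (a * p + g) ^+ 2 * a.
  have a1 : 0 < a + 1 by lra.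
  by rewrite -(ler_pM2r a1); move: H; lra.
have e : (a * p + g) ^+ 2 * a - (a * p) ^+ 2 * (a + 2) =
  a * (2 * (a * p) * g + g ^+ 2 - 2 * a * p ^+ 2) by ring.
have H1 : 0 <= a * (2 * (a * p) * g + g ^+ 2 - 2 * a * p ^+ 2) by rewrite -e subr_ge0.
move: H1; rewrite pmulr_rge0 // => H1.
have H2 : a * (2 * (p * g)) <= a * (2 * 5 / 100).
  rewrite ler_pM2l //; have : p * g <= 5 / 100 by nra.
  lra.
have H3 : g ^+ 2 <= 1 by nra.
have H4 : a * (2 * (9 / 10)) <= a * (2 * p ^+ 2).
  rewrite ler_pM2l //; have : 9 / 10 <= p ^+ 2 by nra.
  lra.
lra.
Qed.

End Sizes.

(** * Isomorphism from class sizes *)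

Section Matching.
Variables (K : eqType).

(** Send the i-th element of each fibre of f to the i-th element of the
    corresponding fibre of g. *)
Lemma fiber_injection (T T' : finType) (f : T -> K) (g : T' -> K) :
  (forall k, #|[set x | f x == k]| <= #|[set y | g y == k]|) ->
  exists2 h : T -> T', injective h & forall x, g (h x) = f x.
Proof.
move=> fg; pose fi x := index x (enum [set z | f z == f x]).
pose gi y := index y (enum [set z | g z == g y]).
have ex x : exists y, g y = f x /\ gi y = fi x.
  have ix : fi x < #|[set y | g y == f x]|.
    by apply: leq_trans (fg _); rewrite cardE index_mem mem_enum inE.
  have yP := enum_valP (Ordinal ix); set y := enum_val _ in yP.
  have gy : g y = f x by move: yP; rewrite inE => /eqP.
  exists y; split=> //; rewrite /gi gy /y (enum_val_nth y) /= index_uniq ?enum_uniq //.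
  by rewrite -cardE.
have [h hP] := boolp.choice ex; exists h; last by move=> x; case: (hP x).
move=> x y hxy; have [gx ix] := hP x; have [gy iy] := hP y.
have fxy : f x = f y by rewrite -gx -gy hxy.
have : fi x = fi y by rewrite -ix -iy hxy.
rewrite /fi -fxy => e.
have xin : x \in enum [set z | f z == f x] by rewrite mem_enum inE.
have yin : y \in enum [set z | f z == f x] by rewrite mem_enum inE fxy.
by rewrite -(nth_index x xin) e nth_index.
Qed.

Lemma fiber_bijection (T T' : finType) (f : T -> K) (g : T' -> K) :
  (forall k, #|[set x | f x == k]| = #|[set y | g y == k]|) ->
  exists2 h : T -> T', bijective h & forall x, g (h x) = f x.
Proof.
move=> fg; have [h hinj hP] := fiber_injection (fun k => eq_leq (fg k)).
have [h' h'inj _] := fiber_injection (fun k => eq_leq (esym (fg k))).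
exists h => //; apply: inj_card_bij => //; exact: leq_card h'inj.
Qed.

(** The bijection is corrected by transpositions inside the fibres, one
    prescribed point at a time. *)
Lemma fiber_bijection_points (T T' : finType) (f : T -> K) (g : T' -> K) (s : seq T) (s' : seq T') :
  (forall k, #|[set x | f x == k]| = #|[set y | g y == k]|) ->
  uniq s -> uniq s' -> map f s = map g s' ->
  exists2 h : T -> T', bijective h & (forall x, g (h x) = f x) /\ map h s = s'.
Proof.
move=> fg; elim: s s' => [|x s IH] [|y s'] //=.
  by have [h hb hP] := fiber_bijection fg; exists h.
move=> /andP[xs us] /andP[ys' us'] [fxy fs].
have [h hb [hP hs]] := IH s' us us' fs.
have hinj := bij_inj hb.
exists (fun z => tperm (h x) y (h z)).
  apply: (bij_comp (f := tperm (h x) y)) hb; apply: injF_bij; exact: perm_inj.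
split.
  move=> z; case: tpermP => [e|e|_ _]; last exact: hP.
    by rewrite -fxy -(hP x) -e hP.
  by rewrite hP fxy -e hP.
rewrite tpermL; congr cons; rewrite -[RHS]hs; apply/eq_in_map => z zs.
rewrite tpermD //.
  by apply: contraNneq xs => /hinj ->.
by apply: contraNneq ys' => ->; rewrite -hs map_f.
Qed.

End Matching.

Section Balanced.
Variable r : nat.

(** The shape of the class sizes of Y_r(n), with i and j the colours of the
    two ends of the missing edge. *)
Definition balanced_ends (a : 'I_r -> nat) i j :=
  [/\ i != j, forall k l, a k <= (a l).+1, forall l, a i <= a l &
      forall l, l != i -> a j <= a l].

(** Balanced sizes are the quotient and the quotient plus 1, and the
    remainder counts the latter; so the sum determines the multiset of sizes. *)
Lemma balanced_count (a : 'I_r -> nat) m :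
  (forall k l, a k <= (a l).+1) -> m = (\sum_l a l) %/ r ->
  (forall l, m <= a l <= m.+1) /\ #|[set l | a l == m.+1]| = (\sum_l a l) %% r.
Proof.
move=> bal mE; have N := divn_eq (\sum_l a l) r; rewrite -mE in N.
have mid l : m <= a l <= m.+1.
  have r0 : 0 < r by apply: leq_ltn_trans (ltn_ord l).
  have sm b : \sum_(k < r) b = r * b by rewrite sum_nat_const card_ord.
  apply/andP; split; rewrite leqNgt; apply/negP => lt.
    have : \sum_k a k < r * m.
      rewrite -sm (bigD1 l) //= [X in _ < X](bigD1 l) //= -addSn leq_add //.
      by apply: leq_sum => k _; apply: leq_trans (bal k l) _.
    by rewrite N mulnC; lia.
  have : r * m.+1 <= \sum_k a k.
    by rewrite -sm; apply: leq_sum => k _; rewrite -ltnS; apply: leq_trans lt (bal l k).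
  have := ltn_pmod (\sum_l a l) r0; rewrite {2}N mulnS mulnC; lia.
split=> //.
have [r0|r0] := posnP r; first by move: a bal mE N mid; rewrite r0 => a *; rewrite big_ord0 mod0n; apply: eq_card0 => -[].
have e : \sum_l a l = m * r + #|[set l | a l == m.+1]|.
  have -> : #|[set l | a l == m.+1]| = \sum_l (a l == m.+1).
    by rewrite -sum1dep_card big_mkcond; apply: eq_bigr => l _; case: (_ == _).
  have -> : m * r = \sum_(l < r) m by rewrite sum_nat_const card_ord mulnC.
  by rewrite -big_split /=; apply: eq_bigr => l _; move: (mid l) => /andP[]; case: eqP; lia.
by apply/eqP; rewrite -(eqn_add2l (m * r)) -e -N.
Qed.

Lemma balanced_fibers (a a' : 'I_r -> nat) :
  (forall k l, a k <= (a l).+1) -> (forall k l, a' k <= (a' l).+1) ->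
  \sum_l a l = \sum_l a' l -> forall k, #|[set l | a l == k]| = #|[set l | a' l == k]|.
Proof.
move=> ba ba' sums k.
have [m1 c1] := balanced_count ba erefl.
have [m2 c2] := balanced_count ba' erefl; rewrite -sums in m2 c2.
set m := _ %/ r in m1 m2 c1 c2.
have [->|km1] := eqVneq k m.+1; first by rewrite c1 c2.
have low (b : 'I_r -> nat) : (forall l, m <= b l <= m.+1) ->
    #|[set l | b l == m.+1]| = (\sum_l a l) %% r -> #|[set l | b l == m]| = r - (\sum_l a l) %% r.
  move=> mb cb; have := cardsC [set l | b l == m.+1]; rewrite cb card_ord => rE.
  have -> : #|[set l | b l == m]| = #|~: [set l | b l == m.+1]|.
    apply: eq_card => l; rewrite !inE.
    by move: (mb l) => /andP[]; case: eqP; case: eqP; lia.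
  by rewrite -[X in _ = X - _]rE addKn.
have [->|km] := eqVneq k m; first by rewrite (low a) // (low a').
have none (b : 'I_r -> nat) : (forall l, m <= b l <= m.+1) -> #|[set l | b l == k]| = 0.
  move=> mb; apply: eq_card0 => l; rewrite !inE; apply/eqP => bl.
  by move: (mb l); rewrite bl; move: km km1; lia.
by rewrite (none a) // (none a').
Qed.

Lemma match_colors (a a' : 'I_r -> nat) i j i' j' :
  balanced_ends a i j -> balanced_ends a' i' j' -> \sum_l a l = \sum_l a' l ->
  exists2 p : 'I_r -> 'I_r, bijective p & [/\ forall l, a' (p l) = a l, p i = i' & p j = j'].
Proof.
move=> [ij ba ai aj] [ij' ba' ai' aj'] sums.
have fib := balanced_fibers ba ba' sums.
have second (b b' : 'I_r -> nat) k l k' l' (p : 'I_r -> 'I_r) : injective p ->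
    (forall x, b (p x) = b' x) -> k' != l' -> b' k' <= b' l' ->
    (forall x, x != k -> b l <= b x) -> b l <= b' l'.
  move=> pinj pb kl' le min; have [e|ne] := eqVneq (p l') k; last by rewrite -pb min.
  apply: leq_trans le; rewrite -pb min // -e (inj_eq pinj).
  exact: kl'.
have [p [p' pK p'K] pa] := fiber_bijection fib.
have p'a l : a (p' l) = a' l by rewrite -pa p'K.
have ei : a i = a' i'.
  apply/eqP; rewrite eqn_leq; apply/andP; split; first by rewrite -p'a ai.
  by rewrite -pa ai'.
have ej : a j = a' j'.
  apply/eqP; rewrite eqn_leq; apply/andP; split.
    by apply: (second a a' i j i' j' p') => //; apply: can_inj p'K.
  by apply: (second a' a i' j' i j p) => //; apply: can_inj pK.
have [h hb [hP [hi hj]]] := @fiber_bijection_points _ _ _ a a' [:: i; j] [:: i'; j'] fib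
  (ltac:(by rewrite /= inE ij)) (ltac:(by rewrite /= inE ij')) (ltac:(by rewrite /= ei ej)).
by exists h.
Qed.

End Balanced.

Lemma yrel_swap (T : finType) r (c : T -> 'I_r) u w v : yrel c u w v =2 yrel c u v w.
Proof.
move=> a b; rewrite /yrel /=; case: (a == u); [|case: (b == u)].
- by congr andb; rewrite orbCA andbC.
- by rewrite orbCA andbC.
by rewrite orbC.
Qed.

Definition ysize (T : finType) r (c : T -> 'I_r) u l := #|[set x | (x != u) && (c x == l)]|.

Lemma sum_ysize (T : finType) r (c : T -> 'I_r) u : (\sum_l ysize c u l).+1 = #|T|.
Proof.
rewrite -cardsT (cardsD1 u) inE add1n; congr _.+1.
rewrite -sum1_card (partition_big c predT) //=; apply: eq_bigr => l _.
by rewrite /ysize -sum1_card; apply: eq_bigl => x; rewrite !inE andbT.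
Qed.

(** Match the colours by [match_colors], then the vertices class by class,
    with u, w and v prescribed. None stands for the class of u alone. *)
Lemma yrel_iso (T T' : finType) r (c : T -> 'I_r) (c' : T' -> 'I_r) u w v u' w' v' :
  u != w -> u != v -> u' != w' -> u' != v' -> #|T| = #|T'| ->
  balanced_ends (ysize c u) (c w) (c v) -> balanced_ends (ysize c' u') (c' w') (c' v') ->
  exists2 h : T -> T', bijective h & forall a b, yrel c' u' w' v' (h a) (h b) = yrel c u w v a b.
Proof.
move=> uw uv uw' uv' cT bal bal'.
have sums : \sum_l ysize c u l = \sum_l ysize c' u' l.
  by apply/eqP; rewrite -eqSS !sum_ysize cT.
have [p pb [pa pw pv]] := match_colors bal bal' sums.
have [ij _ _ _] := bal; have [ij' _ _ _] := bal'.
have wv : w != v by apply: contraNneq ij => ->.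
have wv' : w' != v' by apply: contraNneq ij' => ->.
have pinj := bij_inj pb.
pose f x := if x == u then None else Some (p (c x)).
pose g y := if y == u' then None else Some (c' y).
have fib k : #|[set x | f x == k]| = #|[set y | g y == k]|.
  case: k => [k|]; last first.
    rewrite (_ : [set x | f x == None] = [set u]).
      rewrite (_ : [set y | g y == None] = [set u']) ?cards1 //.
      by apply/setP => y; rewrite !inE /g; case: (eqVneq y u').
    by apply/setP => x; rewrite !inE /f; case: (eqVneq x u).
  have [p' pK p'K] := pb; have := pa (p' k); rewrite p'K /ysize => e.
  rewrite (_ : [set y | g y == Some k] = [set x | (x != u') && (c' x == k)]).
    rewrite e; apply: eq_card => x; rewrite !inE /f; case: (eqVneq x u) => //= _.
    by rewrite -[k in _ == Some k]p'K (inj_eq Some_inj) (inj_eq pinj).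
  by apply/setP => y; rewrite !inE /g; case: (eqVneq y u').
have [h hb [hP [hu hw hv]]] := @fiber_bijection_points _ _ _ f g [:: u; w; v] [:: u'; w'; v'] fib
  (ltac:(by rewrite /= !inE negb_or uw uv wv)) (ltac:(by rewrite /= !inE negb_or uw' uv' wv'))
  (ltac:(by rewrite /f /g /= !eqxx ![_ == u]eq_sym ![_ == u']eq_sym (negPf uw) (negPf uv) (negPf uw') (negPf uv') pw pv)).
have hinj := bij_inj hb.
exists h => // a b.
have hc x : x != u -> c' (h x) = p (c x).
  move=> xu; have := hP x; rewrite /f /g (negPf xu) -hu (inj_eq hinj) (negPf xu).
  by case.
have ceq x y : x != u -> y != u -> (c' (h x) == c' (h y)) = (c x == c y).
  by move=> xu yu; rewrite !hc // (inj_eq pinj).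
have wu : w != u by rewrite eq_sym. have vu : v != u by rewrite eq_sym.
rewrite /yrel /= -hu -hw -hv !(inj_eq hinj).
by case: (eqVneq a u) => [_|au]; case: (eqVneq b u) => [_|bu]; rewrite /= ?ceq.
Qed.

(** * The graph Y_r(n) *)

Section YGraph.
Variables (n r : nat).

Lemma turan_edge (a b : turan n r) : edge a b = (part a != part b).
Proof.
have -> : edge a b = (a != b) && ((part a != part b) || (part b != part a)) by [].
by rewrite [part b == _]eq_sym orbb; case: eqVneq => // ->; rewrite eqxx.
Qed.

Lemma part_card (l : 'I_r) : #|[set x : turan n r | part x == l]| = (n + l) %/ r.
Proof.
pose B (i : 'I_r) := 'I_(tnth [tuple (n + i) %/ r | i < r] i).
have -> : [set x : turan n r | part x == l] = [set (Tagged B y : turan n r) | y in [set: B l]].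
  apply/setP => -[i y]; rewrite inE /part /=; apply/eqP/imsetP => [e|[z _ e]]; last by move/(congr1 (@tag _ _)): e.
    by move: y; rewrite e => y; exists y; rewrite ?inE.
rewrite card_imset ?cardsT ?card_ord ?tnth_mktuple //.
by move=> x y /eqP; rewrite -tag_eqE /tag_eq eqxx /= tagged_asE => /eqP.
Qed.

Variables (u w v : turan n r).
Hypotheses (r2 : 1 < r) (Y : Y_choice u w v).

Let uw : u != w. Proof. by case: Y. Qed.
Let puw : part u = part w.
Proof. by case: Y => pu pw _ _; apply: val_inj; rewrite /= pu pw. Qed.
Lemma choice_parts : part w != part v.
Proof. by case: Y => pu pw _ pv; rewrite -val_eqE /= pw pv; lia. Qed.
Lemma choice_uv : u != v.
Proof. by apply: contraNneq choice_parts => <-; rewrite puw. Qed.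

Lemma Y_edge (a b : turan n r) : @edge (Y_graph u w v) a b = yrel (@part n r) u w v a b.
Proof.
have T1 (d : turan n r) : (part d == 0 :> nat) = (part d == part v).
  by case: Y => _ _ _ pv; rewrite -pv val_eqE.
have wv : w != v by apply: contraNneq choice_parts => ->.
pose P x y := [&& part x != part y, ~~ (((x == u) || (x == w)) && (part y == part v))
  & ~~ (((y == u) || (y == w)) && (part x == part v))] ||
  [|| (x == u) && (y == w), (x == u) && (y == v) | [&& x == w, part y == part v & y != v]].
have -> : @edge (Y_graph u w v) a b = (a != b) && (P a b || P b a).
  have PE x y : [&& edge x y, ~~ Y_deleted u w x y & ~~ Y_deleted u w y x] || Y_added u w v x y
      = P x y.
    by rewrite /P -!T1 turan_edge /Y_deleted /Y_added /in_T1 /= !inE.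
  by rewrite -!PE.
rewrite /P /yrel /=.
have pvw := negPf choice_parts; have pvw' := pvw; rewrite eq_sym in pvw'.
have uv := choice_uv.
have [-> {a}|au] := eqVneq a u.
  have [->|bu] := eqVneq b u; first by [].
  rewrite (negPf uw) (negPf uv) puw pvw /= [part b == part w]eq_sym.
  have [->|bw] := eqVneq b w; first by rewrite eqxx ?orbT.
  have [->|bv] := eqVneq b v; first by rewrite ?orbT.
  rewrite !andbF /= !orbF.
  by do 2?case: (part _ == part _).
have [->|bu] := eqVneq b u.
  rewrite au (negPf uw) (negPf uv) puw pvw /=.
  have [->|aw] := eqVneq a w; first by rewrite ?orbT.
  have [->|av] := eqVneq a v; first by rewrite ?orbT.
  rewrite !andbF /= !orbF.
  by rewrite [part w == part a]eq_sym; do 3?case: (part _ == part _).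
rewrite /=.
have [->|aw] := eqVneq a w.
  have [->|bw] := eqVneq b w; first by rewrite !eqxx.
  have [->|bv] := eqVneq b v; first by rewrite !eqxx pvw pvw' !andbF.
  rewrite pvw [part b == part w]eq_sym ?andbF /=.
  case: eqVneq => [<-|_]; first by rewrite pvw.
  by case: (part _ == part _).
have [->|bw] := eqVneq b w.
  have [->|av] := eqVneq a v; first by rewrite !eqxx pvw pvw' !andbF.
  rewrite aw pvw [part w == part a]eq_sym /=.
  case: (eqVneq (part a) (part v)) => [->|_]; first by rewrite pvw'.
  by case: (part _ == part _).
rewrite /= ?andbT ?andbF ?orbF [part b == part a]eq_sym orbb.
by have [->|ab] := eqVneq a b; rewrite ?eqxx /= ?andbF ?orbF ?andbT ?orbb.
Qed.

Lemma Y_size l : 0 < n ->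
  ysize (@part n r) u l = if l == part w then n.-1 %/ r else (n + l) %/ r.
Proof.
move=> n0; have [->|lw] := eqVneq l (part w); last first.
  rewrite -part_card; apply: eq_card => x; rewrite !inE.
  by apply: andb_idl => /eqP xl; apply: contraNneq lw => xu; rewrite -xl xu puw.
have : #|[set x : turan n r | part x == part w]| = (ysize (@part n r) u (part w)).+1.
  rewrite (cardsD1 u) inE puw eqxx add1n; congr _.+1.
  by apply: eq_card => x; rewrite !inE.
rewrite part_card; case: Y => _ -> _ _.
have -> : n + r.-1 = n.-1 + r by lia.
by rewrite divnDr ?dvdnn // divnn (ltnW r2) addn1 => -[].
Qed.

Lemma Y_balanced : 0 < n -> balanced_ends (ysize (@part n r) u) (part w) (part v).
Proof.
move=> n0; have mono a b : a <= b -> a %/ r <= b %/ r by apply: leq_div2r.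
have up : (n.-1 %/ r).+1 = (n.-1 + r) %/ r by rewrite divnDr ?dvdnn // divnn (ltnW r2) addn1.
have low l : n.-1 %/ r <= ysize (@part n r) u l.
  by rewrite Y_size //; case: ifP => // _; apply: mono; lia.
split; first exact: choice_parts.
- move=> k l; apply: leq_trans (_ : (n.-1 %/ r).+1 <= _); last by rewrite ltnS.
  rewrite up Y_size //; case: ifP => [_|]; first by apply: mono; lia.
  move=> kw; apply: mono; have : (k : nat) != r.-1.
    by case: Y => _ <- _ _; rewrite val_eqE kw.
  have := ltn_ord k; lia.
- by move=> l; rewrite Y_size // eqxx.
move=> l lw; rewrite !Y_size // (negPf lw) eq_sym (negPf choice_parts).
by apply: mono; case: Y => _ _ _ ->; lia.
Qed.

Lemma Y_part_big l : r * 5 <= n -> 4 < #|[set x : turan n r | part x == l]|.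
Proof. by move=> rn; rewrite part_card leq_divRL ?(ltnW r2) //; lia. Qed.

End YGraph.

Section YBound.
Variables (R : realType) (n r : nat).
Variables (u w v : turan n r).
Hypotheses (r3 : 2 < r) (Y : Y_choice u w v).

Lemma Y_admissible (t : (r - 2).-tuple nat) : all (leq 1) t -> r * 5 <= n ->
  admissible r n (complete_multipartite [tuple of [:: 1, 1, 1 & t]]) (Y_graph u w v).
Proof.
move=> t1 rn; have uw : u != w by case: Y.
have uv := choice_uv (ltnW r3) Y; have cwv := choice_parts (ltnW r3) Y.
split; first by rewrite card_turan //; lia.
  rewrite chromatic_lt; apply/negP => /colorableP[k kP].
  apply: (@yrel_uncolorable _ _ (@part n r) u w v) => // [l|].
    by apply: ltnW; apply: (Y_part_big (ltnW r3) Y).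
  by exists k => a b ab; apply: kP; rewrite (Y_edge (ltnW r3) Y).
move=> /(forbidden_clique r3 t1)[f fe]; apply: (yrel_noclique uw uv cwv (f := f)) => i j ij.
by rewrite -(Y_edge (ltnW r3) Y); apply: fe.
Qed.
Local Open Scope ring_scope.

(** Test with the all-one vector; the class sizes are within 2 of q. *)
Lemma Y_rho : (40 * r <= n)%N ->
  n%:R - n%:R / r%:R - 1 <= spectral_radius (adjacency R (Y_graph u w v)).
Proof.
move=> rn; have uw : u != w by case: Y.
have uv := choice_uv (ltnW r3) Y; have cwv := choice_parts (ltnW r3) Y.
have wv : w != v by apply: contraNneq cwv => ->.
have n0 : (0 < n)%N by lia.
have cn : #|turan n r| = n by rewrite card_turan //; lia.
pose a l : R := (ysize (@part n r) u l)%:R; set q : R := n%:R / r%:R.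
have rq : r%:R * q = n%:R := @rq R r (ltnW r3) n%:R.
have r3R : 3 <= r%:R :> R by rewrite ler_nat.
have ab l : -2 <= a l - q <= 2.
  have [lo hi] : (n <= r * (ysize (@part n r) u l + 2) /\ r * ysize (@part n r) u l <= n + r)%N.
    rewrite (Y_size (ltnW r3) Y) //; have r0 : (0 < r)%N by lia.
    case: ifP => _.
      have := divn_eq n.-1 r; have := ltn_pmod n.-1 r0; nia.
    have := divn_eq (n + l) r; have := ltn_pmod (n + l) r0; have := ltn_ord l; nia.
  move: lo hi; rewrite -!(ler_nat R) !natrM !natrD -/(a l) -rq => lo hi.
  by nra.
have asum : \sum_l a l = n%:R - 1.
  have := sum_ysize (@part n r) u; rewrite cn => e.
  by rewrite /a -natr_sum -[X in _ = X%:R - _]e -natr1 addrK.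
have sqs : \sum_l a l ^+ 2 <= 4 * r%:R + 2 * q * (n%:R - 1) - n%:R * q.
  have -> : 4 * r%:R + 2 * q * (n%:R - 1) - n%:R * q = \sum_(l < r) (4 + 2 * q * a l - q ^+ 2).
    rewrite sumrB big_split /= -mulr_sumr asum !sumr_const card_ord -[4 *+ r]mulr_natr -[_ *+ r]mulr_natr.
    by rewrite -rq; ring.
  by apply: ler_sum => l _; move: (ab l) => /andP[]; nra.
have co l : csum u (@part n r) (fun=> 1) l = a l.
  rewrite /csum /a /ysize -sum1dep_card natr_sum; exact: eq_bigl.
have out : \sum_l (outer w v (@part n r) l)%:R * a l = n%:R - 1 - a (part w) - a (part v).
  rewrite -asum (bigD1 (part w)) //= [X in X - _ - _](bigD1 (part w)) //=.
  rewrite (bigD1 (part v)) 1?eq_sym //= [X in _ = _ + X - _ - _](bigD1 (part v)) 1?eq_sym //=.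
  rewrite /outer !eqxx /= andbF !mul0r !add0r.
  rewrite (eq_bigr a) => [|l ->]; last by rewrite mul1r.
  by ring.
have Q : qform (@edge (Y_graph u w v)) (fun=> 1 : R) =
    (n%:R - 1) ^+ 2 - \sum_l a l ^+ 2 - 2 + 2 * (n%:R + 1 - a (part w) - a (part v)).
  rewrite (_ : qform _ _ = qform (yrel (@part n r) u w v) (fun=> 1)); last first.
    by apply: eq_bigr => x _; apply: eq_bigr => y _; rewrite (Y_edge (ltnW r3) Y).
  rewrite (qform_yrel uw uv wv) //.
  rewrite (eq_bigr a) => [|l _]; last exact: co.
  rewrite [\sum_l csum _ _ _ l ^+ 2](eq_bigr (fun l => a l ^+ 2)) => [|l _]; last by rewrite co.
  rewrite [X in _ + _ * (_ + X)](eq_bigr (fun l => (outer w v (@part n r) l)%:R * a l)) => [|l _]; last by rewrite co.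
  rewrite asum out; ring.
have H := @rayleigh R (Y_graph u w v) (ltac:(by rewrite /= cn)) (fun=> 1).
have one : \sum_(a : Y_graph u w v) (1 : R) ^+ 2 = n%:R by rewrite sumr_const /= cn expr1n.
rewrite Q one in H.
have nR : 40 * r%:R <= n%:R :> R by rewrite -natrM ler_nat.
have nR0 : 0 < n%:R :> R by rewrite ltr0n.
rewrite -(ler_pM2r nR0); apply: le_trans H.
move: (ab (part w)) (ab (part v)) => /andP[_ hw] /andP[_ hv].
move: sqs hw hv nR rq r3R; move: (\sum_l _) (a (part w)) (a (part v)) => s aw av.
by nra.
Qed.
End YBound.

(** * Structure of extremal graphs *)

Lemma ysize_nsize (T : finType) r (c : T -> 'I_r) u w v l :
  u != w -> u != v -> c w != c v -> ysize c u l = nsize u w v c l + ~~ outer w v c l.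
Proof.
move=> uw uv cwv; rewrite /ysize /outer negb_and !negbK.
have wv : w != v by apply: contraNneq cwv => ->.
have W : #|[set x | (x != u) && (c x == l)] :&: [set w]| = (l == c w).
  case: eqVneq => [->|lw].
    rewrite (_ : _ :&: _ = [set w]) ?cards1 //; apply/setP => x; rewrite !inE andbC.
    by case: eqVneq => //= ->; rewrite eqxx andbT eq_sym.
  by apply: eq_card0 => x; rewrite !inE andbC; case: eqVneq => //= ->; rewrite [c w == _]eq_sym (negPf lw) andbF.
have V : #|([set x | (x != u) && (c x == l)] :\: [set w]) :&: [set v]| = (l == c v).
  case: eqVneq => [->|lv].
    rewrite (_ : _ :&: _ = [set v]) ?cards1 //; apply/setP => x; rewrite !inE andbC.
    by case: eqVneq => //= ->; rewrite eqxx andbT [v == w]eq_sym wv eq_sym.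
  by apply: eq_card0 => x; rewrite !inE andbC; case: eqVneq => //= ->; rewrite [c v == _]eq_sym (negPf lv) !andbF.
rewrite -(cardsID [set w]) W -(cardsID [set v] (_ :\: _)) V.
have -> : (l == c w) || (l == c v) = (l == c w) + (l == c v) :> nat.
  case: (eqVneq l (c w)) => [->|_]; first by rewrite (negPf cwv).
  by case: eqP.
rewrite addnA addnC; congr (_ + _); apply: eq_card => x.
by rewrite !inE /nonspecial /= -!andbA; case: (x == u); case: (x == w); case: (x == v).
Qed.

(** The limit of the Perron entry at the critical vertex, where rho x is
    about n - 2 q while rho is about n - q. *)
Lemma partite_ratio (R : realType) (s n q : R) : (3 <= s -> s * q = n ->
  [/\ 0 <= (s - 2) / (s - 1), (s - 2) / (s - 1) <= 1 & (s - 2) / (s - 1) * (n - q) = n - 2 * q])%R.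
Proof.
move=> s3 <-; have s1 : (0 < s - 1)%R by lra.
split; first by rewrite divr_ge0 ?ltW //; lra.
  by rewrite ler_pdivrMr //; lra.
by field; rewrite gt_eqF.
Qed.

Section Structure.
Variable R : realType.
Local Open Scope ring_scope.
Variables (F G : sgraph) (r t : nat).
Hypotheses (r3 : (2 < r)%N) (t0 : (0 < t)%N) (tameT : tame (@edge G) r t).
Hypothesis cliqueF : forall H, has_subgraph F H ->
  exists f : 'I_r.+1 -> H, forall i j, i != j -> edge (f i) (f j).
Hypothesis freeF : Defs.free F G.
Hypothesis ncol : ~ exists k : G -> 'I_r, forall a b, edge a b -> k a != k b.
Local Notation n := (#|G|%:R : R).
Local Notation q := (n / r%:R).
Local Notation rho := (spectral_radius (adjacency R G)).
Hypothesis rhoge : n - q - 1 <= rho.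
Hypothesis ext : forall (e' : rel G) (s : symmetric e') (i : irreflexive e'),
  Defs.free F (SGraph s i) ->
  ~ (exists k : G -> 'I_r, forall a b, e' a b -> k a != k b) ->
  forall y : G -> R, qform e' y <= rho * \sum_a y a ^+ 2.
Variables (eps0 eps : R) (N1 D : nat).
Hypothesis colored : forall S : {set G}, (N1 <= #|S|)%N ->
  (forall v, v \in S -> #|S|%:R - #|S|%:R / r%:R - eps0 * #|S|%:R <= (deg_in (@edge G) S v)%:R) ->
  exists c : G -> 'I_r, proper_on (@edge G) S c.
Hypotheses (eps_gt0 : 0 < eps) (eps3 : eps <= 1 / 3) (eps_le : eps <= eps0).
Hypothesis nbig : N1%:R + 2 / eps + 1 <= eps / 2 * n.
Hypothesis D_ge : eps * n + 2 / eps <= D%:R.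
(** Bounds the deviation of rho x from its main term once one vertex has
    left the core; the added 1 is the slack that [critical_structure] asks for. *)
Definition exact_err := (30 * r ^ 2 * (core_const r t * D.+1) + 1)%N.
Local Notation D3 := exact_err.
Hypothesis small1 : #|F|%:R * (missing r D).+1%:R < q - core_err R r t D.
Hypothesis small2 : r%:R * core_err R r t D <= eps0 * n.
Hypothesis small3 : 144 * r%:R ^+ 4 * core_err R r t D.+1 <= q.
Hypothesis small4 : 4 * r%:R * core_err R r t D3 <= q.
Hypothesis small5 : 80 * r%:R * D3%:R <= n.

Let r3R : 3 <= r%:R :> R. Proof. by rewrite ler_nat. Qed.
Let rqE : r%:R * q = n. Proof. exact: (@rq R r (ltnW r3) n). Qed.
Let eps2 : 0 < 2 / eps. Proof. by rewrite divr_gt0. Qed.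
Let n_gt0 : 0 < n.
Proof. by move: nbig eps2 eps_gt0 (ler0n R N1); nra. Qed.
Let D0 : (0 < D)%N.
Proof. rewrite -(ltr_nat R); move: D_ge eps2 eps_gt0 n_gt0; nra. Qed.

Lemma near_core : exists S : {set G}, [/\ n - D%:R <= #|S|%:R,
  forall v, v \in S -> n - q - D%:R <= (deg_in (@edge G) S v)%:R &
  exists c : G -> 'I_r, proper_on (@edge G) S c].
Proof.
pose al : R := 1 - r%:R^-1.
have ri : r%:R * r%:R^-1 = 1 :> R by rewrite mulfV // gt_eqF // (lt_le_trans _ r3R).
have ri0 : 0 < r%:R^-1 :> R by rewrite invr_gt0 (lt_le_trans _ r3R).
have ri3 : 3 * r%:R^-1 <= 1 :> R by rewrite -[leRHS]ri ler_pM2r.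
have al23 : 2 / 3 <= al by rewrite /al; lra.
have al1 : al <= 1 by rewrite /al; lra.
have core (S : {set G}) : (N1 <= #|S|)%N ->
    (forall v, v \in S -> (al - eps) * #|S|%:R <= (deg_in (@edge G) S v)%:R) ->
    exists c : G -> 'I_r, proper_on (@edge G) S c.
  move=> NS dS; apply: colored NS _ => v /dS; apply: le_trans.
  have := ler_wpM2r (ler0n R #|S|) eps_le; rewrite /al; lra.
have full : rhoS R (@edge_sym G) (@edge_irr G) setT = rho.
  have G0 : (0 < #|G|)%N by rewrite -(ltr0n R).
  apply: (@iso_spectral R (induced (@edge_sym G) (@edge_irr G) setT) G) => //.
  exists id; first by exists id.
  move=> x y; apply/esym; have := in_setT (y : G); have := in_setT (x : G) => xT yT.
  by apply: etrans (_ : [&& @edge G x y, (x : G) \in setT & (y : G) \in setT] = _) => //; rewrite xT yT !andbT.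
have {full}[S [Sge degS cS]] := dense_core (symE := @edge_sym G) (irrE := @edge_irr G)
  (ltnW (ltnW r3)) erefl al23 eps_gt0 eps3 core nbig
  (ltac:(by rewrite full; apply: le_trans rhoge; rewrite /al; lra)).
exists S; split=> //; first by move: D_ge eps_gt0 n_gt0 Sge; nra.
move=> v /degS; apply: le_trans.
have S0 : #|S|%:R <= n by rewrite ler_nat max_card.
have al0 : 0 <= al by move: al23; lra.
have h1 := ler_wpM2l al0 Sge; have h2 := ler_wpM2l (ltW eps_gt0) S0.
have h3 := ler_wpM2r (ltW eps2) al1.
move: D_ge h1 h2 h3; rewrite /al; move: (2 / eps) => e; lra.
Qed.

Definition size_balance (c : G -> 'I_r) u w v := [/\
  forall k l, outer w v c k -> outer w v c l -> (nsize u w v c k <= (nsize u w v c l).+1)%N,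
  forall k l, ~~ outer w v c k -> outer w v c l -> (nsize u w v c k < nsize u w v c l)%N,
  forall k l, outer w v c k -> ~~ outer w v c l -> (nsize u w v c k <= (nsize u w v c l).+2)%N &
  forall k l, ~~ outer w v c k -> ~~ outer w v c l -> (nsize u w v c k <= (nsize u w v c l).+1)%N].

(** The critical vertex z is found with the core S0. The core is then
    replaced by S0 minus z with the colouring A of G - z, at the cost of D + 1
    for D; the estimates near z give the exact structure, and those for x the
    sizes. *)
Lemma extremal_sizes : exists (c : G -> 'I_r) u w v,
  [/\ u != w, u != v, c w != c v, forall a b, edge a b = yrel c u w v a b & size_balance c u w v].
Proof.
have G0 : (0 < #|G|)%N by rewrite -(ltr0n R).
have [x [x0 x1 xmax xE]] := @perron R G G0.
have [S0 [Sge degS [c0 pS]]] := near_core.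
have E1 : 1 <= core_err R r t D by have := @Ebig R r t r3 D D0; move: D0; rewrite -(ltr_nat R); lra.
have EE : core_err R r t D.+1 = core_err R r t D + (core_const r t)%:R by rewrite /core_err -natr1; ring.
have K0 : 0 <= (core_const r t)%:R :> R by [].
have r4 : 1 <= r%:R ^+ 3 :> R by rewrite exprn_ege1 //; move: r3R; lra.
have Eq1 : 2 * r%:R * core_err R r t D.+1 <= q.
  apply: le_trans small3; rewrite ler_wpM2r //; first by rewrite EE; lra.
  by rewrite exprS; move: r3R r4; nra.
have Eq0 : 2 * r%:R * core_err R r t D <= q.
  by apply: le_trans Eq1; rewrite EE; move: (_%:R) K0 => K K0; rewrite mulrDr lerDl !mulr_ge0.
have [z [A properz zmin]] : exists z, exists2 A : G -> 'I_r,
    proper_on (@edge G) ([set: G] :\ z) A & forall a, x z <= x a.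
  apply: (exists_critical r3 t0 tameT freeF ncol x0 x1 xmax xE rhoge ext D0 Sge degS pS Eq0 small1).
  move=> degall; apply: colored.
    rewrite -(ler_nat R) cardsT; move: nbig eps2 eps3 n_gt0; move: (2 / eps) => e; nra.
  move=> v _; rewrite cardsT; apply: le_trans (degall v); move: small2; lra.
pose S := S0 :\ z.
have zS : z \notin S by rewrite !inE eqxx.
have cS : (#|S0| <= #|S|.+1)%N by rewrite (cardsD1 z S0); case: (_ \in _).
have Dn : D.+1%:R = D%:R + 1 :> R by rewrite -natr1.
have Sge' : n - D.+1%:R <= #|S|%:R.
  by move: Sge cS; rewrite Dn -(ler_nat R) -natr1; lra.
have degS' v : v \in S -> n - q - D.+1%:R <= (deg_in (@edge G) S v)%:R.
  rewrite inE => /andP[_ /degS]; have : (deg_in (@edge G) S0 v <= (deg_in (@edge G) S v).+1)%N.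
    rewrite /deg_in (cardsD1 z) -addn1 addnC leq_add //; last by case: (_ \in _).
    by apply: subset_leq_card; apply/subsetP => b; rewrite !inE -!andbA.
  by rewrite Dn -(ler_nat R) -natr1; lra.
have pS' : proper_on (@edge G) S A.
  by move=> a b; rewrite !inE => /andP[az _] /andP[bz _]; apply: properz; rewrite !inE ?az ?bz.
have big := class_big r3 t0 tameT x0 x1 xmax xE rhoge (ltn0Sn D) Sge' degS' pS' Eq1.
have zle := critical_le r3 t0 tameT cliqueF ncol x0 x1 xmax xE rhoge ext (ltn0Sn D) Sge' degS' pS' Eq1 zS properz zmin small3.
have zge := critical_ge r3 t0 tameT cliqueF ncol x0 x1 xmax xE rhoge ext (ltn0Sn D) Sge' degS' pS' Eq1 zS properz zmin small3.
have dge := @noncritical_ge _ _ _ _ _ r3 t0 tameT cliqueF ncol _ _ x0 x1 xmax xE rhoge ext _ _ _ (ltn0Sn D) Sge' degS' pS' Eq1 _ zS properz zmin small3.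
have rle := rho_le r3 t0 tameT (ltn0Sn D) Sge' degS' pS' x0 x1 xmax xE.
have D3E : D3%:R = 30 * r%:R ^+ 2 * core_err R r t D.+1 + 1 by rewrite /exact_err natrD; congr (_ + _); rewrite natrM; congr (_ * _); rewrite ?natrM ?natrX.
have E1' : 1 <= core_err R r t D.+1 by rewrite EE; lra.
have r2 : 1 <= r%:R ^+ 2 :> R by rewrite exprn_ege1 //; move: r3R; lra.
have D30 : (0 < D3)%N by rewrite /exact_err addn1.
have D31 : 1 <= D3%:R :> R by rewrite ler1n.
have n80 : 80 * r%:R <= n.
  by apply: le_trans small5; rewrite -[leLHS]mulr1 ler_wpM2l // mulr_ge0.
have rho0 : n / 2 <= rho.
  have q3 : 3 * q <= n by rewrite -[leRHS]rqE ler_wpM2r // divr_ge0.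
  by move: rhoge n80 q3 r3R; lra.
have [w [v [zw zv Awv eyrel]]] : exists w v, [/\ z != w, z != v, A w != A v &
    forall a b, edge a b = yrel A z w v a b].
  apply: (critical_structure r3 t0 tameT _ x0 x1 xE properz D30 (critical_nbr ncol properz)).
  - by move: rho0 n_gt0; lra.
  - by move=> d /dge; rewrite D3E; lra.
  - by rewrite D3E; move: zge r2 E1'; nra.
  - by rewrite D3E; move: zle r2 E1'; nra.
  - exact: small4.
  move=> w v zw zv Awv; apply: (ext_yrel cliqueF ext zw zv Awv) => l; exact: ltnW.
have wv : w != v by apply: contraNneq Awv => ->.
have pick := class_pick z w v (fun l => ltnW (big l)).
have ray m l : nonspecial z w v m -> l != A m -> forall y : G -> R,
    qform (yrel (fun a => if a == m then l else A a) z w v) y <= rho * \sum_a y a ^+ 2.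
  move=> /and3P[mz mw mv] lm; apply: (ext_yrel cliqueF ext zw zv).
    by rewrite ![_ == m]eq_sym (negPf mw) (negPf mv).
  move=> k; have h : (3 < #|[set a | A a == k] :\ m|)%N.
    by move: (big k); rewrite (cardsD1 m); case: (_ \in _) => //; apply: ltnW.
  apply: leq_trans h _; apply: subset_leq_card; apply/subsetP => b.
  by rewrite !inE => /andP[/negPf ->].
have filled l : exists2 m, nonspecial z w v m & A m = l.
  by have [m [Am mz mw mv]] := pick l; exists m; rewrite // /nonspecial /= mz mw mv.
have rho_gt0 : 0 < rho by move: rho0 n_gt0; lra.
have rle' : rho <= n - q + D3%:R.
  by apply: le_trans rle _; rewrite D3E Dn; move: r2 E1' (ler0n R D); nra.
pose eta := 4 * D3%:R / n.
have eta0 : 0 <= eta by rewrite /eta divr_ge0 // mulr_ge0.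
have eta_rho : 2 * D3%:R <= eta * rho.
  have -> : 2 * D3%:R = eta * (n / 2) by rewrite /eta; field; rewrite gt_eqF.
  exact: ler_wpM2l.
have eta_small : 20 * r%:R * eta <= 1.
  rewrite /eta mulrA ler_pdivrMr // mul1r; apply: le_trans small5; lra.
have rho_big : 20 * r%:R <= rho by move: rho0 n80; lra.
have xyE a b : edge a b = yrel A z w v a b by [].
have xE' a : rho * x a = \sum_(b | yrel A z w v a b) x b by rewrite xE; apply: eq_bigl.
have xge a : a != z -> 1 - eta <= x a.
  move=> /dge h; rewrite -(ler_pM2l rho_gt0).
  by move: h rle' eta_rho; rewrite D3E; lra.
pose th : R := (r%:R - 2) / (r%:R - 1).
have [th0 th1 thX] : [/\ 0 <= th, th <= 1 & th * (n - q) = n - 2 * q] := partite_ratio r3R rqE.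
have xzge : th - eta <= x z.
  rewrite -(ler_pM2l rho_gt0).
  have : rho * th <= (n - q + D3%:R) * th by rewrite ler_wpM2r.
  have : D3%:R * th <= D3%:R by rewrite -[leRHS]mulr1 ler_wpM2l.
  by move: zge thX eta_rho; rewrite D3E; move: r2 E1'; nra.
have xzle : x z <= th + eta.
  rewrite -(ler_pM2l rho_gt0).
  have : (n - q - 1) * th <= rho * th by rewrite ler_wpM2r.
  by move: zle thX eta_rho D31; rewrite D3E; move: r2 E1'; nra.
exists A, z, w, v; split=> //; split=> k l.
- exact: (size_outer zw zv wv Awv r3 xE' ray filled eta0 eta_small rho_big x1 xge).
- exact: (size_special_lt zw zv wv Awv r3 xE' ray filled eta0 eta_small rho_big x1 xge xzge xzle).
- exact: (size_outer_special zw zv wv Awv r3 xE' ray filled eta0 eta_small rho_big x1 xge xzge xzle).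
- exact: (size_special zw zv wv Awv r3 xE' ray filled eta0 eta_small rho_big x1 xge xzge xzle).
Qed.

Lemma extremal_balanced : exists (c : G -> 'I_r) u w v,
  [/\ u != w, u != v, forall a b, edge a b = yrel c u w v a b &
      balanced_ends (ysize c u) (c w) (c v)].
Proof.
have [c [u [w [v [uw uv cwv eyrel [oo so os ss]]]]]] := extremal_sizes.
have ys l := ysize_nsize l uw uv cwv.
have bal k l : (ysize c u k <= (ysize c u l).+1)%N.
  rewrite !ys; case ok: (outer w v c k); case ol: (outer w v c l); rewrite /= ?addn0 ?addn1.
  - exact: oo.
  - exact: os (negbT ol).
  - by apply: leqW; apply: so (negbT ok) ol.
  - by rewrite ltnS; apply: ss (negbT ok) (negbT ol).
have low k l : ~~ outer w v c k -> outer w v c l -> (ysize c u k <= ysize c u l)%N.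
  by move=> ok ol; rewrite !ys ok ol addn0 addn1; apply: so.
have nw : ~~ outer w v c (c w) by rewrite /outer eqxx.
have nv : ~~ outer w v c (c v) by rewrite /outer eqxx andbF.
have cvw : c v != c w by rewrite eq_sym.
case: (leqP (ysize c u (c w)) (ysize c u (c v))) => wlev.
  exists c, u, w, v; split=> //; split=> // l.
    case: (boolP (outer w v c l)) => [|]; first exact: low.
    by rewrite /outer negb_and !negbK => /orP[]/eqP->.
  move=> lw; case: (boolP (outer w v c l)) => [|]; first exact: low.
  by rewrite /outer lw negbK => /eqP->.
exists c, u, v, w; split=> //; first by move=> a b; rewrite eyrel yrel_swap.
split=> // l.
  case: (boolP (outer w v c l)) => [|]; first exact: low.
  by rewrite /outer negb_and !negbK => /orP[]/eqP->; rewrite // ltnW.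
move=> lv; case: (boolP (outer w v c l)) => [|]; first exact: low.
by rewrite /outer lv andbT negbK => /eqP->.
Qed.

End Structure.

(** * Choice of constants *)

Section Scales.
Variable R : realType.
Local Open Scope ring_scope.

(** eps is the loss in minimum degree and D the resulting number of
    exceptional vertices or missing edges; D is linear in n with a slope that
    can be made smaller than any 1 / M. *)
Lemma scales (eps0 : R) (M N1 : nat) : 0 < eps0 ->
  exists eps, [/\ 0 < eps, eps <= 1 / 3, eps <= eps0 & exists n1, forall n, (n1 <= n)%N ->
    exists D, [/\ N1%:R + 2 / eps + 1 <= eps / 2 * n%:R, eps * n%:R + 2 / eps <= D%:R & (M * D <= n)%N]].
Proof.
move=> e0; pose m : R := M%:R; have m0 : 0 <= m by [].
(* The slope 2 eps of D times M is at most 2 / 3, which leaves room for the rounding. *)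
pose eps := Num.min eps0 (3 * m + 3)^-1.
have eps_gt0 : 0 < eps by rewrite lt_min e0 invr_gt0; lra.
have eM : eps * (3 * m + 3) <= 1.
  by rewrite -ler_pdivlMr ?mul1r; [rewrite ge_min lexx orbT | lra].
exists eps; split=> //; [by nra | by rewrite ge_min lexx |].
pose C := 2 / eps * (N1%:R + 2 / eps + 1) + 3 * m.
exists (Num.truncn C).+1 => n nC.
have Cn : C <= n%:R.
  by apply: ltW; apply: lt_le_trans (truncnS_gt C) _; rewrite ler_nat.
have e2 : 0 < 2 / eps by rewrite divr_gt0.
have ee : eps * (2 / eps) = 2 by rewrite mulrC divfK // gt_eqF.
have N0 : 0 <= N1%:R :> R by [].
have eC : eps * C <= eps * n%:R by rewrite ler_pM2l.
have eCE : eps * C = 2 * (N1%:R + 2 / eps + 1) + 3 * m * eps by rewrite mulrDr mulrA ee; ring.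
exists (Num.truncn (2 * (eps * n%:R))).+1; split.
- by move: eC eCE (mulr_ge0 m0 (ltW eps_gt0)); lra.
- apply: le_trans (ltW (truncnS_gt _)); move: eC eCE (mulr_ge0 m0 (ltW eps_gt0)); lra.
rewrite -(ler_nat R) natrM -natr1 -/m.
have en : 0 <= 2 * (eps * n%:R) by rewrite !mulr_ge0 // ltW.
have /andP[tr _] := truncn_itv en.
have h1 := ler_wpM2l m0 tr; have h2 := ler_wpM2r (ler0n R n) eM.
have h3 : 3 * m <= n%:R.
  by apply: le_trans Cn; rewrite /C lerDr mulr_ge0 ?ltW //; lra.
move: en h1 h2 h3; move: (Num.trunc _)%:R => T; lra.
Qed.

Lemma small_errors r t f (eps0 : R) : (0 < r)%N -> 0 < eps0 ->
  exists M, forall n D, (0 < D)%N -> (M * D <= n)%N ->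
  [/\ f%:R * (missing r D).+1%:R < n%:R / r%:R - core_err R r t D,
      r%:R * core_err R r t D <= eps0 * n%:R,
      144 * r%:R ^+ 4 * core_err R r t D.+1 <= n%:R / r%:R,
      4 * r%:R * core_err R r t (exact_err r t D) <= n%:R / r%:R &
      80 * r%:R * (exact_err r t D)%:R <= n%:R :> R].
Proof.
move=> r0 e0; set K := core_const r t.
pose c := (Num.truncn ((r * K)%N%:R / eps0)).+1.
have cP : (r * K)%N%:R <= eps0 * c%:R.
  by rewrite mulrC -ler_pdivrMr // ltW // truncnS_gt.
pose L := (30 * r ^ 2 * (K * 2) + 1)%N.
exists (r * (f * r.+2 + K + 1) + c + 288 * r ^ 5 * K + 4 * r ^ 2 * (K * L) + 80 * r * L)%N.
set M := (_ + _)%N; move=> n D D0 MD.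
have le C : (C <= M)%N -> (C * D <= n)%N by move=> CM; apply: leq_trans MD; rewrite leq_mul.
have rR : 0 < r%:R :> R by rewrite ltr0n.
have XL : (exact_err r t D <= L * D)%N.
  by rewrite /exact_err -/K /L mulnDl mul1n leq_add // -!mulnA !leq_mul //; nia.
split.
- rewrite ltrBrDr /core_err -/K -natrM -natrM -natrD ltr_pdivlMr // -natrM ltr_nat /missing.
  apply: leq_trans (_ : r * (f * r.+2 + K + 1) * D <= n)%N; last by apply: le; rewrite /M; lia.
  have : (f <= f * D)%N by apply: leq_pmulr.
  have : (r <= r * D)%N by apply: leq_pmulr.
  nia.
- rewrite /core_err -/K mulrA -natrM; apply: le_trans (_ : eps0 * (c * D)%N%:R <= _).
    by rewrite [X in _ <= _ * X]natrM mulrA ler_wpM2r.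
  by rewrite ler_pM2l // ler_nat le // /M; lia.
- rewrite ler_pdivlMr // /core_err -/K -natrX -!natrM ler_nat.
  apply: leq_trans (_ : 288 * r ^ 5 * K * D <= n)%N; last by apply: le; rewrite /M; lia.
  rewrite (expnSr r 4); move: (r ^ 4)%N => r4.
  have : (K * D.+1 <= K * (2 * D))%N by rewrite leq_mul //; lia.
  by move=> h; apply: leq_trans (leq_mul (leq_mul (leqnn (144 * r4)) h) (leqnn r)) _; lia.
- rewrite ler_pdivlMr // /core_err -/K -!natrM ler_nat.
  apply: leq_trans (_ : 4 * r ^ 2 * (K * L) * D <= n)%N; last by apply: le; rewrite /M; lia.
  apply: leq_trans (leq_mul (leq_mul (leqnn (4 * r)) (leq_mul (leqnn K) XL)) (leqnn r)) _.
  by rewrite (_ : r ^ 2 = r * r)%N //; lia.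
rewrite -!natrM ler_nat; apply: leq_trans (leq_mul (leqnn (80 * r)) XL) _.
by rewrite mulnA le // /M; lia.
Qed.

End Scales.

(** * Extremal graphs are isomorphic to Y_r(n) *)

Lemma extremal_iso_Y (R : realType) r (t : (r - 2).-tuple nat) : 2 < r -> all (leq 1) t ->
  exists n0, forall n, n0 <= n -> forall u w v : turan n r, Y_choice u w v ->
  forall G, EX_rho R r n (complete_multipartite [tuple of [:: 1, 1, 1 & t]]) G ->
  isomorphic G (Y_graph u w v).
Proof.
move=> r3 t1; set F := complete_multipartite _; pose tm := (\max_(i <- t) i).+1.
have tm0 : 0 < tm by [].
have tle i : i \in t -> i <= tm by move=> it; apply: leqW; apply: (leq_bigmax_seq (F := id)).
have [eps0 e0 [N1 colored]] := @min_degree_colorable R r tm (ltnW r3) tm0.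
have [M small] := @small_errors R r tm #|F| eps0 (ltnW (ltnW r3)) e0.
have [eps [eps_gt0 eps3 eps_le [n1 scale]]] := scales M N1 e0.
exists (n1 + 40 * r) => n n_ge u w v Y G [[cG chG fG] maxG].
have [n_n1 n40 n5 n0] : [/\ n1 <= n, 40 * r <= n, r * 5 <= n & 0 < n] by split; lia.
have [D [nbig D_ge MD]] := scale n n_n1.
have eps2 : (0 < 2 / eps)%R by rewrite divr_gt0.
have D0 : 0 < D.
  by rewrite -(ltr_nat R); apply: lt_le_trans D_ge; rewrite ltr_wpDl // mulr_ge0 // ltW.
have [small1 small2 small3 small4 small5] := small n D D0 MD.
have tameG : tame (@edge G) r tm := free_tame fG tle.
have ncol : ~ exists k : G -> 'I_r, forall a b, edge a b -> k a != k b.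
  by move/colorableP; apply/negP; rewrite -chromatic_lt.
have cGR : (n%:R = #|G|%:R :> R)%R by rewrite cG.
have rhoge : (#|G|%:R - #|G|%:R / r%:R - 1 <= spectral_radius (adjacency R G))%R.
  rewrite -cGR; exact: le_trans (Y_rho R r3 Y n40) (maxG _ (Y_admissible r3 Y t1 n5)).
have ext (e' : rel G) (s : symmetric e') (i : irreflexive e') : Defs.free F (SGraph s i) ->
    ~ (exists k : G -> 'I_r, forall a b, e' a b -> k a != k b) ->
    forall y : G -> R, (qform e' y <= spectral_radius (adjacency R G) * \sum_a y a ^+ 2)%R.
  move=> fH nH y; have G0 : 0 < #|G| by rewrite cG.
  apply: le_trans (@rayleigh R (SGraph s i) G0 y) _.
  apply: ler_wpM2r; first by apply: sumr_ge0 => a _; apply: sqr_ge0.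
  by apply: maxG; split=> //; rewrite chromatic_lt; apply/negP => /colorableP.
rewrite cGR in small1 small2 small3 small4 small5 nbig D_ge.
have [c [u' [w' [v' [uw uv eyrel bal]]]]] := extremal_balanced r3 tm0 tameG
  (forbidden_clique r3 t1) fG ncol rhoge ext (colored _ _ (@edge_sym G) tameG)
  eps_gt0 eps3 eps_le nbig D_ge small1 small2 small3 small4 small5.
have r2 := ltnW r3; have uwY : u != w by case: Y.
have [h hb hP] := yrel_iso uw uv uwY (choice_uv r2 Y)
  (etrans cG (esym (card_turan n (ltnW r2)))) bal (Y_balanced r2 Y n0).
by exists h => // a b; rewrite (Y_edge r2 Y) hP eyrel.
Qed.

(** Up to isomorphism there are finitely many graphs of order n, namely
    those on the vertices of the Turan graph. *)
Lemma extremal_exists (R : realType) r n (F G : sgraph) : 0 < r -> 0 < n ->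
  admissible r n F G -> exists H, EX_rho R r n F H.
Proof.
move=> r0 n0 admG; pose T := turan n r.
pose gr (e : {ffun T * T -> bool}) := graph_of_rel (fun a b => e (a, b)).
have represent H : admissible r n F H -> exists e, isomorphic (gr e) H.
  move=> [cH _ _]; have cTH : #|T| = #|H| by rewrite cH card_turan.
  have [f fb _] := @fiber_bijection unit T H (fun=> tt) (fun=> tt)
    (fun k => ltac:(by case: k; rewrite (eq_card (B := T)) ?(eq_card (B := H)) // => x; rewrite inE)).
  pose e := [ffun p : T * T => edge (f p.1) (f p.2)].
  have eE a b : e (a, b) = edge (f a) (f b) by rewrite ffunE.
  exists e; exists f => // a b.
  have -> : @edge (gr e) a b = (a != b) && (e (a, b) || e (b, a)) by [].
  rewrite !eE [edge (f b) _]edge_sym orbb.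
  by case: eqVneq => //= ->; rewrite edge_irr.
have [e0 iso0] := represent G admG.
pose P e := boolp.asbool (admissible r n F (gr e)).
have P0 : P e0 by apply/boolp.asboolP; apply: iso_admissible (iso_sym iso0) admG.
pose rho e := spectral_radius (adjacency R (gr e)).
case: (@Order.TotalTheory.arg_maxP _ _ _ e0 P rho P0) => e /boolp.asboolP adm max.
exists (gr e); split=> // H admH; have [e' iso'] := represent H admH.
rewrite -(iso_spectral R _ iso').
  by apply: max; apply/boolp.asboolP; apply: iso_admissible (iso_sym iso') admH.
by rewrite (iso_card iso'); case: admH => ->.
Qed.

Theorem theorem4p1 (R : realType) (r : nat) (t : (r - 2).-tuple nat)
    (hr : 3 <= r) (ht1 : all (leq 1) t) (ht : sorted leq t) :
  exists n0 : nat, forall n : nat, n0 <= n ->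
    forall u w v : turan n r, Y_choice u w v ->
    forall G : sgraph,
      EX_rho R r n (complete_multipartite [tuple of [:: 1, 1, 1 & t]]) G <->
      isomorphic G (Y_graph u w v).
Proof.
have [n0 isoY] := extremal_iso_Y R hr ht1.
exists (n0 + r * 5) => n n_ge u w v Y G; split; first by apply: isoY; rewrite // (leq_trans _ n_ge) ?leq_addr.
have n_gt0 : 0 < n by lia.
have n_n0 : n0 <= n by lia.
move=> GY; have admY := Y_admissible hr Y ht1 (ltac:(lia)).
have admG := iso_admissible (iso_sym GY) admY.
have [H extH] := extremal_exists R (ltnW (ltnW hr)) n_gt0 admG.
have HG : isomorphic H G := iso_trans (isoY n n_n0 u w v Y H extH) (iso_sym GY).
have [[cH _ _] maxH] := extH.
split=> // K /maxH; rewrite (iso_spectral R _ HG) // cH //.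
Qed.
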